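(* Let $R=\bigoplus_{i\ge0}R_i$ be a commutative Noetherian $\mathbb N$-graded Gorenstein ring with $R_0=k$ an algebraically closed field of characteristic zero, and assume that $R$ is a graded isolated singularity. Let $M$ and $N$ be graded Cohen-Macaulay $R$-modules. Then $[M,X]=[N,X]$ for every graded Cohen-Macaulay $R$-module $X$ if and only if $M\cong N$ (as graded $R$-modules). In particular, the relation $\leq_{hom}$ is a partial order on (isomorphism classes of) graded Cohen-Macaulay $R$-modules.
   Context: Let $\mathfrak m=\bigoplus_{i>0}R_i$. Let $\mathrm{mod}^{\mathbb Z}(R)$ be the category of finitely generated $\mathbb Z$-graded $R$-modules with degree-preserving homomorphisms; $\mathrm{Hom}_R(M,N)$ denotes morphisms in this category, and $[M,N]=\dim_k\mathrm{Hom}_R(M,N)$, which is finite. The shift $M(i)$ is defined by $M(i)_n=M_{n+i}$; ${}^*\mathrm{Hom}_R(M,N)=\bigoplus_{i\in\mathbb Z}\mathrm{Hom}_R(M,N(i))$, with derived functors ${}^*\mathrm{Ext}^i_R$. A module $M\in\mathrm{mod}^{\mathbb Z}(R)$ is graded Cohen-Macaulay if ${}^*\mathrm{Ext}^i_R(R/\mathfrak m,M)=0$ for all $i<\dim R$. $R$ is a graded isolated singularity if the homogeneous localization $R_{(\mathfrak p)}$ is regular for every graded prime ideal $\mathfrak p\ne\mathfrak m$. For graded Cohen-Macaulay modules $M,N$, $M\leq_{hom}N$ means $[M,X]\le[N,X]$ for every graded Cohen-Macaulay $R$-module $X$. *)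

(* Defs.v *)
From HB Require Import structures.
From mathcomp Require Import all_boot all_order all_algebra.
From mathcomp Require Import generic_quotient ring_quotient.
From mathcomp Require Import boolp classical_sets.
From mathcomp Require Import ring.

Set Implicit Arguments.
Unset Strict Implicit.
Unset Printing Implicit Defensive.

Import Order.TTheory GRing.Theory Num.Theory.
Local Open Scope ring_scope.
Local Open Scope quotient_scope.

(* ** Localization of a commutative ring *)

Record mulset (A : comNzRingType) := MulSet {
  mulset_pred :> {pred A};
  mulset1 : 1 \in mulset_pred;
  mulset0 : 0 \notin mulset_pred;
  mulsetM : {in mulset_pred &, forall x y, x * y \in mulset_pred} }.

Module Localization.
Section Localization.
Variables (A : comNzRingType) (S : mulset A).

Definition den := {x : A | x \in S}.
Definition frac := (A * den)%type.

Definition den1 : den := exist _ 1 (mulset1 S).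
Definition denM (s t : den) : den :=
  exist _ (sval s * sval t) (mulsetM (valP s) (valP t)).

Definition equiv (x y : frac) : bool :=
  `[< exists2 u, u \in S & u * (x.1 * sval y.2) = u * (y.1 * sval x.2) >].

Lemma equiv_refl : reflexive equiv.
Proof. by move=> x; apply/asboolP; exists 1; rewrite ?mulset1. Qed.

Lemma equiv_sym : symmetric equiv.
Proof.
by move=> x y; apply/asboolP/asboolP => -[u uS e]; exists u.
Qed.

Lemma equiv_trans : transitive equiv.
Proof.
move=> y x z /asboolP[u uS e] /asboolP[v vS f]; apply/asboolP.
exists (u * v * sval y.2).
  by rewrite !mulsetM //; exact: valP.
transitivity (v * sval z.2 * (u * (x.1 * sval y.2))); first by ring.
rewrite e; transitivity (u * sval x.2 * (v * (y.1 * sval z.2))); first by ring.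
by rewrite f; ring.
Qed.

Canonical equiv_rel := EquivRel equiv equiv_refl equiv_sym equiv_trans.

Definition type := {eq_quot equiv}.
#[export]
HB.instance Definition _ := Choice.on type.
#[export]
HB.instance Definition _ : EqQuotient _ equiv type := EqQuotient.on type.

Lemma pi_eqP (x y : frac) :
  reflect (exists2 u, u \in S & u * (x.1 * sval y.2) = u * (y.1 * sval x.2))
          (\pi_type x == \pi_type y).
Proof. by rewrite eqmodE; apply: asboolP. Qed.

Definition addf (x y : frac) : frac :=
  (x.1 * sval y.2 + y.1 * sval x.2, denM x.2 y.2).
Definition oppf (x : frac) : frac := (- x.1, x.2).
Definition mulf (x y : frac) : frac := (x.1 * y.1, denM x.2 y.2).

Definition add := lift_op2 type addf.
Definition opp := lift_op1 type oppf.
Definition mul := lift_op2 type mulf.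
Definition zero : type := \pi_type (0, den1).
Definition one : type := \pi_type (1, den1).

Lemma repr_equiv (x : frac) : exists2 u, u \in S &
  u * (x.1 * sval (repr (\pi_type x)).2) = u * ((repr (\pi_type x)).1 * sval x.2).
Proof.
have /pi_eqP : \pi_type x == \pi_type (repr (\pi_type x)) by rewrite reprK.
by [].
Qed.

Lemma pi_add : {morph \pi_type : x y / addf x y >-> add x y}.
Proof.
move=> x y; unlock add; apply/eqP/pi_eqP.
have [u uS e] := repr_equiv x; have [v vS f] := repr_equiv y.
move: (repr (\pi x)) (repr (\pi y)) e f => x' y' e f /=.
exists (u * v); first by rewrite mulsetM.
transitivity (v * sval y.2 * sval y'.2 * (u * (x.1 * sval x'.2))
            + u * sval x.2 * sval x'.2 * (v * (y.1 * sval y'.2))); first by ring.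
by rewrite e f; ring.
Qed.
Canonical pi_add_morph := PiMorph2 pi_add.

Lemma pi_opp : {morph \pi_type : x / oppf x >-> opp x}.
Proof.
move=> x; unlock opp; apply/eqP/pi_eqP.
have [u uS e] := repr_equiv x; move: (repr _) e => x' e /=.
by exists u; rewrite // !mulNr !mulrN e.
Qed.
Canonical pi_opp_morph := PiMorph1 pi_opp.

Lemma pi_mul : {morph \pi_type : x y / mulf x y >-> mul x y}.
Proof.
move=> x y; unlock mul; apply/eqP/pi_eqP.
have [u uS e] := repr_equiv x; have [v vS f] := repr_equiv y.
move: (repr (\pi x)) (repr (\pi y)) e f => x' y' e f /=.
exists (u * v); first by rewrite mulsetM.
transitivity ((u * (x.1 * sval x'.2)) * (v * (y.1 * sval y'.2))); first by ring.
by rewrite e f; ring.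
Qed.
Canonical pi_mul_morph := PiMorph2 pi_mul.

Lemma eq_pi (x y : frac) :
  x.1 * sval y.2 = y.1 * sval x.2 -> \pi_type x = \pi_type y.
Proof. by move=> e; apply/eqP/pi_eqP; exists 1; rewrite ?mulset1 ?e. Qed.

Lemma addA : associative add.
Proof.
elim/quotW=> x; elim/quotW=> y; elim/quotW=> z; rewrite !piE.
by apply: eq_pi => /=; ring.
Qed.

Lemma addC : commutative add.
Proof.
by elim/quotW=> x; elim/quotW=> y; rewrite !piE; apply: eq_pi => /=; ring.
Qed.

Lemma add0 : left_id zero add.
Proof. by elim/quotW=> x; rewrite /zero !piE; apply: eq_pi => /=; ring. Qed.

Lemma addN : left_inverse zero opp add.
Proof. by elim/quotW=> x; rewrite /zero !piE; apply: eq_pi => /=; ring. Qed.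

#[export]
HB.instance Definition _ := GRing.isZmodule.Build type addA addC add0 addN.

Lemma mulA : associative mul.
Proof.
elim/quotW=> x; elim/quotW=> y; elim/quotW=> z; rewrite !piE.
by apply: eq_pi => /=; ring.
Qed.

Lemma mulC : commutative mul.
Proof.
by elim/quotW=> x; elim/quotW=> y; rewrite !piE; apply: eq_pi => /=; ring.
Qed.

Lemma mul1 : left_id one mul.
Proof. by elim/quotW=> x; rewrite /one !piE; apply: eq_pi => /=; ring. Qed.

Lemma mulDl : left_distributive mul add.
Proof.
elim/quotW=> x; elim/quotW=> y; elim/quotW=> z; rewrite !piE.
by apply: eq_pi => /=; ring.
Qed.

Lemma one_neq0 : one != 0.
Proof.
apply/negP => /pi_eqP[u uS] /=; rewrite !mulr1 mulr0 => u0.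
by move: uS (mulset0 S); rewrite u0 => ->.
Qed.

#[export]
HB.instance Definition _ :=
  GRing.Zmodule_isComNzRing.Build type mulA mulC mul1 mulDl one_neq0.

End Localization.
Module Exports. HB.reexport. End Exports.
End Localization.
Export Localization.Exports.

Definition localization (A : comNzRingType) (S : mulset A) : comNzRingType :=
  Localization.type S.

Section PrimeComplement.
Variables (A : comNzRingType) (p : prime_idealr A).

Lemma prime_compl1 : 1 \in [pred x | x \notin p].
Proof. by rewrite inE idealr1. Qed.

Lemma prime_compl0 : 0 \notin [pred x | x \notin p].
Proof. by rewrite inE negbK idealr0. Qed.

Lemma prime_complM :
  {in [pred x | x \notin p] &, forall x y, x * y \in [pred x | x \notin p]}.
Proof. by move=> x y; rewrite !inE prime_idealrM negb_or => -> ->. Qed.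

Definition prime_compl : mulset A :=
  MulSet prime_compl1 prime_compl0 prime_complM.

End PrimeComplement.

(* ** Noetherian, regular and Gorenstein rings *)

Definition generates (A : comNzRingType) n (g : 'I_n -> A) (I : {pred A}) :=
  forall x, x \in I <-> exists c : 'I_n -> A, x = \sum_i c i * g i.

Definition noetherian (A : comNzRingType) :=
  forall I : idealr A, exists n (g : 'I_n -> A), generates g I.

(* There is a chain p_0 < ... < p_n of prime ideals, i.e. n <= dim A. *)
Definition krull_dim_ge (A : comNzRingType) (n : nat) :=
  exists p : 'I_n.+1 -> prime_idealr A,
    forall i j : 'I_n.+1, (i < j)%N ->
      {subset p i <= p j} /\ ~ {subset p j <= p i}.

Definition krull_dim_eq (A : comNzRingType) (n : nat) :=
  krull_dim_ge A n /\ ~ krull_dim_ge A n.+1.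

Definition regular_local (A : comNzRingType) :=
  noetherian A /\
  exists n : idealr A,
    (forall x, x \notin n <-> exists y, y * x = 1) /\
    exists d (g : 'I_d -> A), krull_dim_eq A d /\ generates g n.

Definition regular_ring (A : comNzRingType) :=
  noetherian A /\
  forall p : prime_idealr A, regular_local (localization (prime_compl p)).

Definition injective_module (A : comNzRingType) (E : lmodType A) :=
  forall (U V : lmodType A) (i : {linear U -> V}) (f : {linear U -> E}),
    injective i -> exists g : {linear V -> E}, forall x, g (i x) = f x.

(* A resolution 0 -> M -> E_0 -> ... -> E_n -> 0 by injective modules *)
Definition finite_injdim (A : comNzRingType) (M : lmodType A) :=
  exists (n : nat) (E : nat -> lmodType A) (e : {linear M -> E 0%N})
         (d : forall i, {linear E i -> E i.+1}),
    [/\ forall i, injective_module (E i),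
        injective e,
        forall y, d 0%N y = 0 <-> exists x, e x = y,
        forall i y, d i.+1 y = 0 <-> exists x, d i x = y
      & forall i, (n < i)%N -> forall y : E i, y = 0].

Definition gorenstein (A : comNzRingType) :=
  noetherian A /\
  forall p : prime_idealr A, finite_injdim (localization (prime_compl p))^o.

(* ** Graded rings and modules *)

(* [V] is the internal direct sum of its additive subgroups [deg i]. *)
Record is_grading (I : eqType) (V : zmodType) (deg : I -> set V) : Prop :=
  IsGrading {
  grading0 : forall i, deg i 0;
  gradingB : forall i x y, deg i x -> deg i y -> deg i (x - y);
  grading_sum : forall x, exists (s : seq I) (c : I -> V),
    [/\ uniq s, forall i, deg i (c i) & x = \sum_(i <- s) c i];
  grading_indep : forall (s : seq I) (c : I -> V),
    uniq s -> (forall i, deg i (c i)) -> \sum_(i <- s) c i = 0 ->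
    forall i, i \in s -> c i = 0 }.

Record gring (k : fieldType) := GRingPack {
  gring_sort :> comAlgType k;
  rdeg : nat -> set gring_sort;
  rdeg_grading : is_grading rdeg;
  rdeg1 : rdeg 0%N 1;
  rdegM : forall i j x y, rdeg i x -> rdeg j y -> rdeg (i + j)%N (x * y) }.

(* Objects of mod^Z(R) *)
Record gmod (k : fieldType) (R : gring k) := GMod {
  gmod_sort :> lmodType R;
  mdeg : int -> set gmod_sort;
  mdeg_grading : is_grading mdeg;
  mdegZ : forall (i : nat) (j : int) a x,
    @rdeg k R i a -> mdeg j x -> mdeg (i%:Z + j) (a *: x);
  gmod_fg : exists n (g : 'I_n -> gmod_sort),
    forall x, exists c : 'I_n -> R, x = \sum_i c i *: g i }.

Section GradedModules.
Variables (k : fieldType) (R : gring k).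
Implicit Types (M N A B X : gmod R).

Definition ghom M N (f : M -> N) :=
  linear f /\ forall i x, mdeg i x -> mdeg i (f x).

Definition giso M N :=
  exists (f : M -> N) (g : N -> M),
    [/\ ghom f, ghom g, cancel f g & cancel g f].

(* The [f i] form a k-basis of Hom_R(M, N). *)
Definition ghom_basis M N d (f : 'I_d -> M -> N) :=
  [/\ forall i, ghom (f i),
      forall c : 'I_d -> k,
        (forall x, \sum_i ((c i)%:A : R) *: f i x = 0) -> forall i, c i = 0
    & forall g : M -> N, ghom g ->
        exists c : 'I_d -> k, forall x, g x = \sum_i ((c i)%:A : R) *: f i x].

(* [M, N]. The default value 0 is only taken if Hom_R(M, N) has infinite
   dimension, which cannot happen when R is Noetherian and R_0 = k. *)
Definition homdim M N : nat :=
  xget 0%N [set d | exists f : 'I_d -> M -> N, ghom_basis f]%classic.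

Section Shift.
Variables (M : gmod R) (i : int).

Definition shift_deg (n : int) : set M := @mdeg _ _ M (n + i).

Lemma shift_grading : is_grading shift_deg.
Proof.
case: (mdeg_grading M) => d0 dB ds di; split=> [n|n x y|x|s c us dc sc j js].
- exact: d0.
- exact: dB.
- have [s [c [us dc ->]]] := ds x.
  exists [seq n - i | n <- s], (fun n => c (n + i)); split.
  + by rewrite map_inj_uniq //; exact: addIr.
  + by move=> n; exact: dc.
  + by rewrite big_map; apply: eq_bigr => n _; rewrite subrK.
- have := di [seq n + i | n <- s] (fun n => c (n - i)).
  rewrite map_inj_uniq; last exact: addIr.
  rewrite big_map; under eq_bigr do rewrite addrK.
  move=> /(_ us) H; rewrite -(addrK i j); apply: H => //.
    by move=> n; have := dc (n - i); rewrite /shift_deg subrK.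
  by apply/mapP; exists j.
Qed.

Lemma shift_degZ (m : nat) (j : int) a x :
  @rdeg k R m a -> shift_deg j x -> shift_deg (m%:Z + j) (a *: x).
Proof. by move=> da dx; rewrite /shift_deg -addrA; exact: mdegZ. Qed.

Definition shift : gmod R := GMod shift_grading shift_degZ (gmod_fg M).

End Shift.

(* The elements of *Hom_R(M, N) *)
Definition starhom M N (f : M -> N) :=
  exists (s : seq int) (c : int -> M -> N),
    (forall i, @ghom M (shift N i) (c i)) /\
    forall x, f x = \sum_(i <- s) c i x.

Definition gprojective (P : gmod R) :=
  forall A B (q : A -> B) (f : P -> B),
    ghom q -> (forall y, exists x, q x = y) -> ghom f ->
    exists2 g : P -> A, ghom g & forall x, q (g x) = f x.

Definition gproj_resolution A (P : nat -> gmod R)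
    (d : forall i, P i.+1 -> P i) (e : P 0%N -> A) :=
  [/\ forall i, gprojective (P i),
      ghom e /\ forall i, ghom (d i),
      forall y, exists x, e x = y,
      forall y, e y = 0 <-> exists x, d 0%N x = y
    & forall i y, d i y = 0 <-> exists x, d i.+1 x = y].

Definition starhom_cocycle (P : nat -> gmod R) (d : forall i, P i.+1 -> P i)
    B (i : nat) (f : P i -> B) :=
  starhom f /\ forall x, f (d i x) = 0.

Definition starhom_coboundary (P : nat -> gmod R)
    (d : forall i, P i.+1 -> P i) B (i : nat) : (P i -> B) -> Prop :=
  match i return (P i -> B) -> Prop with
  | 0%N => fun f => forall x, f x = 0
  | j.+1 => fun f =>
      exists2 g : P j -> B, starhom g & forall x, f x = g (d j x)
  end.

(* *Ext^i_R(A, B) = 0. It is computed on some graded projective resolution of A: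
   one exists when R is Noetherian, and the cohomology does not depend on it. *)
Definition starext_eq0 (i : nat) A B :=
  exists (P : nat -> gmod R) (d : forall i, P i.+1 -> P i) (e : P 0%N -> A),
    gproj_resolution d e /\
    forall f : P i -> B, starhom_cocycle d f -> starhom_coboundary d f.

(* The ideal m, as the set of sums of homogeneous elements of positive
   degree *)
Definition irrelevant : {pred R} := fun x =>
  `[< exists2 s : seq R,
        forall y, y \in s -> exists2 i, (0 < i)%N & @rdeg k R i y
      & x = \sum_(y <- s) y >].

Lemma irrelevant_homog i x : (0 < i)%N -> @rdeg k R i x -> x \in irrelevant.
Proof.
move=> i0 dx; apply/asboolP; exists [:: x]; last by rewrite big_seq1.
by move=> y; rewrite inE => /eqP->; exists i.
Qed.

Lemma irrelevant_zmod : zmod_closed irrelevant.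
Proof.
split=> [|x y /asboolP[s ds ->] /asboolP[t dt ->]]; apply/asboolP.
  by exists [::] => //; rewrite big_nil.
exists (s ++ [seq - z | z <- t]); last by rewrite big_cat big_map sumrN.
move=> z; rewrite mem_cat => /orP[/ds//|/mapP[w /dt[i i0 dw] ->]].
exists i => //; rewrite -[- w]sub0r.
by apply: (gradingB (rdeg_grading R)) => //; exact: grading0 (rdeg_grading R) i.
Qed.

HB.instance Definition _ :=
  GRing.isZmodClosed.Build R irrelevant irrelevant_zmod.

Lemma irrelevantM a x : x \in irrelevant -> a * x \in irrelevant.
Proof.
move=> /asboolP[s ds ->]; rewrite mulr_sumr big_seq; apply: rpred_sum.
move=> y /ds[i i0 dy].
have [t [c [_ dc ->]]] := grading_sum (rdeg_grading R) a.
rewrite mulr_suml; apply: rpred_sum => j _.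
by apply: (@irrelevant_homog (j + i)); [rewrite addn_gt0 i0 orbT|exact: rdegM].
Qed.

End GradedModules.

Arguments irrelevant {k} R.

(* ** The graded module R/m *)

Module ResidueModule.
Section ResidueModule.
Variables (k : fieldType) (R : gring k).

Local Notation m := (irrelevant R).

Definition type : Type := Quotient.quot m.
#[export]
HB.instance Definition _ := GRing.Zmodule.on type.
#[export]
HB.instance Definition _ := EqQuotient.on type.

Definition scale (a : R) (x : type) : type := \pi_type (a * repr x).

Lemma pi_eq (x y : R) : x - y \in m -> \pi_type x = \pi_type y.
Proof. by move=> h; apply/eqP; rewrite -Quotient.idealrBE. Qed.

Lemma scale_pi a x : scale a (\pi_type x) = \pi_type (a * x).
Proof.
apply: pi_eq; rewrite -mulrBr; apply: irrelevantM.
by rewrite Quotient.idealrBE reprK.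
Qed.

Lemma piD (x y : R) : \pi_type (x + y) = \pi_type x + \pi_type y.
Proof. exact: (raddfD \pi_(Quotient.quot m)). Qed.

Lemma scaleA a b x : scale a (scale b x) = scale (a * b) x.
Proof. by move: x; elim/quotW=> x; rewrite (scale_pi b) (scale_pi a) scale_pi mulrA. Qed.

Lemma scale1 : left_id 1 scale.
Proof. by elim/quotW=> x; rewrite scale_pi mul1r. Qed.

Lemma scaleDr : right_distributive scale +%R.
Proof.
move=> a; elim/quotW=> x; elim/quotW=> y.
by rewrite -piD !scale_pi -piD mulrDr.
Qed.

Lemma scaleDl x : {morph scale^~ x : a b / a + b}.
Proof. by move: x; elim/quotW=> x a b /=; rewrite !scale_pi mulrDl piD. Qed.

#[export]
HB.instance Definition _ :=
  GRing.Zmodule_isLmodule.Build R type scaleA scale1 scaleDr scaleDl.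

(* m contains every R_i with i > 0, so R/m is concentrated in degree 0. *)
Definition deg (i : int) : set type := fun x => i = 0 \/ x = 0.

Lemma deg_grading : is_grading deg.
Proof.
split=> [i|i x y [->|->] [] |x|s c us dc].
- by right.
- by left.
- by left.
- by left.
- by move=> ->; right; rewrite subr0.
- exists [:: 0], (fun i => if i == 0 then x else 0); split=> //.
  + by move=> i; rewrite /deg; case: (i =P 0) => [->|_]; [left|right].
  + by rewrite big_seq1.
- move=> sc i is_; have [i0|ni0] := eqVneq i 0; last first.
    by case: (dc i) => // i0; rewrite i0 eqxx in ni0.
  move: sc; rewrite (bigD1_seq i) //= big1 ?addr0 // => j ji.
  by case: (dc j) => // j0; rewrite i0 j0 eqxx in ji.
Qed.

Lemma degZ (i : nat) (j : int) a x :
  @rdeg k R i a -> deg j x -> deg (i%:Z + j) (a *: x).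
Proof.
move=> da [->|->]; last by right; rewrite scaler0.
case: i da => [|i] da; first by left.
right; move: x; elim/quotW=> x.
have -> : a *: \pi_type x = \pi_type (a * x) by exact: scale_pi.
have -> : 0 = \pi_type 0 :> type by rewrite (raddf0 \pi_(Quotient.quot m)).
apply: pi_eq; rewrite subr0 mulrC; apply: irrelevantM.
exact: irrelevant_homog da.
Qed.

Lemma fg : exists n (g : 'I_n -> type),
  forall x, exists c : 'I_n -> R, x = \sum_i c i *: g i.
Proof.
exists 1%N, (fun=> \pi_type 1); elim/quotW=> x; exists (fun=> x).
by rewrite big_ord1; rewrite -[_ *: _]/(scale _ _) scale_pi mulr1.
Qed.

Definition gmod : gmod R := GMod deg_grading degZ fg.

End ResidueModule.
Module Exports. HB.reexport. End Exports.
End ResidueModule.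
Export ResidueModule.Exports.

Section CohenMacaulay.
Variables (k : fieldType) (R : gring k).
Implicit Types (M N X : gmod R).

(* [krull_dim_ge R i.+1] says i < dim R. *)
Definition gCM M :=
  forall i, krull_dim_ge R i.+1 -> starext_eq0 i (ResidueModule.gmod R) M.

Definition le_hom M N := forall X, gCM X -> (homdim M X <= homdim N X)%N.

End CohenMacaulay.

(* ** Graded isolated singularities *)

Section IsolatedSingularity.
Variables (k : fieldType) (R : gring k).

Definition graded_ideal (p : {pred R}) :=
  forall x, x \in p -> exists (s : seq nat) (c : nat -> R),
    (forall i, @rdeg k R i (c i) /\ c i \in p) /\ x = \sum_(i <- s) c i.

Section HomogComplement.
Variable p : prime_idealr R.

Definition homog_pred :=
  [pred x : R | `[< exists i, @rdeg k R i x >] & x \notin p].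

Lemma homog_compl1 : 1 \in homog_pred.
Proof.
rewrite inE idealr1 andbT; apply/asboolP; exists 0%N; exact: rdeg1.
Qed.

Lemma homog_compl0 : 0 \notin homog_pred.
Proof. by rewrite inE idealr0 andbF. Qed.

Lemma homog_complM : {in homog_pred &, forall x y, x * y \in homog_pred}.
Proof.
move=> x y; rewrite !inE prime_idealrM negb_or.
move=> /andP[/asboolP[i dx] ->] /andP[/asboolP[j dy] ->]; rewrite !andbT.
by apply/asboolP; exists (i + j)%N; exact: rdegM.
Qed.

Definition homog_compl : mulset R :=
  MulSet homog_compl1 homog_compl0 homog_complM.

End HomogComplement.

(* The homogeneous localization R_(p) inverts the homogeneous elements outside
   p (it is the whole graded ring, not just its degree-0 part). *)
Definition graded_isolated_singularity :=
  forall p : prime_idealr R, graded_ideal p -> ~ (p =i irrelevant R) ->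
    regular_ring (localization (homog_compl p)).

End IsolatedSingularity.

(* [le] induces a partial order on the quotient of the class [D] by [eqv]. *)
Definition partial_order_on_classes (T : Type) (D : T -> Prop)
    (eqv le : T -> T -> Prop) :=
  [/\ [/\ forall x, D x -> eqv x x,
          forall x y, D x -> D y -> eqv x y -> eqv y x
        & forall x y z, D x -> D y -> D z -> eqv x y -> eqv y z -> eqv x z],
      forall x x' y y', D x -> D x' -> D y -> D y' ->
        eqv x x' -> eqv y y' -> le x y -> le x' y',
      forall x, D x -> le x x,
      forall x y, D x -> D y -> le x y -> le y x -> eqv x y
    & forall x y z, D x -> D y -> D z -> le x y -> le y z -> le x z].

(* Main.v *)
Require Import Defs.
From HB Require Import structures.
From mathcomp Require Import all_boot all_order all_algebra.
From mathcomp Require Import generic_quotient ring_quotient.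
From mathcomp Require Import boolp classical_sets.
From mathcomp Require Import zify ring.

(** Bongartz' cancellation argument, in the exact category of graded Cohen-Macaulay
    modules.  If [M,X] = [N,X] for all X, let q : B -> N be onto, with B the sum of
    copies of M and of a free module F, such that every map M -> N lifts along q.  The
    depth lemma makes K = ker q Cohen-Macaulay, so [M,B] = [M,K] + [M,N] turns into
    [N,B] = [N,K] + [N,N]; hence id_N lifts and N is a summand of M^r (+) F.  So a
    summand of N with local endomorphism ring is a summand of M or some R(a).
    Cancelling the common summands leaves modules whose local summands are all of the
    form R(a), and these are told apart by the test modules X = R(a).

    The ring enters only through the fact that R itself is Cohen-Macaulay, which has
    to be extracted from the finite injective dimension of the localization at m.
    Write F^j(L) = *Ext^j(L,R).  Finite injective dimension gives F^j = 0 for large j.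
    Let e be the largest j with F^j(k) <> 0.  By Noetherian induction, using
    0 -> (F/(U:a))(-d) -> F/U -> F/(U+aF) -> 0, one gets F^j = 0 for j > e on all
    finitely generated modules, while the Hilbert function of F^j(L) summed up to n is
    O(n^(e-j)).  For j = 0 and L = R this bounds dim R by e, because more than e
    elements of R are then algebraically dependent.  Finally let t be least with
    F^t(k) <> 0.  Dualizing a resolution of k up to degree t yields a module L of
    projective dimension at most t that contains a copy of k; as F^(e+1)(L/k) = 0,
    the map F^e(L) -> F^e(k) is onto, so e <= t. *)

Set Implicit Arguments.
Unset Strict Implicit.
Unset Printing Implicit Defensive.

Import Order.TTheory GRing.Theory Num.Theory.
Local Open Scope ring_scope.

(** Modules are presented by graded submodules of row vectors over [R], resolutions are sequences of
    homogeneous matrices, and F^j is the cohomology of the same matrices acting on column vectors.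
    Two devices carry the estimates. Cohomology is measured from above, by the size of a spanning
    set, so that three-term exact pieces suffice. It also vanishes in low degrees, so that
    multiplication by an element of positive degree can be iterated down to zero; this plays the
    part of Nakayama's lemma. The exponent e-j has the same origin: if a is regular on F/U, the
    dimension of F^j(F/U) in one degree is at most the one d degrees lower plus a value for F^(j+1)
    of the quotient, so a passage from j+1 to j costs one summation. If a is not regular, U:a is
    larger than U and induction covers both outer terms. In the cancellation, one common local
    summand at a time is split off from both modules. When there is none left, a nonzero map from
    R(b) to R(a) with b different from a has b < a; alternating between the two modules yields an
    endless descent of shifts, which finite generation forbids. *)

Lemma sum_supp (I : eqType) (V : zmodType) (s t : seq I) (c : I -> V) :
  uniq s -> uniq t -> {subset s <= t} -> (forall i, i \notin s -> c i = 0) ->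
  \sum_(i <- t) c i = \sum_(i <- s) c i.
Proof.
move=> us ut st c0; rewrite (bigID (mem s)) /= [X in _ + X]big1 ?addr0; last first.
  by move=> i /c0.
rewrite -big_filter; apply: perm_big; apply: uniq_perm => //.
  exact: filter_uniq.
by move=> i; rewrite mem_filter; have [/st ->|] := boolP (i \in s); rewrite ?andbF ?andbT.
Qed.

(** * Gradings and linear algebra over the base field *)

Section Grading.
Variables (I : eqType) (V : zmodType) (deg : I -> set V).
Hypothesis gV : is_grading deg.

Lemma degN i x : deg i x -> deg i (- x).
Proof. by move=> dx; rewrite -sub0r; apply: (gradingB gV) => //; exact: grading0. Qed.

Lemma degD i x y : deg i x -> deg i y -> deg i (x + y).
Proof.
by move=> dx dy; rewrite -[y]opprK; apply: (gradingB gV) => //; exact: degN.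
Qed.

Lemma deg_sum i J (s : seq J) (P : pred J) (F : J -> V) :
  (forall j, P j -> deg i (F j)) -> deg i (\sum_(j <- s | P j) F j).
Proof.
move=> dF; elim/big_ind: _ => //; first exact: (grading0 gV).
exact: degD.
Qed.

(** [grading_sum] leaves the values of [c] outside [s] arbitrary. Setting them to zero makes the
    family unique, so that [gcomp] can be chosen once and for all. *)
Lemma gcomp_ex x : exists c : I -> V, exists s, [/\ uniq s,
  forall i, deg i (c i), (forall i, i \notin s -> c i = 0) & x = \sum_(i <- s) c i].
Proof.
have [s [c [us dc ->]]] := grading_sum gV x.
exists (fun i => if i \in s then c i else 0), s; split=> //.
- by move=> i; case: ifP => // _; exact: (grading0 gV).
- by move=> i /negbTE ->.
- by rewrite big_seq [RHS]big_seq; apply: eq_bigr => i ->.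
Qed.

Definition gcomp (x : V) : I -> V := sval (cid (gcomp_ex x)).

Lemma gcompP x : exists s, [/\ uniq s, forall i, deg i (gcomp x i),
  (forall i, i \notin s -> gcomp x i = 0) & x = \sum_(i <- s) gcomp x i].
Proof. by rewrite /gcomp; case: cid. Qed.

Lemma gcomp_uniq x (c : I -> V) s : uniq s -> (forall i, deg i (c i)) ->
  (forall i, i \notin s -> c i = 0) -> x = \sum_(i <- s) c i -> gcomp x =1 c.
Proof.
move=> us dc c0 xc; have [s' [us' dg g0 xg]] := gcompP x.
pose t := undup (s ++ s') => i.
have ut : uniq t by exact: undup_uniq.
have st : {subset s <= t} by move=> j js; rewrite mem_undup mem_cat js.
have st' : {subset s' <= t} by move=> j js; rewrite mem_undup mem_cat js orbT.
have [it|] := boolP (i \in t); last first.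
  by rewrite mem_undup mem_cat negb_or => /andP[/c0 -> /g0 ->].
apply/eqP; rewrite -subr_eq0; apply/eqP.
apply: (grading_indep gV (s := t) (c := fun i => gcomp x i - c i)) => //.
  by move=> j; exact: (gradingB gV).
rewrite sumrB (sum_supp us' ut st' g0) (sum_supp us ut st c0) -xg -xc.
by rewrite subrr.
Qed.

Lemma gcomp_deg x i : deg i (gcomp x i).
Proof. by have [s []] := gcompP x. Qed.

Lemma gcomp_homog i x j : deg i x -> gcomp x j = if j == i then x else 0.
Proof.
move=> dx; apply: (@gcomp_uniq x (fun j => if j == i then x else 0) [:: i]) => //.
- by move=> l; case: eqP => [->|] //; rewrite ?dx //; move=> _; exact: (grading0 gV).
- by move=> l; rewrite inE => /negbTE ->.
- by rewrite big_seq1 eqxx.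
Qed.

Lemma gcomp_id i x : deg i x -> gcomp x i = x.
Proof. by move=> dx; rewrite (gcomp_homog i dx) eqxx. Qed.

Lemma gcomp_fin x y : exists s, [/\ uniq s,
  (forall i, i \notin s -> gcomp x i = 0 /\ gcomp y i = 0),
   x = \sum_(i <- s) gcomp x i & y = \sum_(i <- s) gcomp y i].
Proof.
have [s [us _ g0 xg]] := gcompP x; have [s' [us' _ g0' yg]] := gcompP y.
pose t := undup (s ++ s').
have ut : uniq t by exact: undup_uniq.
have st : {subset s <= t} by move=> j js; rewrite mem_undup mem_cat js.
have st' : {subset s' <= t} by move=> j js; rewrite mem_undup mem_cat js orbT.
exists t; split=> //.
- by move=> i; rewrite mem_undup mem_cat negb_or => /andP[/g0 -> /g0' ->].
- by rewrite (sum_supp us ut st g0).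
- by rewrite (sum_supp us' ut st' g0').
Qed.

Lemma gcompD x y i : gcomp (x + y) i = gcomp x i + gcomp y i.
Proof.
have [s [us s0 xs ys]] := gcomp_fin x y.
apply: (@gcomp_uniq _ (fun i => gcomp x i + gcomp y i) s us).
- by move=> j; apply: degD; exact: gcomp_deg.
- by move=> j /s0[-> ->]; rewrite addr0.
- by rewrite big_split /= -xs -ys.
Qed.

Lemma gcomp0 i : gcomp 0 i = 0.
Proof. by rewrite (gcomp_homog i (grading0 gV i)) if_same. Qed.

Lemma gcomp_sum J (s : seq J) (P : pred J) (F : J -> V) i :
  gcomp (\sum_(j <- s | P j) F j) i = \sum_(j <- s | P j) gcomp (F j) i.
Proof.
apply: (big_morph (fun x => gcomp x i)) => [x y|]; [exact: gcompD|exact: gcomp0].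
Qed.

Lemma gcompN x i : gcomp (- x) i = - gcomp x i.
Proof. by apply/eqP; rewrite -addr_eq0 -gcompD addNr gcomp0. Qed.

Lemma gcompB x y i : gcomp (x - y) i = gcomp x i - gcomp y i.
Proof. by rewrite gcompD gcompN. Qed.

Lemma gcomp_eq0 x : (forall i, gcomp x i = 0) -> x = 0.
Proof. by move=> x0; have [s [_ _ _ ->]] := gcompP x; rewrite big1. Qed.

End Grading.

(** Homogeneous additive maps of any degree commute with taking components. The instances below are
    multiplication by a homogeneous element, graded maps, and the action on a homogeneous vector. *)
Lemma gcomp_shift (I J : eqType) (V W : zmodType) (dV : I -> set V) (dW : J -> set W)
    (gV : is_grading dV) (gW : is_grading dW) (f : V -> W) (sh : I -> J) :
  {morph f : x y / x + y} -> injective sh ->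
  (forall i x, dV i x -> dW (sh i) (f x)) ->
  forall x i, gcomp gW (f x) (sh i) = f (gcomp gV x i).
Proof.
move=> fD ish df x i.
have f0 : f 0 = 0 by apply: (addrI (f 0)); rewrite -fD !addr0.
have fsum K (s : seq K) (F : K -> V) : f (\sum_(j <- s) F j) = \sum_(j <- s) f (F j).
  exact: (big_morph f fD f0).
have [s [us dx x0 {1}->]] := gcompP gV x.
rewrite fsum gcomp_sum.
have E j : gcomp gW (f (gcomp gV x j)) (sh i) = if j == i then f (gcomp gV x i) else 0.
  rewrite (gcomp_homog gW (sh i) (df _ _ (dx j))) (inj_eq ish) eq_sym.
  by case: eqP => [->|].
under eq_bigr do rewrite E.
have [is_|is_] := boolP (i \in s).
  by rewrite (bigD1_seq i) //= eqxx big1 ?addr0 // => j /negbTE ->.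
rewrite big1_seq ?x0 // => j /andP[_ js]; case: eqP => // ji.
Qed.

(** * Vector spaces over [k] and bounds for the dimension of subquotients *)

Section SpannedQuotients.
Variables (k : fieldType) (R : comAlgType k).
Implicit Types (V W : lmodType R).

(** Graded modules carry only an [R]-action, so [k] acts through [c%:A]. This one format serves [R]
    itself, column vectors and spaces of functions. *)
Definition subsp V (Z : set V) := Z 0 /\ forall (c : k) x y, Z x -> Z y -> Z (c%:A *: x + y).

Definition klin V W (h : V -> W) :=
  forall (c : k) x y, h (c%:A *: x + y) = c%:A *: h x + h y.

Lemma scaleAA V (c d : k) (x : V) : (c%:A : R) *: ((d%:A : R) *: x) = ((c * d)%:A : R) *: x.
Proof. by rewrite scalerA -scalerAl mul1r scalerA. Qed.

Lemma scaleAD V (c d : k) (x : V) : ((c + d)%:A : R) *: x = (c%:A : R) *: x + (d%:A : R) *: x.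
Proof. by rewrite -!scalerDl. Qed.

Lemma scaleA1 V (x : V) : ((1 : k)%:A : R) *: x = x.
Proof. by rewrite scale1r scale1r. Qed.

Lemma scaleA0 V (x : V) : ((0 : k)%:A : R) *: x = 0.
Proof. by rewrite scale0r scale0r. Qed.

Lemma scaleAN V (c : k) (x : V) : ((- c)%:A : R) *: x = - ((c%:A : R) *: x).
Proof. by rewrite scaleNr scaleNr. Qed.

Section Subsp.
Variables (V : lmodType R) (Z : set V).
Hypothesis sZ : subsp Z.
Lemma subspD x y : Z x -> Z y -> Z (x + y).
Proof. by move=> zx zy; rewrite -[x]scaleA1; apply: (proj2 sZ). Qed.
Lemma subspZ (c : k) x : Z x -> Z ((c%:A : R) *: x).
Proof. by move=> zx; rewrite -[_ *: x]addr0; apply: (proj2 sZ) => //; case: sZ. Qed.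
Lemma subspN x : Z x -> Z (- x).
Proof. by move=> zx; rewrite -[x]scaleA1 -scaleAN; exact: subspZ. Qed.
Lemma subspB x y : Z x -> Z y -> Z (x - y).
Proof. by move=> zx zy; apply: subspD => //; exact: subspN. Qed.
Lemma subsp_sum J (s : seq J) (P : pred J) (F : J -> V) :
  (forall j, P j -> Z (F j)) -> Z (\sum_(j <- s | P j) F j).
Proof. by move=> zF; elim/big_ind: _ => //; [case: sZ|exact: subspD]. Qed.
End Subsp.

Section Klin.
Variables (V W : lmodType R) (h : V -> W).
Hypothesis lh : klin h.
Lemma klin0 : h 0 = 0.
Proof. by have := lh (-1) 0 0; rewrite !scaleAN !scaleA1 oppr0 addr0 addNr. Qed.
Lemma klinD x y : h (x + y) = h x + h y.
Proof. by rewrite -{1}[x]scaleA1 lh scaleA1. Qed.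
Lemma klinZ (c : k) x : h ((c%:A : R) *: x) = (c%:A : R) *: h x.
Proof. by rewrite -[X in h X]addr0 lh klin0 addr0. Qed.
Lemma klinN x : h (- x) = - h x.
Proof. by apply/eqP; rewrite -addr_eq0 -klinD addNr klin0. Qed.
Lemma klinB x y : h (x - y) = h x - h y.
Proof. by rewrite klinD klinN. Qed.
Lemma klin_sum J (s : seq J) (P : pred J) (F : J -> V) :
  h (\sum_(j <- s | P j) F j) = \sum_(j <- s | P j) h (F j).
Proof. exact: (big_morph h klinD klin0). Qed.
End Klin.

(* The image of [Z] in the quotient by [B] is spanned by [n] elements. *)
Definition qle V (Z B : set V) (n : nat) :=
  exists v : 'I_n -> V, forall z, Z z ->
    exists c : 'I_n -> k, B (z - \sum_i (c i)%:A *: v i).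

Lemma qle_sub V (Z Z' B : set V) n : (forall z, Z' z -> Z z) -> qle Z B n -> qle Z' B n.
Proof. by move=> s [v vP]; exists v => z /s /vP. Qed.

Lemma sum_split V n m (c : 'I_n -> k) (d : 'I_m -> k) (v : 'I_n -> V) (w : 'I_m -> V) :
  \sum_i (match split i with inl j => c j | inr j => d j end)%:A *:
     (match split i with inl j => v j | inr j => w j end) =
  \sum_i (c i)%:A *: v i + \sum_i (d i)%:A *: w i :> V.
Proof.
by rewrite big_split_ord /=; congr (_ + _); apply: eq_bigr => i _;
  rewrite ?(unsplitK (inl i)) ?(unsplitK (inr i)).
Qed.

Lemma qle_addr V (Z B : set V) n m : qle Z B n -> qle Z B (n + m).
Proof.
move=> [v vP].
exists (fun i => match split i with inl j => v j | inr _ => 0 end) => z /vP[c cP].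
exists (fun i => match split i with inl j => c j | inr _ => 0 end).
by rewrite sum_split [X in _ - (_ + X)]big1 ?addr0 // => i _; rewrite scaler0.
Qed.

Lemma qle_mono V (Z B : set V) n m : (n <= m)%N -> qle Z B n -> qle Z B m.
Proof. by move=> /subnKC <-; exact: qle_addr. Qed.

(** Dimension is subadditive in extensions. The vectors that span [h(Z)] modulo [B2] may lie outside
    [h(Z)], so they cannot simply be lifted; they are eliminated one by one, as in Gaussian
    elimination. *)
Lemma qle_ext V W (h : V -> W) (Z B : set V) (B2 : set W) n m :
  klin h -> subsp Z -> subsp B2 ->
  (exists v : 'I_n -> W, forall z, Z z ->
    exists c : 'I_n -> k, B2 (h z - \sum_i (c i)%:A *: v i)) ->
  qle (fun z => Z z /\ B2 (h z)) B m -> qle Z B (n + m).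
Proof.
move=> lh + sB2; elim: n Z => [|n IH] Z sZ [v vP] qK.
  by apply: qle_sub qK => z zZ; split=> //; have [c] := vP z zZ; rewrite big_ord0 subr0.
pose Z' := (fun z => Z z /\ exists c : 'I_n -> k,
  B2 (h z - \sum_i (c i)%:A *: v (widen_ord (leqnSn n) i))).
have sZ' : subsp Z'.
  split; first split; first by case: sZ.
    exists (fun=> 0); rewrite (klin0 lh) big1 ?subr0; first by case: sB2.
    by move=> i _; rewrite scaleA0.
  move=> c x y [Zx [cx bx]] [Zy [cy b_y]]; split; first exact: (proj2 sZ).
  exists (fun i => c * cx i + cy i).
  set X := (X in B2 X); suff -> : X = c%:A *: (h x - \sum_i (cx i)%:A *: v (widen_ord (leqnSn n) i))
     + (h y - \sum_i (cy i)%:A *: v (widen_ord (leqnSn n) i)) by exact: (proj2 sB2).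
  rewrite /X lh scalerBr addrACA -opprD; congr (_ - _).
  rewrite scaler_sumr -big_split /=; apply: eq_bigr => i _.
  by rewrite scaleAD -scaleAA.
have qZ' : qle Z' B (n + m).
  apply: IH => //; first by exists (fun i => v (widen_ord (leqnSn n) i)) => z [].
  by apply: qle_sub qK => z [[]].
have [[z0 [c0 [Zz0 bz0 c0n]]]|no] := pselect (exists z0 (c0 : 'I_n.+1 -> k),
   [/\ Z z0, B2 (h z0 - \sum_i (c0 i)%:A *: v i) & c0 ord_max != 0]); last first.
  apply: (@qle_mono _ _ _ (n + m)); first by rewrite leq_add2r leqnSn.
  apply: qle_sub qZ' => z Zz; split=> //; have [c bc] := vP z Zz.
  exists (fun i => c (widen_ord (leqnSn n) i)); move: bc; rewrite big_ord_recr /=.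
  have [cn|cn] := eqVneq (c ord_max) 0; first by rewrite cn scaleA0 addr0.
  by move=> bc; case: no; exists z, c; split=> //; rewrite big_ord_recr.
have [w wP] := qZ'.
rewrite -[(n.+1 + m)%N]/(1 + (n + m))%N.
exists (fun i => match @split 1 (n + m) i with inl _ => z0 | inr j => w j end) => z Zz.
have [c bc] := vP z Zz; pose d := c ord_max / c0 ord_max.
have : Z' (z - (d%:A : R) *: z0).
  split; first by apply: (subspB sZ) => //; exact: (subspZ sZ).
  exists (fun i => c (widen_ord (leqnSn n) i) - d * c0 (widen_ord (leqnSn n) i)).
  set X := (X in B2 X); suff -> : X = (h z - \sum_i (c i)%:A *: v i)
     - (d%:A : R) *: (h z0 - \sum_i (c0 i)%:A *: v i).
    by apply: (subspB sB2) => //; exact: (subspZ sB2).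
  rewrite /X (klinB lh) (klinZ lh) scalerBr opprD addrACA -opprD; congr (_ - _).
  rewrite scaler_sumr -sumrB [RHS]big_ord_recr /= scaleAA /d divfK // subrr addr0.
  by apply: eq_bigr => i _; rewrite scaleAD scaleAN -scaleAA.
move=> /wP[e be]; exists (fun i => match @split 1 (n + m) i with inl _ => d | inr j => e j end).
by rewrite (@sum_split _ 1 (n + m) (fun=> d) e (fun=> z0) w) big_ord1 opprD addrA.
Qed.
End SpannedQuotients.

Section LinearAlgebra.
Variables (k : fieldType) (R : comAlgType k).
Implicit Types (V W : lmodType R).

Lemma qle0P V (Z B : set V) : qle Z B 0 <-> forall z, Z z -> B z.
Proof.
split=> [[v vP] z /vP[c]|ZB]; first by rewrite big_ord0 subr0.
by exists (fun=> 0) => z /ZB; exists (fun=> 0); rewrite big_ord0 subr0.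
Qed.

Lemma qle_onto V W (h : V -> W) (Z1 B1 : set V) (Z2 B2 : set W) n :
  klin h -> subsp B2 -> (forall z, Z2 z -> exists2 y, Z1 y & B2 (z - h y)) ->
  (forall b, B1 b -> B2 (h b)) -> qle Z1 B1 n -> qle Z2 B2 n.
Proof.
move=> lh sB2 onto hB [v vP]; exists (h \o v) => z /onto[y Z1y zy].
have [c bc] := vP y Z1y; exists c.
have -> : z - \sum_i (c i)%:A *: (h \o v) i = (z - h y) + h (y - \sum_i (c i)%:A *: v i).
  rewrite (klinB lh) addrA subrK (klin_sum lh); congr (_ - _).
  by apply: eq_bigr => i _; rewrite (klinZ lh).
by apply: (subspD sB2) => //; exact: hB.
Qed.

(** Exact dimensions serve the Hom spaces, where an equality of dimensions has to be turned into
    surjectivity. For cohomology the upper bounds [qle] suffice. *)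
Definition isdim V (Z : set V) d := exists f : 'I_d -> V,
  [/\ forall i, Z (f i),
      forall c : 'I_d -> k, \sum_i (c i)%:A *: f i = 0 -> forall i, c i = 0
    & forall z, Z z -> exists c : 'I_d -> k, z = \sum_i (c i)%:A *: f i].

Lemma subsp0 V : subsp (fun z : V => z = 0).
Proof. by split=> // c x y -> ->; rewrite scaler0 addr0. Qed.

Lemma isdim_ex V (Z : set V) n : subsp Z -> qle Z (fun z => z = 0) n -> exists d, isdim Z d.
Proof.
elim: n Z => [|n IH] Z sZ [v vP].
  exists 0%N, (fun=> 0); split=> [[]//|c _ []//|z /vP[c]].
  by rewrite big_ord0 subr0 => ->; exists c; rewrite big_ord0.
pose w i := v (widen_ord (leqnSn n) i).
pose Z' := fun z => Z z /\ exists c : 'I_n -> k, z = \sum_i (c i)%:A *: w i.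
have sZ' : subsp Z'.
  split; first split; first by case: sZ.
    by exists (fun=> 0); rewrite big1 // => i _; rewrite scaleA0.
  move=> c x y [Zx [cx bx]] [Zy [cy b_y]]; split; first exact: (proj2 sZ).
  exists (fun i => c * cx i + cy i); rewrite bx b_y scaler_sumr -big_split /=.
  by apply: eq_bigr => i _; rewrite scaleAD -scaleAA.
have [|d [f [Zf ind sp]]] := IH Z' sZ'.
  by exists w => z [_ [c ->]]; exists c; rewrite subrr.
have vP' z : Z z -> exists c (a : k), z = \sum_(i < n) (c i)%:A *: w i + (a%:A : R) *: v ord_max.
  move=> /vP[c /subr0_eq ->]; exists (fun i => c (widen_ord (leqnSn n) i)), (c ord_max).
  by rewrite big_ord_recr.
have [[z0 [Zz0 nz0]]|no] := pselect (exists z0, Z z0 /\ ~ Z' z0); last first.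
  exists d, f; split=> // [i|z Zz]; first by case: (Zf i).
  by apply: sp; apply/not_notP => nz; apply: no; exists z.
exists (d + 1)%N, (fun i => match split i with inl j => f j | inr _ => z0 end).
have spl (c : 'I_(d + 1) -> k) : \sum_i (c i)%:A *: (match split i with inl j => f j | inr _ => z0 end)
   = \sum_i (c (lshift 1 i))%:A *: f i + ((c (rshift d 0))%:A : R) *: z0.
  rewrite big_split_ord big_ord1 /= (unsplitK (inr _)); congr (_ + _).
  by apply: eq_bigr => i _; rewrite (unsplitK (inl i)).
split.
- by move=> i; case: split => // j; case: (Zf j).
- move=> c; rewrite spl => c0.
  have cr : c (rshift d 0) = 0.
    apply/eqP/negP => /negP cn; apply: nz0.
    suff -> : z0 = (- (c (rshift d 0))^-1)%:A *: \sum_i (c (lshift 1 i))%:A *: f i.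
      by apply: (subspZ sZ'); apply: (subsp_sum sZ') => i _; apply: (subspZ sZ').
    move/eqP: c0; rewrite addr_eq0 => /eqP ->.
    by rewrite scaleAN scalerN opprK scaleAA mulVf // scaleA1.
  move: c0; rewrite cr scaleA0 addr0 => /ind c0 i.
  by case: (splitP i) => j ij; [rewrite -(c0 j)|rewrite -cr]; congr c; apply: val_inj; rewrite //= (ord1 j) in ij *.
- move=> z Zz; have [c0 [a0 z0E]] := vP' _ Zz0; have [c1 [a1 zE]] := vP' _ Zz.
  have a0n : a0 != 0.
    apply/negP => /eqP a00; apply: nz0; split=> //; exists c0.
    by rewrite z0E a00 scaleA0 addr0.
  have [|e zz] := sp (z - ((a1 / a0)%:A : R) *: z0).
    split; first by apply: (subspB sZ) => //; exact: (subspZ sZ).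
    exists (fun i => c1 i - a1 / a0 * c0 i); rewrite {1}zE {1}z0E.
    rewrite scalerDr scaleAA divfK // opprD addrACA subrr addr0.
    rewrite scaler_sumr -sumrB; apply: eq_bigr => i _.
    by rewrite scaleAD scaleAN scaleAA.
  exists (fun i => match split i with inl j => e j | inr _ => a1 / a0 end).
  rewrite spl (unsplitK (inr _)).
  under eq_bigr do rewrite (unsplitK (inl _)).
  by rewrite -zz subrK.
Qed.

Section Comb.
Variables (V : lmodType R) (d : nat) (f : 'I_d -> V).
Definition comb (c : 'rV[k]_d) : V := \sum_i (c 0 i)%:A *: f i.
Lemma combD c e : comb (c + e) = comb c + comb e.
Proof.
by rewrite /comb -big_split; apply: eq_bigr => i _; rewrite mxE scaleAD.
Qed.
Lemma combZ a c : comb (a *: c) = (a%:A : R) *: comb c.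
Proof. by rewrite /comb scaler_sumr; apply: eq_bigr => i _; rewrite mxE scaleAA. Qed.
Lemma comb_row e (M : 'M[k]_(e, d)) (c : 'rV_e) :
  comb (c *m M) = \sum_i (c 0 i)%:A *: comb (row i M).
Proof.
have c0 : comb 0 = 0 by rewrite /comb big1 // => i _; rewrite mxE scaleA0.
rewrite mulmx_sum_row (big_morph comb combD c0).
by apply: eq_bigr => i _; rewrite combZ.
Qed.
End Comb.

Lemma sum_comb V d (f : 'I_d -> V) (c : 'I_d -> k) :
  \sum_i (c i)%:A *: f i = comb f (\row_i c i).
Proof. by apply: eq_bigr => i _; rewrite mxE. Qed.

Lemma comb_mx V W d e (f : 'I_d -> V) (g : 'I_e -> W) (h : V -> W) :
  klin h -> (forall i, exists c : 'I_e -> k, h (f i) = \sum_j (c j)%:A *: g j) ->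
  exists M : 'M[k]_(d, e), forall c, h (comb f c) = comb g (c *m M).
Proof.
move=> lh hf; have [m mP] := choice hf.
exists (\matrix_(i, j) m i j) => c; rewrite comb_row (klin_sum lh).
apply: eq_bigr => i _; rewrite (klinZ lh) mP sum_comb; congr (_ *: comb _ _).
by apply/rowP => j; rewrite !mxE.
Qed.

(** Rank-nullity for the matrices of [u] and [v]. The equivalence is the engine of the cancellation:
    a numerical identity between Hom dimensions becomes a lifting property, and conversely. *)
Lemma exact_dim V1 V2 V3 (Z1 : set V1) (Z2 : set V2) (Z3 : set V3) d1 d2 d3
   (u : V1 -> V2) (v : V2 -> V3) :
  klin u -> klin v -> isdim Z1 d1 -> isdim Z2 d2 -> isdim Z3 d3 ->
  (forall x, Z1 x -> Z2 (u x)) -> (forall x, Z2 x -> Z3 (v x)) ->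
  subsp Z1 -> subsp Z2 ->
  (forall x, Z1 x -> u x = 0 -> x = 0) ->
  (forall x, Z1 x -> v (u x) = 0) ->
  (forall y, Z2 y -> v y = 0 -> exists2 x, Z1 x & u x = y) ->
  (d2 <= d1 + d3)%N /\
  (d2 = (d1 + d3)%N <-> forall z, Z3 z -> exists2 y, Z2 y & v y = z).
Proof.
move=> lu lv [f1 [Zf1 i1 s1]] [f2 [Zf2 i2 s2]] [f3 [Zf3 i3 s3]] uZ vZ sZ1 sZ2 uI uv ex.
have [A1 A1P] := comb_mx lu (fun i => s2 _ (uZ _ (Zf1 i))).
have [A2 A2P] := comb_mx lv (fun i => s3 _ (vZ _ (Zf2 i))).
have Zc1 c : Z1 (comb f1 c) by apply: (subsp_sum sZ1) => i _; exact: (subspZ sZ1).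
have Zc2 c : Z2 (comb f2 c) by apply: (subsp_sum sZ2) => i _; exact: (subspZ sZ2).
have c0 V d (f : 'I_d -> V) : comb f 0 = 0.
  by rewrite /comb big1 // => i _; rewrite mxE scaleA0.
have inj V d (f : 'I_d -> V) c :
    (forall c : 'I_d -> k, \sum_i (c i)%:A *: f i = 0 -> forall i, c i = 0) ->
    comb f c = 0 -> c = 0.
  by move=> i0 /i0 ci; apply/rowP => i; rewrite mxE ci.
have rf : row_free A1.
  rewrite -kermx_eq0; apply/eqP/row_matrixP => i; rewrite row0.
  apply: (inj _ _ f1 _ i1); apply: uI => //.
  by rewrite A1P -row_mul mulmx_ker row0 c0.
have kA : (kermx A2 :=: A1)%MS.
  apply/eqmxP/andP; split; last first.
    apply/sub_kermxP/row_matrixP => i; rewrite row0 row_mul.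
    apply: (inj _ _ f3 _ i3); rewrite -A2P.
    suff -> : comb f2 (row i A1) = u (comb f1 (delta_mx 0 i)) by rewrite uv.
    by rewrite A1P rowE.
  apply/row_subP => i.
  have [|x Zx xE] := ex (comb f2 (row i (kermx A2))) (Zc2 _).
    by rewrite A2P -row_mul mulmx_ker row0 c0.
  have [c xc] := s1 _ Zx; rewrite sum_comb in xc.
  suff -> : row i (kermx A2) = (\row_i c i) *m A1 by exact: submxMl.
  apply/eqP; rewrite -subr_eq0; apply/eqP; apply: (inj _ _ f2 _ i2).
  by rewrite combD -xE xc A1P -combD -mulNmx -mulmxDl subrr mul0mx c0.
have rk : (d1 + \rank A2 = d2)%N.
  have := mxrank_ker A2; rewrite kA (eqP rf) => ->.
  by rewrite subnK // rank_leq_row.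
have r3 := rank_leq_col A2.
split; first by rewrite -rk leq_add2l.
have rkP : (d2 = (d1 + d3)%N) <-> row_full A2.
  rewrite /row_full; move: rk r3; move: (\rank A2) => r rk r3.
  by split=> [e|/eqP e]; [apply/eqP|]; lia.
split=> [/rkP rfu z Zz|onto]; last apply/rkP.
  have [c ->] := s3 _ Zz; rewrite sum_comb.
  have /submxP[D ->] := @submx_full _ _ _ _ (\row_i c i) A2 rfu.
  by exists (comb f2 D); rewrite ?A2P.
rewrite -sub1mx; apply/row_subP => i.
have [|y Zy yE] := onto (comb f3 (row i 1%:M)).
  have -> : comb f3 (row i 1%:M) = f3 i.
    rewrite /comb (bigD1 i) //= !mxE eqxx scaleA1 big1 ?addr0 // => j ji.
    by rewrite !mxE eq_sym (negbTE ji) scaleA0.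
  exact: Zf3.
have [c yc] := s2 _ Zy; rewrite sum_comb in yc.
suff -> : row i 1%:M = (\row_i c i) *m A2 by exact: submxMl.
apply/eqP; rewrite -subr_eq0; apply/eqP; apply: (inj _ _ f3 _ i3).
by rewrite combD -yE yc A2P -combD -mulNmx -mulmxDl subrr mul0mx c0.
Qed.

Lemma dependent V n m (v : 'I_n -> V) (w : 'I_m -> V) : (n < m)%N ->
  (forall i, exists c : 'I_n -> k, w i = \sum_j (c j)%:A *: v j) ->
  exists2 c : 'I_m -> k, \sum_i (c i)%:A *: w i = 0 & exists i, c i != 0.
Proof.
move=> nm /choice[e eP]; pose A : 'M[k]_(m, n) := \matrix_(i, j) e i j.
have /rowV0Pn[c /sub_kermxP cA c0] : kermx A != 0.
  by rewrite -mxrank_eq0 mxrank_ker -lt0n subn_gt0 (leq_ltn_trans (rank_leq_col A)).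
exists (c 0); last first.
  by apply/not_existsP => ce; case/eqP: c0; apply/rowP => i; rewrite mxE; apply/eqP/negPn/negP/ce.
have -> : \sum_i (c 0 i)%:A *: w i = comb v (c *m A).
  rewrite comb_row; apply: eq_bigr => i _; rewrite eP sum_comb; congr (_ *: comb _ _).
  by apply/rowP => j; rewrite !mxE.
by rewrite cA /comb big1 // => i _; rewrite mxE scaleA0.
Qed.

End LinearAlgebra.

(** * Homogeneous matrices and finitely generated graded submodules *)

Section IntegerGrading.
Variables (k : fieldType) (R : gring k).

(** With zero in negative degrees, the degree of a matrix entry can be any difference [a i - b l],
    without side conditions. *)
Definition Rz (z : int) : set R :=
  fun x => match z with Posz n => rdeg n x | Negz _ => x = 0 end.

Lemma Rz_grading : is_grading Rz.
Proof.
have gR := rdeg_grading R.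
split=> [[n|n]|[n|n] x y|x|s c us dc sc i is_] //=; first exact: (grading0 gR).
- exact: (gradingB gR).
- by move=> -> ->; rewrite subr0.
- have [s [c [us dc ->]]] := grading_sum gR x.
  exists [seq Posz n | n <- s], (fun z => if z is Posz n then c n else 0); split.
  + by rewrite map_inj_uniq // => ? ? [].
  + by case=> n //=; exact: dc.
  + by rewrite big_map.
- case: i is_ => n is_; last exact: (dc (Negz n)).
  pose s' := [seq `|i|%N | i <- s & 0 <= i].
  have us' : uniq s'.
    rewrite map_inj_in_uniq ?filter_uniq // => x y.
    by rewrite !mem_filter => /andP[x0 _] /andP[y0 _]; lia.
  apply: (grading_indep gR (s := s') (c := fun n => c (Posz n)) us') => //.
  + by move=> m; exact: (dc (Posz m)).
  + rewrite /s' big_map big_filter -[RHS]sc [RHS](bigID (fun i : int => 0 <= i)) /=.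
    rewrite [X in _ = _ + X]big1 ?addr0; last by case=> m // _; exact: (dc (Negz m)).
    by apply: eq_bigr => -[m|m].
  + by apply/mapP; exists (Posz n); rewrite // mem_filter is_.
Qed.

Lemma RzM i j x y : Rz i x -> Rz j y -> Rz (i + j) (x * y).
Proof.
case: i => i; last by move=> ->; rewrite mul0r => _; exact: (grading0 Rz_grading).
case: j => j; last by move=> _ ->; rewrite mulr0; exact: (grading0 Rz_grading).
exact: rdegM.
Qed.

Lemma Rz0 i : Rz i 0.
Proof. exact: (grading0 Rz_grading). Qed.

Lemma Rz_neg i x : i < 0 -> Rz i x -> x = 0.
Proof. by case: i. Qed.

Definition rcomp := gcomp Rz_grading.

Lemma rcomp_deg x i : Rz i (rcomp x i).
Proof. exact: gcomp_deg. Qed.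

Lemma rcompMl i a x j : Rz i a -> rcomp (a * x) (i + j) = a * rcomp x j.
Proof.
move=> da; apply: (gcomp_shift Rz_grading Rz_grading (f := *%R a) (sh := +%R i)).
- exact: mulrDr.
- exact: addrI.
- by move=> l y; exact: RzM.
Qed.

Section Matrices.
Variables (m n : nat) (a : 'I_m -> int) (b : 'I_n -> int).

(* Matrices act on row vectors on the right; [X] is homogeneous of degree 0 from the
   free module with generators in degrees [a] to the one with generators in degrees [b]. *)
Definition gmx (X : 'M[R]_(m, n)) := forall i l, Rz (a i - b l) (X i l).

(** The degree-0 part of an arbitrary matrix. Since it commutes with products by homogeneous
    matrices, a linear system with homogeneous data that is solvable at all has a homogeneous
    solution. *)
Definition pr (X : 'M[R]_(m, n)) : 'M[R]_(m, n) :=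
  \matrix_(i, l) rcomp (X i l) (a i - b l).

Lemma pr_gmx X : gmx (pr X).
Proof. by move=> i l; rewrite mxE; exact: rcomp_deg. Qed.

Lemma pr_id X : gmx X -> pr X = X.
Proof. by move=> gX; apply/matrixP => i l; rewrite mxE /rcomp (gcomp_id _ (gX i l)). Qed.

Lemma gmx0 : gmx 0.
Proof. by move=> i l; rewrite mxE; exact: Rz0. Qed.
Lemma gmxD X Y : gmx X -> gmx Y -> gmx (X + Y).
Proof. by move=> gX gY i l; rewrite mxE; apply: (degD Rz_grading). Qed.
Lemma gmxN X : gmx X -> gmx (- X).
Proof. by move=> gX i l; rewrite mxE; apply: (degN Rz_grading). Qed.
End Matrices.

Lemma gmxM m n p (a : 'I_m -> int) (b : 'I_n -> int) (c : 'I_p -> int) X Y :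
  gmx a b X -> gmx b c Y -> gmx a c (X *m Y).
Proof.
move=> gX gY i l; rewrite mxE; apply: (deg_sum Rz_grading) => j _.
have -> : a i - c l = (a i - b j) + (b j - c l) by ring.
exact: RzM.
Qed.

Lemma gmx_tr m n (a : 'I_m -> int) (b : 'I_n -> int) X :
  gmx a b X <-> gmx (fun l => - b l) (fun i => - a i) X^T.
Proof.
by split=> gX i l; [rewrite mxE|rewrite -[X]trmxK mxE]; have := gX l i; rewrite opprK addrC.
Qed.

Lemma prMr m n p (a : 'I_m -> int) (b : 'I_n -> int) (c : 'I_p -> int) X Y :
  gmx b c Y -> pr a c (X *m Y) = pr a b X *m Y.
Proof.
move=> gY; apply/matrixP => i l; rewrite !mxE /rcomp gcomp_sum.
apply: eq_bigr => j _; rewrite mxE mulrC [RHS]mulrC.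
have -> : a i - c l = (b j - c l) + (a i - b j) by ring.
by rewrite -/rcomp rcompMl.
Qed.

Lemma prMl m n p (a : 'I_m -> int) (b : 'I_n -> int) (c : 'I_p -> int) X Y :
  gmx a b X -> pr a c (X *m Y) = X *m pr b c Y.
Proof.
move=> gX; apply/matrixP => i l; rewrite !mxE /rcomp gcomp_sum.
apply: eq_bigr => j _; rewrite mxE.
have -> : a i - c l = (a i - b j) + (b j - c l) by ring.
by rewrite -/rcomp rcompMl.
Qed.

Lemma gmx_solve_r m n p (a : 'I_m -> int) (b : 'I_n -> int) (c : 'I_p -> int) X Y D :
  gmx a c X -> gmx b c D -> X = Y *m D -> exists2 Y', gmx a b Y' & X = Y' *m D.
Proof.
move=> gX gD XY; exists (pr a b Y); first exact: pr_gmx.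
by rewrite -(prMr _ _ gD) -XY (pr_id gX).
Qed.

Lemma gmx_solve_l m n p (a : 'I_m -> int) (b : 'I_n -> int) (c : 'I_p -> int) X Y D :
  gmx a c X -> gmx a b D -> X = D *m Y -> exists2 Y', gmx b c Y' & X = D *m Y'.
Proof.
move=> gX gD XY; exists (pr b c Y); first exact: pr_gmx.
by rewrite -(prMl _ _ gD) -XY (pr_id gX).
Qed.

Definition rowdeg n (a : 'I_n -> int) (u : int) : set 'rV[R]_n :=
  fun v => gmx (fun=> u) a v.

Lemma rowdeg_grading n (a : 'I_n -> int) : is_grading (rowdeg a).
Proof.
split=> [u|u x y gx gy|x|s c us dc sc u is_].
- exact: gmx0.
- by apply: gmxD => //; exact: gmxN.
- have [S SP] := choice (fun l : 'I_n => gcompP Rz_grading (x 0 l)).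
  exists (undup (flatten [seq [seq i + a l | i <- S l] | l <- enum 'I_n])).
  exists (fun u => pr (fun=> u) a x); split; first exact: undup_uniq.
    by move=> u; exact: pr_gmx.
  apply/rowP => l; rewrite summxE; have [us dx x0 {1}->] := SP l.
  have ui : uniq [seq i + a l | i <- S l] by rewrite map_inj_uniq //; exact: addIr.
  transitivity (\sum_(u <- [seq i + a l | i <- S l]) rcomp (x 0 l) (u - a l)).
    by rewrite big_map; apply: eq_bigr => i _; rewrite addrK.
  under [RHS]eq_bigr do rewrite mxE.
  rewrite [RHS](sum_supp ui) ?undup_uniq //.
  + move=> u ul; rewrite mem_undup; apply/flattenP.
    by exists [seq i + a l | i <- S l] => //; apply/mapP; exists l; rewrite ?mem_enum.
  + move=> u ul; apply: x0; apply: contra ul => ul.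
    by apply/mapP; exists (u - a l); rewrite ?subrK.
- apply/rowP => l; rewrite mxE.
  have inj : injective (fun i => i - a l) by exact: addIr.
  rewrite -(subrK (a l) u); set w := u - a l.
  apply: (grading_indep Rz_grading (s := [seq i - a l | i <- s])
    (c := fun i => c (i + a l) 0 l)).
  + by rewrite map_inj_uniq.
  + by move=> i; have := dc (i + a l) 0 l; rewrite addrK.
  + rewrite big_map; under eq_bigr do rewrite subrK.
    by rewrite -summxE sc mxE.
  + by apply/mapP; exists u.
Qed.

Lemma gcomp_row n (a : 'I_n -> int) v u :
  gcomp (rowdeg_grading a) v u = pr (fun=> u) a v.
Proof.
have [s [us dv v0 vE]] := gcompP (rowdeg_grading a) v.
apply/rowP => l; rewrite mxE {2}vE summxE /rcomp gcomp_sum.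
have inj : injective (fun i => i - a l) by exact: addIr.
have E j : gcomp Rz_grading (gcomp (rowdeg_grading a) v j 0 l) (u - a l) =
   if u == j then gcomp (rowdeg_grading a) v u 0 l else 0.
  rewrite (gcomp_homog _ (i := j - a l)); last exact: (dv j 0 l).
  by rewrite (inj_eq inj); case: eqP => [->|].
under eq_bigr do rewrite E.
have [us_|us_] := boolP (u \in s).
  by rewrite (bigD1_seq u) //= eqxx big1 ?addr0 // => j; rewrite eq_sym => /negbTE ->.
rewrite big1_seq ?v0 ?mxE // => j /andP[_ js]; case: eqP => // uj.
Qed.

Lemma row_decomp n (a : 'I_n -> int) (v : 'rV[R]_n) :
  exists s, v = \sum_(u <- s) pr (fun=> u) a v.
Proof.
have [s [_ _ _ vE]] := gcompP (rowdeg_grading a) v.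
by exists s; rewrite {1}vE; apply: eq_bigr => u _; rewrite gcomp_row.
Qed.

Definition submod n (U : set 'rV[R]_n) :=
  U 0 /\ forall (a : R) x y, U x -> U y -> U (a *: x + y).

Lemma submodD n (U : set 'rV[R]_n) x y : submod U -> U x -> U y -> U (x + y).
Proof. by move=> [_ sU] Ux Uy; rewrite -[x]scale1r; exact: sU. Qed.
Lemma submodZ n (U : set 'rV[R]_n) a x : submod U -> U x -> U (a *: x).
Proof. by move=> [U0 sU] Ux; rewrite -[_ *: x]addr0; exact: sU. Qed.
Lemma submodN n (U : set 'rV[R]_n) x : submod U -> U x -> U (- x).
Proof. by move=> sU Ux; rewrite -scaleN1r; exact: submodZ. Qed.
Lemma submod_sum n (U : set 'rV[R]_n) J (s : seq J) (P : pred J) F : submod U ->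
  (forall j, P j -> U (F j)) -> U (\sum_(j <- s | P j) F j).
Proof.
by move=> sU UF; elim/big_ind: _ => //; [case: sU|move=> *; exact: submodD].
Qed.
Lemma submod_mul n m (U : set 'rV[R]_n) (w : 'rV_m) (G : 'M_(m, n)) : submod U ->
  (forall i, U (row i G)) -> U (w *m G).
Proof.
move=> sU UG; rewrite mulmx_sum_row; apply: submod_sum => // i _.
exact: submodZ.
Qed.

Definition graded n (a : 'I_n -> int) (U : set 'rV[R]_n) :=
  forall u v, U v -> U (pr (fun=> u) a v).

Definition rowspan m n (G : 'M[R]_(m, n)) : set 'rV[R]_n :=
  fun v => exists w, v = w *m G.

Lemma rowspan_submod m n (G : 'M[R]_(m, n)) : submod (rowspan G).
Proof.
split; first by exists 0; rewrite mul0mx.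
by move=> a _ _ [x ->] [y ->]; exists (a *: x + y); rewrite mulmxDl scalemxAl.
Qed.

Lemma rowspan_graded m n a b (G : 'M[R]_(m, n)) : gmx a b G -> graded b (rowspan G).
Proof. by move=> gG u _ [w ->]; exists (pr (fun=> u) a w); rewrite (prMr _ _ gG). Qed.

Hypothesis noeR : noetherian R.

(** An [idealr] is proper by definition, so the unit ideal is handled apart, with the generator
    1. *)
Lemma ideal_fg (I : set R) : I 0 -> (forall a x y, I x -> I y -> I (a * x + y)) ->
  exists r (g : 'I_r -> R), forall x, I x <-> exists c : 'I_r -> R, x = \sum_i c i * g i.
Proof.
move=> I0 IM; have [I1|nI1] := pselect (I 1).
  exists 1%N, (fun=> 1) => x; split=> _.
    by exists (fun=> x); rewrite big_ord1 mulr1.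
  by rewrite -[x]mulr1 -[_ * _]addr0; exact: IM.
pose J : {pred R} := fun x => `[< I x >].
have cJ : idealr_closed J.
  split; first exact/asboolP.
    by apply/negP => /asboolP.
  by move=> a x y /asboolP Ix /asboolP Iy; apply/asboolP; exact: IM.
pose Ji : idealr R := HB.pack_for (idealr R) J (isIdealr.Build R J cJ).
have [r [g gP]] := noeR Ji; exists r, g => x; rewrite -gP.
by split=> [Ix|/asboolP//]; exact/asboolP.
Qed.

(** Induction on the rank: the first coordinates of [U] form an ideal, and the vectors of [U] with
    first coordinate zero form a submodule of smaller rank. *)
Lemma submod_fg n (U : set 'rV[R]_n) : submod U ->
  exists m (G : 'M[R]_(m, n)), forall v, U v <-> rowspan G v.
Proof.
elim: n U => [|n IH] U sU.
  exists 0%N, 0 => v; split=> _.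
    by exists 0; rewrite [v]thinmx0 [RHS]thinmx0.
  by rewrite [v]thinmx0; case: sU.
move: U sU; rewrite -[n.+1]/(1 + n)%N => U sU.
pose I := fun x => exists2 v, U v & v 0 0 = x.
have [||r [g gP]] := @ideal_fg I.
- by exists 0; rewrite ?mxE //; case: sU.
- move=> a _ _ [x Ux <-] [y Uy <-]; exists (a *: x + y); rewrite ?mxE //.
  exact: (proj2 sU).
have /choice[V VP] : forall i, exists v, U v /\ v 0 0 = g i.
  move=> i; have [v Uv vE] : I (g i).
    apply/gP; exists (fun j => (i == j)%:R).
    rewrite (bigD1 i) //= eqxx mul1r big1 ?addr0 // => j; rewrite eq_sym => /negbTE ->.
    by rewrite mul0r.
  by exists v.
have [|m [G GP]] := IH (fun w => U (row_mx (0 : 'rV_1) w)).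
  split; first by rewrite row_mx0; case: sU.
  move=> a x y Ux Uy; rewrite -[0 : 'rV_1](addr0) -{1}[0 : 'rV_1](scaler0 _ a).
  by rewrite -add_row_mx -scale_row_mx; exact: (proj2 sU).
exists (r + m)%N, (col_mx (\matrix_i V i) (row_mx (0 : 'M_(m, 1)) G)) => v; split.
  move=> Uv; have /gP[c cE] : I (v 0 0) by exists v.
  pose w := v - (\row_i c i) *m \matrix_i V i.
  have Uw : U w.
    apply: submodD => //; apply: submodN => //; apply: submod_mul => // i.
    by rewrite rowK; case: (VP i).
  have w0 : lsubmx w = 0.
    apply/rowP => j; rewrite mxE (_ : lshift n j = 0); last first.
      by apply: val_inj; rewrite /= (ord1 j).
    rewrite !mxE cE; apply/eqP; rewrite subr_eq0; apply/eqP.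
    by apply: eq_bigr => i _; rewrite !mxE; case: (VP i) => _ <-.
  have /GP[z zE] : U (row_mx 0 (rsubmx w)) by rewrite -w0 hsubmxK.
  exists (row_mx (\row_i c i) z); rewrite mul_row_col mul_mx_row mulmx0 -zE.
  by rewrite -w0 hsubmxK /w addrC subrK.
move=> [w ->]; apply: submod_mul => // i; rewrite -[i]splitK.
case: (split i) => j /=; first by rewrite rowKu rowK; case: (VP j).
rewrite rowKd row_row_mx row0.
by apply/GP; exists (delta_mx 0 j); rewrite rowE.
Qed.

Lemma graded_fg n a (U : set 'rV[R]_n) : submod U -> graded a U ->
  exists m (b : 'I_m -> int) (G : 'M[R]_(m, n)),
    gmx b a G /\ forall v, U v <-> rowspan G v.
Proof.
move=> sU gU; have [m [G GP]] := submod_fg sU.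
have /choice[S SP] := fun i => row_decomp a (row i G).
pose L := flatten [seq [seq (i, u) | u <- S i] | i <- enum 'I_m].
pose H := \matrix_(j < size L) pr (fun=> (tnth (in_tuple L) j).2) a (row (tnth (in_tuple L) j).1 G).
exists (size L), (fun j => (tnth (in_tuple L) j).2), H; split.
  by move=> j l; rewrite mxE; exact: pr_gmx.
have UG i : U (row i G) by apply/GP; exists (delta_mx 0 i); rewrite rowE.
move=> v; split=> [/GP[w ->]|[w ->]]; last first.
  by apply: submod_mul => // j; rewrite rowK; exact: gU.
have sH := rowspan_submod H.
apply: submod_mul => // i; rewrite SP big_seq; apply: submod_sum => // u uS.
have : (i, u) \in L.
  apply/flattenP; exists [seq (i, u) | u <- S i]; last by apply/mapP; exists u.
  by apply/mapP; exists i; rewrite ?mem_enum.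
move=> /(tnthP (in_tuple L))[j jE]; exists (delta_mx 0 j).
by rewrite -rowE rowK -jE.
Qed.

(** A counterexample starts, by choice, a strictly increasing chain of submodules. Its union is
    finitely generated, hence already reached at some stage [M], against strictness at [M.+1]. *)
Lemma noeth_ind n (Psi : set 'rV[R]_n -> Prop) :
  (forall U, submod U ->
     (forall U', submod U' -> (forall x, U x -> U' x) -> (exists2 x, U' x & ~ U x) -> Psi U') ->
     Psi U) ->
  forall U, submod U -> Psi U.
Proof.
move=> step U0 sU0; apply: contrapT => nU0.
pose T := {U : set 'rV[R]_n | submod U /\ ~ Psi U}.
have next (U : T) : {U' : T | (forall x, sval U x -> sval U' x) /\ exists2 x, sval U' x & ~ sval U x}.
  case: U => U [sU nU] /=; apply: cid; apply: contrapT => no; apply: nU.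
  apply: step => // U' sU' UU' ex; apply: contrapT => nU'; apply: no.
  by exists (exist _ U' (conj sU' nU')).
pose f := fix f n : T := if n is n.+1 then sval (next (f n)) else exist _ U0 (conj sU0 nU0).
have mono i j x : (i <= j)%N -> sval (f i) x -> sval (f j) x.
  move=> /subnKC <-; elim: (j - i)%N => [|l IH]; rewrite ?addn0 // addnS => /IH.
  by move=> /=; case: (next _) => U' [/= h _]; exact: h.
have sf i : submod (sval (f i)) by case: (f i) => U [].
pose Un := fun x => exists i, sval (f i) x.
have [|m [G GP]] := @submod_fg n Un.
  split; first by exists 0%N; case: (sf 0%N).
  move=> a x y [i xi] [j yj]; exists (maxn i j); apply: (proj2 (sf _)).
    by apply: mono xi; exact: leq_maxl.
  by apply: mono yj; exact: leq_maxr.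
have /choice[N NP] : forall i, exists j, sval (f j) (row i G).
  by move=> i; apply/GP; exists (delta_mx 0 i); rewrite rowE.
pose M := (\max_i N i)%N.
have [_ [x xM nx]] := svalP (next (f M)); apply: nx.
have [w ->] : rowspan G x by apply/GP; exists M.+1.
by apply: submod_mul => // i; apply: mono (NP i); exact: leq_bigmax.
Qed.

End IntegerGrading.

(** * Graded free resolutions *)

Definition fsz (n0 : nat) (s : nat -> nat) (j : nat) : nat :=
  match j with 0%N => n0 | j.+1 => s j end.

(* A graded free resolution of [R^n0 / rowspan (rD 0)]. Keeping [n0] as a parameter,
   instead of the value of the sequence of ranks at 0, avoids casts. *)
Record resolution (k : fieldType) (R : gring k) (n0 : nat) := GRes {
  rsz : nat -> nat;
  rdg : forall j, 'I_(fsz n0 rsz j) -> int;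
  rD : forall j, 'M[R]_(fsz n0 rsz j.+1, fsz n0 rsz j);
  rgmx : forall j, gmx (@rdg j.+1) (@rdg j) (rD j);
  rcx : forall j, rD j.+1 *m rD j = 0;
  rex : forall j v, v *m rD j = 0 -> rowspan (rD j.+1) v }.

Arguments rdg {k R n0 g j} _ : rename.

Notation sz P j := (fsz _ (rsz P) j).

Lemma solve_rows (k : fieldType) (R : gring k) m n p (X : 'M[R]_(m, n)) (D : 'M_(p, n)) :
  (forall i, rowspan D (row i X)) -> exists Y, X = Y *m D.
Proof.
move=> /choice[y yP]; exists (\matrix_i y i); apply/row_matrixP => i.
by rewrite row_mul rowK.
Qed.

Lemma rexM (k : fieldType) (R : gring k) n0 (P : resolution R n0) j m (X : 'M[R]_(m, sz P j.+1)) :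
  X *m rD P j = 0 -> exists Y, X = Y *m rD P j.+1.
Proof.
by move=> X0; apply: solve_rows => i; apply: rex; rewrite -row_mul X0 row0.
Qed.

Definition splitdg m n (a : 'I_m -> int) (b : 'I_n -> int) : 'I_(m + n) -> int :=
  fun i => match split i with inl l => a l | inr l => b l end.

Section Resolutions.
Variables (k : fieldType) (R : gring k).

Lemma gmx_col m n p (a : 'I_m -> int) (b : 'I_n -> int) (c : 'I_p -> int)
    (X : 'M[R]_(m, p)) Y :
  gmx (splitdg a b) c (col_mx X Y) <-> gmx a c X /\ gmx b c Y.
Proof.
split=> [g|[gX gY] i l]; last by rewrite mxE /splitdg; case: split => j.
split=> i l.
  by have := g (lshift n i) l; rewrite col_mxEu /splitdg (unsplitK (inl i)).
by have := g (rshift m i) l; rewrite col_mxEd /splitdg (unsplitK (inr i)).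
Qed.

Lemma gmx_row m n p (a : 'I_m -> int) (b : 'I_n -> int) (c : 'I_p -> int)
    (X : 'M[R]_(p, m)) Y :
  gmx c a X -> gmx c b Y -> gmx c (splitdg a b) (row_mx X Y).
Proof. by move=> gX gY i l; rewrite mxE /splitdg; case: split => j. Qed.

Section Existence.
Hypothesis noeR : noetherian R.

(** A single differential bundled with its ranks and degrees, so that a resolution arises by
    iterating a map on one type. *)
Record stage := Stage { sn : nat; sm : nat; sa : 'I_sn -> int; sb : 'I_sm -> int;
  sD : 'M[R]_(sm, sn); sg : gmx sb sa sD }.

Lemma ker_submod m n (D : 'M[R]_(m, n)) : submod (fun v : 'rV[R]_m => v *m D = 0).
Proof.
split; first by rewrite mul0mx.
by move=> a x y x0 y0; rewrite mulmxDl -scalemxAl x0 y0 scaler0 addr0.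
Qed.

Lemma ker_graded m n a b (D : 'M[R]_(m, n)) : gmx b a D ->
  graded b (fun v : 'rV[R]_m => v *m D = 0).
Proof.
move=> gD u v v0; rewrite -(prMr _ _ gD) v0.
by apply/matrixP => i l; rewrite !mxE /rcomp gcomp0.
Qed.

Lemma gst_next (s : stage) : exists x : {m : nat & (('I_m -> int) * 'M[R]_(m, sm s))%type},
  gmx (projT2 x).1 (@sb s) (projT2 x).2 /\
  forall v, v *m sD s = 0 <-> rowspan (projT2 x).2 v.
Proof.
have [m [b [G h]]] := graded_fg noeR (ker_submod (sD s)) (ker_graded (@sg s)).
by exists (existT _ m (b, G)).
Qed.

Definition nxt (s : stage) : stage :=
  Stage (proj1 (svalP (cid (gst_next s)))).

Lemma nxtP s (v : 'rV_(sm s)) : v *m sD s = 0 <-> rowspan (sD (nxt s)) v.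
Proof. exact: (proj2 (svalP (cid (gst_next s)))). Qed.

Lemma gres_ex n (a : 'I_n -> int) (U : set 'rV[R]_n) : submod U -> graded a U ->
  exists P : resolution R n, rdg (g := P) (j := 0) = a /\ forall v, U v <-> rowspan (rD P 0) v.
Proof.
move=> sU gU; have [m [b [G [gG GP]]]] := graded_fg noeR sU gU.
pose f := fix f j := if j is j.+1 then nxt (f j) else Stage gG.
pose s j := sm (f j).
pose dg j : 'I_(fsz n s j) -> int :=
  match j return 'I_(fsz n s j) -> int with 0%N => a | j.+1 => @sb (f j) end.
pose D j : 'M[R]_(fsz n s j.+1, fsz n s j) :=
  match j return 'M[R]_(fsz n s j.+1, fsz n s j) with
  | 0%N => G | j.+1 => sD (f j.+1) end.
have gD j : gmx (@dg j.+1) (@dg j) (D j) by case: j => [|j]; [exact: gG|exact: (@sg (f j.+1))].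
have xD j v : v *m D j = 0 <-> rowspan (D j.+1) v by case: j v => [|j] v; [exact: (@nxtP (f 0) v)|exact: (@nxtP (f j.+1) v)].
have cD j : D j.+1 *m D j = 0.
  apply/row_matrixP => i; rewrite row_mul row0; apply/xD.
  by exists (delta_mx 0 i); rewrite rowE.
by exists (@GRes k R n s dg D gD cD (fun j v => proj1 (xD j v))).
Qed.

End Existence.

Section ChainMap.
Variables (n n' : nat) (P : resolution R n) (P' : resolution R n') (a0 : 'M[R]_(n', n)).
Hypothesis ga0 : gmx (rdg (g := P') (j := 0)) (rdg (g := P) (j := 0)) a0.
Hypothesis ha0 : forall v, rowspan (rD P' 0) v -> rowspan (rD P 0) (v *m a0).

(** The existence of [be] is exactly what the next lifting step consumes; keeping it in the
    invariant makes the chain map a plain recursion. *)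
Definition liftable j (al : 'M[R]_(sz P' j, sz P j)) :=
  gmx (rdg (g := P') (j := j)) (rdg (g := P) (j := j)) al /\
  exists be, rD P' j *m al = be *m rD P j.

Lemma lift_next j (al : 'M[R]_(sz P' j, sz P j)) : liftable al ->
  exists be, rD P' j *m al = be *m rD P j /\ liftable be.
Proof.
move=> [ga [be0 be0E]].
have [be gb bE] := gmx_solve_r (gmxM (@rgmx _ _ _ P' j) ga) (@rgmx _ _ _ P j) be0E.
exists be; split=> //; split=> //; apply: rexM.
by rewrite -mulmxA -bE mulmxA rcx mul0mx.
Qed.

Lemma chain_ex : exists al : forall j, 'M[R]_(sz P' j, sz P j),
  [/\ al 0 = a0, forall j, gmx (rdg (g := P') (j := j)) (rdg (g := P) (j := j)) (al j)
    & forall j, rD P' j *m al j = al j.+1 *m rD P j].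
Proof.
have l0 : @liftable 0 a0.
  split=> //; apply: solve_rows => i; rewrite row_mul; apply: ha0.
  by exists (delta_mx 0 i); rewrite rowE.
pose T j := {al : 'M[R]_(sz P' j, sz P j) | liftable al}.
pose step j (x : T j) : T j.+1 :=
  let y := cid (lift_next (svalP x)) in exist _ (sval y) (proj2 (svalP y)).
pose f := fix f j : T j := if j is j.+1 then step j (f j) else exist _ a0 l0.
exists (fun j => sval (f j)); split=> // j; first by case: (svalP (f j)).
by rewrite /= /step /=; case: (cid _) => be [].
Qed.
End ChainMap.

(* Degree [i] cocycles and coboundaries of the dual complex, as column vectors. *)
Definition Zc n (P : resolution R n) j (i : int) : set 'cV[R]_(sz P j) :=
  fun c => gmx (rdg (g := P) (j := j)) (fun=> - i) c /\ rD P j *m c = 0.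

Definition Bc n (P : resolution R n) j (i : int) : set 'cV[R]_(sz P j) :=
  match j return set 'cV[R]_(sz P j) with
  | 0%N => fun c => c = 0
  | j.+1 => fun c => exists2 b, gmx (rdg (g := P) (j := j)) (fun=> - i) b & c = rD P j *m b
  end.

Arguments Zc {n} P j i _.
Arguments Bc {n} P j i _.

Lemma Bc_intro n (P : resolution R n) j i c b :
  gmx (rdg (g := P) (j := j.+1)) (fun=> - i) c -> c = rD P j *m b -> Bc P j.+1 i c.
Proof.
move=> gc cE; have [b' gb' ->] := gmx_solve_l gc (@rgmx _ _ _ P j) cE.
by exists b'.
Qed.

(** * Mapping cones *)

Section Cone.
Variables (n n' : nat) (P : resolution R n) (P' : resolution R n').
Variable al : forall j, 'M[R]_(fsz n' (rsz P') j, fsz n (rsz P) j).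
Hypothesis gal : forall j, gmx (rdg (g := P') (j := j)) (rdg (g := P) (j := j)) (al j).
Hypothesis cal : forall j, rD P' j *m al j = al j.+1 *m rD P j.
Hypothesis inj : forall w : 'rV_n', rowspan (rD P 0) (w *m al 0) -> rowspan (rD P' 0) w.

Definition csz j := (fsz n (rsz P) j.+1 + fsz n' (rsz P') j)%N.
Definition cdg j : 'I_(fsz n csz j) -> int :=
  match j return 'I_(fsz n csz j) -> int with
  | 0%N => rdg (g := P) (j := 0)
  | j.+1 => splitdg (rdg (g := P) (j := j.+1)) (rdg (g := P') (j := j)) end.
(** The mapping cone of [al]. By [inj] the induced map of resolved modules is injective, so the cone
    resolves its cokernel, still presented on the [n] generators of [P]. The sign makes the square
    of the differential vanish. *)
Definition cD j : 'M[R]_(fsz n csz j.+1, fsz n csz j) :=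
  match j return 'M[R]_(fsz n csz j.+1, fsz n csz j) with
  | 0%N => col_mx (rD P 0) (al 0)
  | j.+1 => block_mx (rD P j.+1) 0 (al j.+1) (- rD P' j) end.

Lemma cD_gmx j : gmx (@cdg j.+1) (@cdg j) (cD j).
Proof.
case: j => [|j]; apply/gmx_col; first by split; [exact: (@rgmx _ _ _ P 0)|exact: gal].
split; apply: gmx_row.
- exact: (@rgmx _ _ _ P j.+1).
- exact: gmx0.
- exact: gal.
- apply: gmxN; exact: (@rgmx _ _ _ P' j).
Qed.

Lemma cD_cx j : cD j.+1 *m cD j = 0.
Proof.
case: j => [|j]; rewrite /cD.
  rewrite (mul_block_col (rD P 1)) rcx mul0mx mulNmx cal add0r subrr.
  by rewrite -[RHS]col_mx0.
rewrite (mulmx_block (rD P j.+2)) !rcx !mulmx0 !mul0mx !mulmxN !mulNmx opprK rcx.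
by rewrite !addr0 ?oppr0 cal subrr -[RHS]block_mx0.
Qed.

Lemma cD_ex j v : v *m cD j = 0 -> rowspan (cD j.+1) v.
Proof.
case: j v => [|j] v; rewrite /cD -[v]hsubmxK.
  rewrite (mul_row_col (lsubmx v)) => /eqP; rewrite addr_eq0 => /eqP v0.
  have [|u uE] := inj (w := rsubmx v).
    by exists (- lsubmx v); rewrite mulNmx v0 opprK.
  have [|t tE] := @rex _ _ _ P 0 (lsubmx v + u *m al 1).
    by rewrite mulmxDl v0 uE -!mulmxA cal addNr.
  exists (row_mx t (- u)); rewrite (mul_row_block t) mulmx0 add0r mulNmx mulmxN mulNmx opprK.
  by rewrite -uE -tE addrK.
rewrite (mul_row_block (lsubmx v)) mulmx0 add0r => vE.
have [v0 /eqP w0] : lsubmx v *m rD P j.+1 + rsubmx v *m al j.+1 = 0 /\ rsubmx v *m - rD P' j = 0.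
  by apply: eq_row_mx; rewrite vE row_mx0.
move: w0; rewrite mulmxN oppr_eq0 => /eqP /rex[u uE].
move/eqP: v0; rewrite addr_eq0 => /eqP v0.
have [|t tE] := @rex _ _ _ P j.+1 (lsubmx v + u *m al j.+2).
  by rewrite mulmxDl v0 uE -!mulmxA cal addNr.
exists (row_mx t (- u)); rewrite (mul_row_block t) mulmx0 add0r mulNmx mulmxN mulNmx opprK.
by rewrite -uE -tE addrK.
Qed.

Definition cone : resolution R n := GRes cD_gmx cD_cx cD_ex.

Lemma cone_span v : rowspan (rD cone 0) v <->
  exists w, rowspan (rD P 0) (v + w *m al 0).
Proof.
split=> [[w ->]|[w [u uE]]].
  rewrite -[w]hsubmxK (mul_row_col (lsubmx w)); exists (- rsubmx w).
  by rewrite mulNmx addrK; exists (lsubmx w).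
by exists (row_mx u (- w)); rewrite (mul_row_col u) -uE mulNmx addrK.
Qed.

End Cone.

End Resolutions.
Arguments Zc {k R n} P j i _.
Arguments Bc {k R n} P j i _.

Section FiniteSpan.
Variables (k : fieldType) (R : comAlgType k).

Lemma qle_fin (V : lmodType R) (T : finType) (Z B : set V) (v : T -> V) :
  (forall z, Z z -> exists c : T -> k, B (z - \sum_t (c t)%:A *: v t)) -> qle Z B #|T|.
Proof.
move=> vP; exists (fun i => v (enum_val i)) => z /vP[c cP].
exists (fun i => c (enum_val i)); move: cP; rewrite (reindex (@enum_val T T)) //.
exact: onW_bij (enum_val_bij _).
Qed.

Definition fdim (V : lmodType R) (Z : set V) := exists n, qle Z (fun z => z = 0) n.

Lemma fdim_sum (V W : lmodType R) m (Z : set V) (Y : 'I_m -> set W) (h : 'I_m -> W -> V) :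
  (forall j, klin (h j)) -> (forall j, fdim (Y j)) ->
  (forall z, Z z -> exists y : 'I_m -> W, (forall j, Y j (y j)) /\ z = \sum_j h j (y j)) ->
  fdim Z.
Proof.
move=> lh /choice[n nP] ZP.
have /choice[v vP] : forall j, exists v : 'I_(\max_j n j)%N -> W, forall z, Y j z ->
    exists c : 'I__ -> k, z - \sum_i (c i)%:A *: v i = 0.
  by move=> j; apply: (qle_mono _ (nP j)); exact: leq_bigmax.
eexists; apply: (@qle_fin _ _ _ _ (fun t : 'I_m * _ => h t.1 (v t.1 t.2))) => z /ZP[y [Yy ->]].
have /choice[c cP] := fun j => vP j _ (Yy j).
exists (fun t => c t.1 t.2); rewrite -(pair_bigA _ (fun j i => (c j i)%:A *: h j (v j i))) /=.
rewrite -sumrB big1 // => j _; have /subr0_eq -> := cP j.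
rewrite (klin_sum (lh j)) -sumrB big1 // => i _.
by rewrite (klinZ (lh j)) subrr.
Qed.

Lemma fdim_sub (V : lmodType R) (Z Z' : set V) : (forall z, Z' z -> Z z) -> fdim Z -> fdim Z'.
Proof. by move=> s [n nP]; exists n; exact: qle_sub nP. Qed.

End FiniteSpan.

Section GradedRing.
Variables (k : fieldType) (R : gring k).
Hypothesis R0 : forall x : R, rdeg 0%N x <-> exists c : k, x = c%:A.
Hypothesis noeR : noetherian R.

Lemma RzZ i (c : k) (x : R) : Rz i x -> Rz i ((c%:A : R) * x).
Proof.
move=> dx; rewrite -[i]add0r; apply: RzM => //.
by apply/(R0 _); exists c.
Qed.

Lemma gmxZ m n (a : 'I_m -> int) (b : 'I_n -> int) (c : k) (X : 'M[R]_(m, n)) :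
  gmx a b X -> gmx a b ((c%:A : R) *: X).
Proof. by move=> gX i l; rewrite mxE; exact: RzZ. Qed.

Lemma irrelevantP x : (x \in irrelevant R) <-> rcomp x 0 = 0.
Proof.
split=> [/asboolP[s sP ->]|x0].
  rewrite /rcomp gcomp_sum big1_seq // => y /andP[_ /sP[i i0 dy]].
  by rewrite (gcomp_homog _ (i := Posz i)) //; case: eqP => // -[i00]; rewrite -i00 in i0.
have [s [us dx xs xE]] := gcompP (Rz_grading R) x.
apply/asboolP; exists [seq rcomp x i | i <- s & 0 < i].
  move=> y /mapP[i]; rewrite mem_filter => /andP[i0 _] ->.
  by case: i i0 => // i i0; exists i => //; exact: (dx (Posz i)).
rewrite big_map big_filter {1}xE (bigID (fun i : int => 0 < i)) /= [X in _ + X]big1 ?addr0 //.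
move=> i ni; have [->|i0] := eqVneq i 0; first exact: x0.
by apply: (Rz_neg _ (dx i)); lia.
Qed.

Lemma rdeg0_unit (x : R) : Rz 0 x -> x != 0 -> exists y, y * x = 1.
Proof.
move=> /R0[c ->] c0; exists (c^-1)%:A; rewrite -scalerAl mul1r scalerA mulVf ?scale1r //.
by apply: contraNneq c0 => ->; rewrite scale0r.
Qed.

Lemma irrelevant_gen : exists m (b : 'I_m -> nat) (g : 'I_m -> R),
  (forall j, Rz (b j) (g j) /\ (0 < b j)%N) /\
  forall (i : int) (x : R), 0 < i -> Rz i x ->
    exists w : 'I_m -> R, (forall j, Rz (i - (b j)%:Z) (w j)) /\ x = \sum_j w j * g j.
Proof.
pose U := fun v : 'rV[R]_1 => v 0 0 \in irrelevant R.
have sU : submod U.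
  split; first by rewrite /U mxE rpred0.
  by move=> a x y Ux Uy; rewrite /U !mxE rpredD // irrelevantM.
have gU : graded (fun=> 0) U.
  move=> u v Uv; rewrite /U mxE; apply/irrelevantP.
  rewrite subr0 /rcomp (gcomp_homog _ _ (gcomp_deg _ _ u)); case: eqP => // <-.
  exact/irrelevantP.
have [m [b [G [gG GP]]]] := graded_fg noeR sU gU.
have UG j : U (row j G) by apply/GP; exists (delta_mx 0 j); rewrite rowE.
have G0 j : b j <= 0 -> G j 0 = 0.
  move=> bj; have := gG j 0; rewrite subr0; have [b0|b0] := eqVneq (b j) 0.
    have := UG j; rewrite /U mxE => /irrelevantP; rewrite b0 => + d0.
    by rewrite /rcomp (gcomp_id _ d0).
  by apply: Rz_neg; lia.
(* A generator listed in degree at most 0 is zero by [G0], so it may be declared to have degree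
   1. *)
exists m, (fun j => if 0 < b j then `|b j|%N else 1%N), (fun j => G j 0); split.
  move=> j; case: ifP => b0; split; rewrite ?absz_gt0 ?gt_eqF //.
    by have := gG j 0; rewrite subr0 gez0_abs // ltW.
  by rewrite G0; [exact: Rz0|rewrite leNgt b0].
move=> i x i0 dx.
have [w wE] : rowspan G (const_mx x).
  apply/GP; rewrite /U mxE; apply/irrelevantP; rewrite /rcomp (gcomp_homog _ _ dx).
  by case: eqP => // i00; rewrite -i00 ltxx in i0.
have gx : gmx (fun=> i) (fun=> 0) (const_mx x : 'rV_1) by move=> ? ?; rewrite subr0 mxE.
have [w' gw wE'] := gmx_solve_r gx gG wE.
exists (fun j => if 0 < b j then w' 0 j else 0); split.
  move=> j; case: ifP => b0; last exact: Rz0.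
  by have := gw 0 j; rewrite gez0_abs // ltW.
have := congr1 (fun v : 'rV_1 => v 0 0) wE'; rewrite !mxE => ->.
apply: eq_bigr => j _; case: ifP => // /negbT b0.
by rewrite (G0 j) ?mulr0 // leNgt.
Qed.

(** Strong induction on the degree: an element of positive degree is a combination of the generators
    of the irrelevant ideal, with coefficients of smaller degree. *)
Lemma Rz_fin i : fdim (V := R^o) (@Rz _ R i).
Proof.
case: i => i; last first.
  by exists 0%N; apply/qle0P => z.
have [m [b [g [gb gen]]]] := irrelevant_gen.
elim/ltn_ind: i => -[|i] IH.
  exists 1%N, (fun=> 1) => z /R0[c ->]; exists (fun=> c).
  by rewrite big_ord1 /GRing.scale /= mulr1 subrr.
apply: (fdim_sum (Y := fun j : 'I_m => @Rz _ R (i.+1%:Z - (b j)%:Z) : set R^o)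
  (h := fun j w => w * g j)).
- by move=> j c x y; rewrite mulrDl scalerAl.
- move=> j; have [_ b0] := gb j; have [le|lt] := leqP (b j) i.+1.
    rewrite subzn //; apply: IH; lia.
  by exists 0%N; apply/qle0P => z; apply: Rz_neg; lia.
- by move=> z /gen; apply.
Qed.

Lemma gmx_fin m (a : 'I_m -> int) i : fdim (V := 'cV[R]_m) (gmx a (fun=> - i)).
Proof.
apply: (fdim_sum (Y := fun j : 'I_m => @Rz _ R (a j - - i) : set R^o)
  (h := fun j w => w *: (delta_mx j 0 : 'cV[R]_m))).
- by move=> j c x y; rewrite scalerDl scalerA.
- by move=> j; exact: Rz_fin.
- move=> z gz; exists (fun j => z j 0); split; first by move=> j; exact: gz.
  by rewrite {1}[z]matrix_sum_delta; apply: eq_bigr => j _; rewrite big_ord1.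
Qed.

Section Complex.
Variables (n : nat) (P : resolution R n).

Lemma Zc_subsp j i : subsp (Zc P j i).
Proof.
split; first by split; [exact: gmx0|rewrite mulmx0].
move=> c x y [gx x0] [gy y0]; split; first by apply: gmxD => //; exact: gmxZ.
by rewrite mulmxDr -scalemxAr x0 y0 scaler0 addr0.
Qed.

Lemma Bc_subsp j i : subsp (Bc P j i).
Proof.
case: j => [|j]; first exact: subsp0.
split; first by exists 0; [exact: gmx0|rewrite mulmx0].
move=> c _ _ [x gx ->] [y gy ->]; exists ((c%:A : R) *: x + y).
  by apply: gmxD => //; exact: gmxZ.
by rewrite mulmxDr -scalemxAr.
Qed.

(** [R] lives in nonnegative degrees. This lower bound is where the inductions on the degree
    start. *)
Lemma Zc_low j : exists N : nat, forall i, i < - N%:Z -> forall c, Zc P j i c -> c = 0.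
Proof.
exists (\max_l `|rdg (g := P) (j := j) l|)%N => i iN c [gc _].
apply/matrixP => l l'; rewrite mxE; apply: (Rz_neg _ (gc l l')).
have := leq_bigmax (F := fun l => `|rdg (g := P) (j := j) l|%N) l; lia.
Qed.

(* Multiplication by [a] is null-homotopic; [S] is one stage of the homotopy. *)
Lemma kill_homotopy (a : R) : (forall v, rowspan (rD P 0) (a *: v)) -> forall j,
  exists S, rD P j *m S *m rD P j = a *: rD P j.
Proof.
move=> ha; elim=> [|j [S SE]].
  have [i|S SE] := @solve_rows _ _ _ _ _ (a%:M) (rD P 0).
    by rewrite -[a%:M]mulmx1 mul_scalar_mx linearZ /=; exact: ha.
  by exists S; rewrite -mulmxA -SE mul_mx_scalar.
have [|S' SE'] := @rexM _ _ _ P j _ (a%:M - rD P j *m S).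
  by rewrite mulmxBl SE mul_scalar_mx subrr.
exists S'; rewrite -mulmxA -SE' mulmxBr mul_mx_scalar mulmxA rcx mul0mx subr0.
by [].
Qed.

Lemma hom_kill (a : R) d : Rz d a -> (forall v, rowspan (rD P 0) (a *: v)) ->
  forall j i c, Zc P j i c -> Bc P j (i + d) (a *: c).
Proof.
move=> da ha j i c [gc c0].
have gac : gmx (rdg (g := P) (j := j)) (fun=> - (i + d)) (a *: c).
  move=> l l'; rewrite mxE (_ : _ - _ = d + (rdg l - - i)); last by ring.
  exact: RzM.
have [S SE] := kill_homotopy ha j.
case: j c gc c0 gac S SE => [|j] c gc c0 gac S SE.
  have [i'|T TE] := @solve_rows _ _ _ _ _ (a%:M) (rD P 0).
    by rewrite -[a%:M]mulmx1 mul_scalar_mx linearZ /=; exact: ha.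
  by rewrite /Bc -mul_scalar_mx TE -mulmxA c0 mulmx0.
have [S1 SE1] := kill_homotopy ha j.
(* [a] minus [rD P j *m S1] factors through the next differential, which kills the cocycle [c];
   hence [a *: c] is the image of [S1 *m c]. *)
have [|S' SE'] := @rexM _ _ _ P j _ (a%:M - rD P j *m S1).
  by rewrite mulmxBl SE1 mul_scalar_mx subrr.
apply: (@Bc_intro _ _ _ _ _ _ _ (S1 *m c)) => //.
apply/eqP; rewrite -subr_eq0 mulmxA -mul_scalar_mx -mulmxBl SE'.
by rewrite -mulmxA c0 mulmx0.
Qed.

Definition vanishing j := forall i c, Zc P j i c -> Bc P j i c.

Lemma Zc_fin j i : exists m, qle (Zc P j i) (Bc P j i) m.
Proof.
have [m mP] := gmx_fin (rdg (g := P) (j := j)) i; exists m.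
have [v vP] := qle_sub (fun z (h : Zc P j i z) => proj1 h) mP.
exists v => z /vP[c cE]; exists c; rewrite cE; exact: (proj1 (Bc_subsp j i)).
Qed.

End Complex.

Section ConeExact.
Variables (n n' : nat) (P : resolution R n) (P' : resolution R n').
Variable al : forall j, 'M[R]_(fsz n' (rsz P') j, fsz n (rsz P) j).
Hypothesis gal : forall j, gmx (rdg (g := P') (j := j)) (rdg (g := P) (j := j)) (al j).
Hypothesis cal : forall j, rD P' j *m al j = al j.+1 *m rD P j.
Hypothesis inj : forall w : 'rV_n', rowspan (rD P 0) (w *m al 0) -> rowspan (rD P' 0) w.

Let C := cone gal cal inj.

Lemma klin_mul m p (A : 'M[R]_(m, p)) : klin (fun c : 'cV[R]_p => A *m c).
Proof. by move=> c x y; rewrite mulmxDr -scalemxAr. Qed.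

Lemma al_Zc j i c : Zc P j i c -> Zc P' j i (al j *m c).
Proof.
move=> [gc c0]; split; first exact: gmxM (@gal j) gc.
by rewrite mulmxA cal -mulmxA c0 mulmx0.
Qed.

Lemma al_Bc j i c : Bc P j i c -> Bc P' j i (al j *m c).
Proof.
case: j c => [|j] c; first by move=> ->; exact: mulmx0.
move=> [b gb ->]; exists (al j *m b); first exact: gmxM (@gal j) gb.
by rewrite mulmxA -cal mulmxA.
Qed.

Lemma cone_Zc j i (x : 'cV_(fsz n (rsz P) j.+1)) (y : 'cV_(fsz n' (rsz P') j)) :
  Zc C j.+1 i (col_mx x y) <->
  [/\ Zc P j.+1 i x, gmx (rdg (g := P') (j := j)) (fun=> - i) y
    & al j.+1 *m x = rD P' j *m y].
Proof.
have E : rD C j.+1 *m col_mx x y = col_mx (rD P j.+1 *m x) (al j.+1 *m x - rD P' j *m y).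
  by rewrite (mul_block_col (rD P j.+1)) mul0mx addr0 mulNmx.
split=> [[/gmx_col[gx gy]]|[[gx x0] gy xy]].
  rewrite E -col_mx0 => /eq_col_mx[x0 /eqP]; rewrite subr_eq0 => /eqP xy.
  by split.
split; first exact/gmx_col.
by rewrite E x0 xy subrr col_mx0.
Qed.

(* [cone_E1] and [cone_E2] express the exactness of
   H^j(C) -> H^j(P) -> H^j(P') -> H^(j+1)(C) at the two middle terms. *)
Lemma cone_E1 j i n1 n2 : qle (Zc C j i) (Bc C j i) n1 ->
  qle (Zc P' j i) (Bc P' j i) n2 -> qle (Zc P j i) (Bc P j i) (n2 + n1).
Proof.
move=> q1 [v vP]; apply: (qle_ext (h := fun c => al j *m c) (B2 := Bc P' j i)).
- exact: klin_mul.
- exact: Zc_subsp.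
- exact: Bc_subsp.
- by exists v => z /al_Zc /vP.
case: j v vP q1 => [|j] v vP q1.
  apply: qle_sub q1 => z [[gz z0] /= az]; split; first exact: gz.
  by change (col_mx (rD P 0) (al 0) *m z = 0); rewrite mul_col_mx z0 az col_mx0.
apply: (qle_onto (h := @usubmx _ (fsz n (rsz P) j.+1) (fsz n' (rsz P') j) 1) (Z1 := Zc C j.+1 i)
   (B1 := Bc C j.+1 i)) => //.
- by move=> c x y; rewrite linearD linearZ.
- exact: Bc_subsp.
- move=> z [Zz [b gb bE]]; exists (col_mx z b); first exact/cone_Zc.
  by rewrite col_mxKu subrr; case: (Bc_subsp P j.+1 i).
- case: j {v vP q1} => [|j] _ [c gc ->].
    rewrite (_ : rD C 0 *m c = col_mx (rD P 0 *m c) (al 0 *m c)); last exact: mul_col_mx.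
    by rewrite col_mxKu; exists c.
  rewrite -[c]vsubmxK in gc *; have /gmx_col[gx gy] := gc.
  rewrite (mul_block_col (rD P j.+1)) col_mxKu mul0mx addr0.
  by exists (@usubmx _ (fsz n (rsz P) j.+1) _ _ c).
Qed.

Lemma cone_E2 j i n1 n2 : qle (Zc P j i) (Bc P j i) n1 ->
  qle (Zc C j.+1 i) (Bc C j.+1 i) n2 -> qle (Zc P' j i) (Bc P' j i) (n2 + n1).
Proof.
move=> q1 [v vP].
pose h (c : 'cV[R]_(fsz n' (rsz P') j)) : 'cV[R]_(fsz n (rsz C) j.+1) :=
  @col_mx _ (fsz n (rsz P) j.+1) _ _ 0 c.
have hE c : h c = @col_mx _ (fsz n (rsz P) j.+1) _ _ 0 c by [].
have lh : klin h.
  move=> c x y; rewrite /h -[0 in LHS]addr0 -{1}(scaler0 _ (c%:A : R)).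
  by rewrite -add_col_mx -scale_col_mx.
apply: (qle_ext (h := h) (B2 := Bc C j.+1 i)) => //.
- exact: Zc_subsp.
- exact: Bc_subsp.
- exists v => z [gz z0]; apply: vP; apply/cone_Zc; split=> //; last by rewrite z0 mulmx0.
  exact: (proj1 (Zc_subsp P j.+1 i)).
apply: (qle_onto (h := fun c => al j *m c) (Z1 := Zc P j i) (B1 := Bc P j i)) => //.
- exact: klin_mul.
- exact: Bc_subsp.
- move=> z [_ [b gb]]; case: j v vP h hE lh q1 z b gb => [|j] v vP h hE lh q1 z b gb; rewrite hE.
    rewrite (_ : rD C 0 *m b = col_mx (rD P 0 *m b) (al 0 *m b)); last exact: mul_col_mx.
    move=> e; have [b0 ->] := @eq_col_mx _ (fsz n (rsz P) 1) _ _ 0 z _ _ e.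
    exists b; first by split.
    by rewrite subrr.
  rewrite -[b]vsubmxK in gb *; have /gmx_col[gx gy] := gb.
  rewrite (mul_block_col (rD P j.+1)) mul0mx addr0 mulNmx => e.
  have [x0 ->] := @eq_col_mx _ (fsz n (rsz P) j.+2) _ _ 0 z _ _ e.
  exists (@usubmx _ (fsz n (rsz P) j.+1) _ _ b); first by split.
  rewrite addrAC subrr add0r -mulmxN; eexists; last reflexivity.
  exact: gmxN.
- by move=> b /al_Bc.
Qed.
End ConeExact.

Section ShiftResolution.
Variables (n : nat) (P : resolution R n) (d : int).
Definition sdg j (l : 'I_(fsz n (rsz P) j)) : int := rdg l + d.
Lemma sgmx j : gmx (@sdg j.+1) (@sdg j) (rD P j).
Proof.
move=> i l; have := @rgmx _ _ _ P j i l; rewrite /sdg.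
by rewrite (_ : _ + d - _ = rdg i - rdg l) //; ring.
Qed.
Definition gshift : resolution R n := GRes sgmx (@rcx _ _ _ P) (@rex _ _ _ P).

Lemma gmx_shift j m i (X : 'M[R]_(_, m)) : gmx (@sdg j) (fun=> i) X <->
  gmx (rdg (g := P) (j := j)) (fun _ : 'I_m => i - d) X.
Proof.
split=> gX l l'; have := gX l l'; rewrite /sdg.
  by rewrite (_ : _ + d - i = rdg l - (i - d)) //; ring.
by rewrite (_ : rdg l - (i - d) = rdg l + d - i) //; ring.
Qed.

Lemma gshift_Zc j i c : Zc gshift j i c <-> Zc P j (i + d) c.
Proof. by rewrite /Zc opprD; split=> -[/gmx_shift gc c0]; split=> //; apply/gmx_shift. Qed.

Lemma gshift_Bc j i c : Bc gshift j i c <-> Bc P j (i + d) c.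
Proof.
case: j c => [//|j] c.
by rewrite /Bc opprD; split=> -[b /gmx_shift gb ->]; exists b => //; apply/gmx_shift.
Qed.

Lemma gshift_qle j i m : qle (Zc gshift j i) (Bc gshift j i) m <->
  qle (Zc P j (i + d)) (Bc P j (i + d)) m.
Proof.
split=> -[v vP]; exists v => z /gshift_Zc /vP[c cP]; exists c; exact/gshift_Bc.
Qed.
End ShiftResolution.

End GradedRing.

Local Open Scope quotient_scope.

(** * Finite injective dimension and localization *)

Record submodule (A : nzRingType) (V : lmodType A) := SubModule {
  subm_pred :> V -> Prop;
  subm_closed : subm_pred 0 /\
    forall a x y, subm_pred x -> subm_pred y -> subm_pred (a *: x + y) }.

Section SubModuleType.
Variables (A : nzRingType) (V : lmodType A) (U : submodule V).
Definition inU : {pred V} := fun x => `[< U x >].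
Lemma inU_closed : submod_closed inU.
Proof.
have [U0 US] := subm_closed U; split; first exact/asboolP.
by move=> a x y /asboolP Ux /asboolP Uy; apply/asboolP; exact: US.
Qed.
HB.instance Definition _ := GRing.isSubmodClosed.Build A V inU inU_closed.
Definition subt := {x : V | x \in inU}.
HB.instance Definition _ := SubChoice.on subt.
HB.instance Definition _ := [SubChoice_isSubLmodule of subt by <:].
Definition subv : subt -> V := \val.
Lemma subv_linear : linear subv. Proof. by move=> a x y; rewrite /subv linearP. Qed.
Lemma subv_inj : injective subv. Proof. exact: val_inj. Qed.
Lemma subt_mem (x : subt) : U (subv x). Proof. by have /asboolP := valP x. Qed.
Lemma subv_ex x : U x -> exists y : subt, subv y = x.
Proof. by move=> Ux; exists (exist _ x (asboolT Ux)). Qed.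
End SubModuleType.

Section LinearFacts.
Variable (A : nzRingType).
Lemma linear_pack (V W : lmodType A) (f : V -> W) : linear f ->
  exists g : {linear V -> W}, g =1 f.
Proof.
move=> lf; pose g : {linear V -> W} := HB.pack f (GRing.isLinear.Build A V W *:%R f lf).
by exists g.
Qed.

Section Lin.
Variables (V W : lmodType A) (f : V -> W).
Hypothesis lf : linear f.
Lemma lin0 : f 0 = 0.
Proof. by have [g gE] := linear_pack lf; rewrite -gE linear0. Qed.
Lemma linD x y : f (x + y) = f x + f y.
Proof. by have [g gE] := linear_pack lf; rewrite -!gE linearD. Qed.
Lemma linB x y : f (x - y) = f x - f y.
Proof. by have [g gE] := linear_pack lf; rewrite -!gE linearB. Qed.
Lemma linZ a x : f (a *: x) = a *: f x.
Proof. by have [g gE] := linear_pack lf; rewrite -!gE linearZ. Qed.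
Lemma lin_sum J (s : seq J) (P : pred J) F :
  f (\sum_(j <- s | P j) F j) = \sum_(j <- s | P j) f (F j).
Proof. exact: (big_morph f linD lin0). Qed.
End Lin.

(** A form of injectivity for a map [h] with a kernel: [f] vanishes on that kernel, so it factors
    through the image of [h] and is extended from there. *)
Lemma injective_ext (V W E : lmodType A) (h : V -> W) (f : V -> E) :
  (forall (U V : lmodType A) (i : {linear U -> V}) (f : {linear U -> E}),
    injective i -> exists g : {linear V -> E}, forall x, g (i x) = f x) ->
  linear h -> linear f -> (forall v, h v = 0 -> f v = 0) ->
  exists2 g : W -> E, linear g & forall v, g (h v) = f v.
Proof.
move=> injE lh lf hf.
have imP : (exists v, h v = 0) /\
    forall a x y, (exists v, h v = x) -> (exists v, h v = y) -> exists v, h v = a *: x + y.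
  split; first by exists 0; exact: lin0.
  by move=> a _ _ [x <-] [y <-]; exists (a *: x + y); rewrite lh.
pose U := SubModule imP; have UE w : U w <-> exists v, h v = w by [].
have /choice[c cP] : forall u : subt U, exists v, h v = subv u.
  by move=> u; exact: (subt_mem (U := U) u).
have hfE x y : h x = h y -> f x = f y.
  move=> hxy; apply/eqP; rewrite -subr_eq0 -(linB lf); apply/eqP/hf.
  by rewrite (linB lh) hxy subrr.
have [i iE] := linear_pack (@subv_linear _ _ U).
have [F FE] : exists F : {linear subt U -> E}, forall u, F u = f (c u).
  apply: (linear_pack (f := fun u => f (c u))) => a x y.
  by rewrite -lf; apply: hfE; rewrite lh !cP subv_linear.
have [|g gE] := injE _ _ i F; first by move=> x y; rewrite !iE; exact: subv_inj.
exists g; first by move=> a x y; rewrite linearP.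
move=> v; have [u uE] : exists u : subt U, subv u = h v.
  by apply: subv_ex; apply/UE; exists v.
by rewrite -uE -iE gE FE; apply: hfE; rewrite cP.
Qed.
End LinearFacts.

Section FiniteInjectiveDimension.
Variables (A : comNzRingType) (q : nat -> nat) (d : forall j, 'M[A]_(q j.+1, q j)).
Hypothesis dd : forall j, d j.+1 *m d j = 0.
Hypothesis ex : forall j (v : 'rV_(q j.+1)), v *m d j = 0 -> exists w, v = w *m d j.+1.
Variables (n : nat) (E : nat -> lmodType A) (dE : forall i, {linear E i -> E i.+1}).
Hypothesis injE : forall i, injective_module (E i).
Hypothesis exE : forall i y, dE i.+1 y = 0 <-> exists x, dE i x = y.
Hypothesis zE : forall i, (n < i)%N -> forall y : E i, y = 0.

Lemma mul_linear m p (M : 'M[A]_(m, p)) : linear (fun v : 'rV[A]_m => v *m M).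
Proof. by move=> a x y; rewrite mulmxDl scalemxAl. Qed.

(** Dimension shifting along the injective resolution, with values in the kernel of [dE i]. Extend
    [f] to [g] with values in [E i]; the error [dE i (g v)] is a cocycle one step further on, hence
    of the form [h (v *m d j)] by induction. As the row module is free, [h] lifts through [dE i],
    and the lift corrects [g]. The induction ends at [i = n], where the next term is zero. *)
Lemma cocycle_ext t i : (i + t)%N = n -> forall j, (t <= j)%N ->
  forall f : 'rV[A]_(q j.+1) -> E i, linear f ->
  (forall v, dE i (f v) = 0) -> (forall w, f (w *m d j.+1) = 0) ->
  exists g : 'rV[A]_(q j) -> E i,
    [/\ linear g, forall v, dE i (g v) = 0 & forall v, g (v *m d j) = f v].
Proof.
elim: t i => [|t IH] i itn j tj f lf df fd.
  have [|g lg gE] := injective_ext (@injE i) (mul_linear (d j)) lf.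
    by move=> v /ex[w ->]; exact: fd.
  exists g; split=> // v; apply: zE; lia.
case: j tj f lf df fd => // j tj f lf df fd.
have [|g lg gE] := injective_ext (@injE i) (mul_linear (d j.+1)) lf.
  by move=> v /ex[w ->]; exact: fd.
have lcomp : linear (fun v => dE i (g v)) by move=> a x y; rewrite lg linearP.
have [||||h [lh dh hE]] := IH i.+1 _ j _ _ lcomp.
- by lia.
- by [].
- by move=> v; apply/exE; exists (g v).
- by move=> w; rewrite gE df.
have /choice[e eE] : forall l, exists x, dE i x = h (delta_mx 0 l).
  by move=> l; apply/exE.
pose h' (v : 'rV[A]_(q j)) := \sum_l v 0 l *: e l.
have lh' : linear h'.
  move=> a x y; rewrite /h' scaler_sumr -big_split; apply: eq_bigr => l _ /=.
  by rewrite !mxE scalerDl scalerA.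
have dh' v : dE i (h' v) = h v.
  rewrite /h' linear_sum {2}[v]row_sum_delta (lin_sum lh); apply: eq_bigr => l _.
  by rewrite linearZ /= eE (linZ lh).
exists (fun v => g v - h' (v *m d j)); split.
- move=> a x y; rewrite lg mul_linear lh' scalerBr.
  by rewrite opprD addrACA.
- by move=> v; rewrite linearB /= dh' hE subrr.
- by move=> v; rewrite gE -mulmxA dd mulmx0 (lin0 lh') subr0.
Qed.
End FiniteInjectiveDimension.

(** Through [e] the ring is the kernel of [dE 0], so a column cocycle is a cocycle in the sense of
    [cocycle_ext] with [i = 0] and [t = n]. *)
Lemma injdim_vanish (A : comNzRingType) : finite_injdim A^o -> exists r, forall q
    (d : forall j, 'M[A]_(q j.+1, q j)),
  (forall j, d j.+1 *m d j = 0) ->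
  (forall j (v : 'rV_(q j.+1)), v *m d j = 0 -> exists w, v = w *m d j.+1) ->
  forall j, (r <= j)%N -> forall c : 'cV[A]_(q j.+1), d j.+1 *m c = 0 ->
  exists b, c = d j *m b.
Proof.
move=> [n [E [e [dE [injE ie eE exE zE]]]]]; exists n => q d dd ex j nj c dc.
pose f (v : 'rV[A]_(q j.+1)) := e ((v *m c) 0 0).
have lf : linear f.
  by move=> a x y; rewrite /f mulmxDl -scalemxAl !mxE linearP.
have [||g [lg dg gE]] := cocycle_ext dd ex injE exE zE (add0n n) nj lf.
- by move=> v; apply/eE; eexists.
- by move=> w; rewrite /f -mulmxA dc mulmx0 mxE linear0.
have /choice[b bE] : forall l, exists x, e x = g (delta_mx 0 l).
  by move=> l; apply/eE.
exists (\col_l b l); apply/matrixP => i i'; rewrite (ord1 i').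
apply: ie; have -> : c i 0 = (delta_mx (0 : 'I_1) i *m c) 0 0 by rewrite -rowE mxE.
rewrite -[LHS]gE -rowE mxE [row i (d j)]row_sum_delta (lin_sum lg) linear_sum.
by apply: eq_bigr => l _; rewrite (linZ lg) -bE !mxE -linearZ.
Qed.

(** * Descent from the localization at the irrelevant ideal *)

Lemma localization_map (A : comNzRingType) (S : mulset A) :
  exists iota : {rmorphism A -> localization S},
  [/\ forall x, iota x = 0 -> exists2 u, u \in S & u * x = 0,
      forall a, exists x s, s \in S /\ iota s * a = iota x
    & forall s, s \in S -> exists b, b * iota s = 1].
Proof.
pose io (x : A) : localization S := \pi_(Localization.type S) (x, Localization.den1 S).
have ioB : zmod_morphism io.
  move=> x y; rewrite /io.
  have -> : \pi_(Localization.type S) (x, Localization.den1 S) -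
     \pi_(Localization.type S) (y, Localization.den1 S) =
     \pi_(Localization.type S) (Localization.addf (x, Localization.den1 S)
        (Localization.oppf (y, Localization.den1 S))).
    by rewrite Localization.pi_add Localization.pi_opp.
  by apply: Localization.eq_pi; rewrite /= !mulr1.
have ioM : monoid_morphism io.
  split=> // x y; rewrite /io.
  have -> : \pi_(Localization.type S) (x, Localization.den1 S) *
     \pi_(Localization.type S) (y, Localization.den1 S) =
     \pi_(Localization.type S) (Localization.mulf (x, Localization.den1 S)
        (y, Localization.den1 S)).
    by rewrite Localization.pi_mul.
  by apply: Localization.eq_pi; rewrite /= !mulr1.
pose iota : {rmorphism A -> localization S} := HB.pack io
  (GRing.isZmodMorphism.Build A (localization S) io ioB)
  (GRing.isMonoidMorphism.Build A (localization S) io ioM).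
have mulE (x y : Localization.frac S) : (\pi_(Localization.type S) x : localization S) *
   \pi_(Localization.type S) y = \pi_(Localization.type S) (Localization.mulf x y).
  by rewrite Localization.pi_mul.
exists iota; split.
- move=> x; change (io x = \pi_(Localization.type S) (0, Localization.den1 S) -> exists2 u, u \in S & u * x = 0).
  by move=> /eqP/Localization.pi_eqP[u uS] /=; rewrite !mulr1 mulr0; exists u.
- elim/quotW => -[x [s sS]]; exists x, s; split=> //.
  rewrite [LHS]mulE; apply: Localization.eq_pi => /=; ring.
- move=> s sS; exists (\pi_(Localization.type S) (1, exist _ s sS)).
  rewrite [LHS]mulE; apply: Localization.eq_pi => /=; ring.
Qed.

Section LocalizationVanishing.
Variables (k : fieldType) (R : gring k).
Hypothesis R0 : forall x : R, rdeg 0%N x <-> exists c : k, x = c%:A.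

Lemma rcomp0M (x y : R) : rcomp (x * y) 0 = rcomp x 0 * rcomp y 0.
Proof.
have xm : x - rcomp x 0 \in irrelevant R.
  by apply/irrelevantP; rewrite /rcomp gcompB (gcomp_id _ (gcomp_deg _ x 0)) subrr.
have : (x - rcomp x 0) * y \in irrelevant R by rewrite mulrC irrelevantM.
move=> /irrelevantP; rewrite mulrBl /rcomp gcompB => /eqP; rewrite subr_eq0 => /eqP ->.
by have := rcompMl y 0 (rcomp_deg x 0); rewrite addr0.
Qed.

Lemma irrelevant_prime : exists p : prime_idealr R, forall x, x \in p <-> rcomp x 0 = 0.
Proof.
pose J : {pred R} := fun x => `[< rcomp x 0 = 0 >].
have J1 : rcomp (1 : R) 0 = 1.
  by apply: gcomp_id; exact: rdeg1.
have cJ : idealr_closed J.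
  split; first by apply/asboolP; exact: gcomp0.
    by apply/negP => /asboolP; rewrite J1 => /eqP; rewrite oner_eq0.
  move=> a x y /asboolP x0 /asboolP y0; apply/asboolP.
  by rewrite [LHS](gcompD (Rz_grading R)) [X in X + _]rcomp0M x0 [X in _ + X]y0 mulr0 addr0.
have pJ : prime_idealr_closed J.
  move=> x y /asboolP; rewrite rcomp0M => xy0.
  have /R0[c cE] := rcomp_deg x 0; have /R0[d dE] := rcomp_deg y 0.
  move: xy0; rewrite cE dE -scalerAl mul1r scalerA => /eqP.
  rewrite scaler_eq0 oner_eq0 orbF mulf_eq0 => /orP[/eqP c0|/eqP d0]; apply/orP; [left|right];
    by apply/asboolP; rewrite ?cE ?dE ?c0 ?d0 scale0r.
pose Ji : prime_idealr R := HB.pack_for (prime_idealr R) J (isIdealr.Build R J cJ)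
  (isPrimeIdealrClosed.Build R J pJ).
by exists Ji => x; split=> [/asboolP|x0] //; exact/asboolP.
Qed.

Lemma common_denominator (A : comNzRingType) (S : mulset A) (L : comNzRingType)
    (iota : {rmorphism A -> L}) m n (X : 'M[L]_(m, n)) :
  (forall a, exists x s, s \in S /\ iota s * a = iota x) ->
  exists Y s, s \in S /\ iota s *: X = map_mx iota Y.
Proof.
move=> fr; have /choice[y yP] : forall ij : 'I_m * 'I_n, exists y : A * A, y.2 \in S /\
    iota y.2 * X ij.1 ij.2 = iota y.1.
  by move=> [i j] /=; have [x [s [sS e]]] := fr (X i j); exists (x, s).
pose s := \prod_ij (y ij).2.
have prodS (r : seq ('I_m * 'I_n)) (Q : pred ('I_m * 'I_n)) : \prod_(ij <- r | Q ij) (y ij).2 \in S.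
  elim/big_ind: _ => [|x1 x2|ij _]; [exact: mulset1|exact: mulsetM|by case: (yP ij)].
exists (\matrix_(i, j) ((\prod_(ij | ij != (i, j)) (y ij).2) * (y (i, j)).1)), s; split.
  exact: prodS.
apply/matrixP => i j; rewrite !mxE /s (bigD1 (i, j)) //= !rmorphM mulrAC.
by case: (yP (i, j)) => _ /= ->; rewrite mulrC.
Qed.

Lemma kernel_denominator (A : comNzRingType) (S : mulset A) (L : comNzRingType)
    (iota : {rmorphism A -> L}) m n (X : 'M[A]_(m, n)) :
  (forall x, iota x = 0 -> exists2 u, u \in S & u * x = 0) ->
  map_mx iota X = 0 -> exists2 u, u \in S & u *: X = 0.
Proof.
move=> ke X0; have /choice[y yP] : forall ij : 'I_m * 'I_n, exists u, u \in S /\ u * X ij.1 ij.2 = 0.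
  move=> [i j] /=; have [|u uS u0] := ke (X i j); last by exists u.
  by have /matrixP/(_ i j) := X0; rewrite !mxE.
exists (\prod_ij y ij).
  elim/big_ind: _ => [|x1 x2|ij _]; [exact: mulset1|exact: mulsetM|by case: (yP ij)].
apply/matrixP => i j; rewrite !mxE (bigD1 (i, j)) //= mulrAC.
by case: (yP (i, j)) => _ /= ->; rewrite mul0r.
Qed.

(** A localized resolution stays exact, so [c] becomes a coboundary there, and clearing denominators
    gives [t *: c = rD P j.+1 *m (u *: b')] with [t] outside the irrelevant ideal. The component of
    this equation in the degrees of [c] has on its left the constant term of [t] times [c], and that
    constant is a unit. *)
Lemma gorenstein_vanish : gorenstein R -> exists r, forall n (P : resolution R n) j, (r < j)%N -> vanishing P j.
Proof.
move=> [_ gor]; have [p pP] := irrelevant_prime.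
have [iota [ke fr inv]] := localization_map (prime_compl p).
have [r rP] := injdim_vanish (gor p).
exists r.+1 => n P [//|[//|j]] rj i c [gc c0].
pose q j := fsz n (rsz P) j.
pose d j : 'M_(q j.+1, q j) := map_mx iota (rD P j).
have [||||b bE] := rP q d _ _ j.+1 _ (map_mx iota c).
- by move=> l; rewrite /d -map_mxM rcx map_mx0.
- move=> l v v0; have [v' [s [sS sE]]] := common_denominator v fr.
  have [|u uS u0] := kernel_denominator (X := v' *m rD P l) ke.
    by rewrite map_mxM -sE -scalemxAl v0 scaler0.
  have [|w wE] := @rex _ _ _ P l (u *: v'); first by rewrite -scalemxAl.
  have [b bE] := inv _ (mulsetM uS sS); exists (b *: map_mx iota w).
  rewrite -scalemxAl /d -map_mxM -wE map_mxZ -sE !scalerA.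
  by rewrite -mulrA -rmorphM bE scale1r.
- by lia.
- by rewrite /d -map_mxM c0 map_mx0.
have [b' [s [sS sE]]] := common_denominator b fr.
have [|u uS u0] := kernel_denominator (X := s *: c - rD P j.+1 *m b') ke.
  by rewrite map_mxB map_mxZ map_mxM -sE -scalemxAr -bE subrr.
have tS := mulsetM uS sS; set t := u * s in tS.
have tc : t *: c = rD P j.+1 *m (u *: b').
  by apply/eqP; rewrite -subr_eq0 -scalemxAr /t -scalerA -scalerBr u0.
have t0 : rcomp t 0 != 0.
  by apply/eqP => /pP tp; move: tS; rewrite inE tp.
have [y yt] := rdeg0_unit R0 (rcomp_deg t 0) t0.
have E : rcomp t 0 *: c = rD P j.+1 *m pr (rdg (g := P) (j := j.+1)) (fun=> - i) (u *: b').
  rewrite -(prMl _ _ (@rgmx _ _ _ P j.+1)) -tc; apply/matrixP => l l'; rewrite !mxE.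
  have := rcompMl t 0 (gc l l').
  by rewrite addr0 [c l l' * t]mulrC [RHS]mulrC => ->.
apply: (@Bc_intro _ _ _ _ _ _ _ (y *: pr (rdg (g := P) (j := j.+1)) (fun=> - i) (u *: b'))) => //.
by rewrite -scalemxAr -E scalerA yt scale1r.
Qed.

End LocalizationVanishing.

(** * Growth of the cohomology *)

Definition cumul (h : int -> nat) (N n : nat) : nat := (\sum_(l < n) h (l%:Z - N%:Z)%R)%N.

(** Bounding partial sums rather than values gives exponent 0 a meaning, finite total dimension, and
    makes each summation raise the exponent by one. *)
Definition poly_bounded (h : int -> nat) (N s : nat) :=
  (forall i : int, i < - N%:Z -> h i = 0%N) /\
  exists c, forall n, (cumul h N n <= c * n.+1 ^ s)%N.

Lemma bnd_shift h N N' s : (N <= N')%N -> poly_bounded h N s -> poly_bounded h N' s.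
Proof.
move=> /subnKC <-; elim: (N' - N)%N => [|t IH]; rewrite ?addn0 // addnS => /IH.
move: (N + t)%N => {IH} M [h0 [c hc]]; split; first by move=> i iM; apply: h0; lia.
exists c => -[|n]; first by rewrite /cumul big_ord0.
rewrite /cumul big_ord_recl h0; last by rewrite /=; lia.
rewrite add0n (_ : (\sum_(l < n) _)%N = cumul h M n); last first.
  by apply: eq_bigr => l _; rewrite lift0; congr h; lia.
apply: leq_trans (hc n) _; rewrite leq_mul2l; apply/orP; right.
by case: s {hc} => // s; rewrite leq_exp2r.
Qed.

Lemma bnd_add h h' N s : poly_bounded h N s -> poly_bounded h' N s -> poly_bounded (fun i => (h i + h' i)%N) N s.
Proof.
move=> [h0 [c hc]] [h0' [c' hc']]; split; first by move=> i iN; rewrite h0 ?h0'.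
exists (c + c')%N => n; rewrite /cumul big_split mulnDl /=.
by apply: leq_add; [exact: hc|exact: hc'].
Qed.

Lemma bnd_exp h N s s' : (s <= s')%N -> poly_bounded h N s -> poly_bounded h N s'.
Proof.
move=> ss [h0 [c hc]]; split=> //; exists c => n.
by apply: leq_trans (hc n) _; rewrite leq_mul2l leq_pexp2l ?orbT.
Qed.

Lemma cumul_mono h N n m : (n <= m)%N -> (cumul h N n <= cumul h N m)%N.
Proof.
move=> /subnKC <-; rewrite /cumul big_split_ord /=; exact: leq_addr.
Qed.

(** The sum of [h] over the degrees from [-N] to [i - 1], regarded as a bound in degree [i]. *)
Definition cumulz (h : int -> nat) (N : nat) (i : int) : nat :=
  if i < - N%:Z then 0%N else cumul h N (absz (i + N%:Z)).

Lemma bnd_cumul h N s : poly_bounded h N s -> poly_bounded (cumulz h N) N s.+1.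
Proof.
move=> [h0 [c hc]]; split; first by move=> i iN; rewrite /cumulz iN.
exists c => n; apply: (@leq_trans (\sum_(l < n) c * n.+1 ^ s)%N); last first.
  rewrite sum_nat_const card_ord mulnCA leq_mul2l expnS leq_mul2r leqnSn !orbT.
  by [].
apply: leq_sum => l _; rewrite /cumulz; case: ifP => // _.
apply: leq_trans (cumul_mono _ _ _) (hc n) => //.
by rewrite subrK absz_nat ltnW.
Qed.

Section Vanishing.
Variables (k : fieldType) (R : gring k).
Hypothesis R0 : forall x : R, rdeg 0%N x <-> exists c : k, x = c%:A.
Hypothesis noeR : noetherian R.

(* Cohomology in degree [j] has Hilbert function with partial sums O(n^s). *)
Definition growth n (P : resolution R n) j s := exists h N,
  (forall i, qle (Zc P j i) (Bc P j i) (h i)) /\ poly_bounded h N s.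

(* What remains of the long exact sequence of the cone [C] of [P' -> P]. *)
Definition long_exact n n' (P : resolution R n) (P' : resolution R n') (C : resolution R n) := forall j i n1 n2,
  (qle (Zc C j i) (Bc C j i) n1 ->
   qle (Zc P' j i) (Bc P' j i) n2 -> qle (Zc P j i) (Bc P j i) (n2 + n1)) /\
  (qle (Zc P j i) (Bc P j i) n1 ->
   qle (Zc C j.+1 i) (Bc C j.+1 i) n2 -> qle (Zc P' j i) (Bc P' j i) (n2 + n1)).

Notation "U_[ P ]" := (rowspan (rD P 0)) (at level 0, format "U_[ P ]").

Lemma cone_ex n n' (P : resolution R n) (P' : resolution R n') (X : 'M[R]_(n', n)) :
  gmx (rdg (g := P') (j := 0)) (rdg (g := P) (j := 0)) X ->
  (forall w, U_[P'] w <-> U_[P] (w *m X)) ->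
  exists C : resolution R n,
    (forall v, U_[C] v <-> exists w, U_[P] (v + w *m X)) /\ long_exact P P' C.
Proof.
move=> gX UX; have [al [al0 gal cal]] := chain_ex gX (fun v => proj1 (UX v)).
have inj w : U_[P] (w *m al 0%N) -> U_[P'] w by rewrite al0 => /UX.
exists (cone gal cal inj); split.
  by move=> v; rewrite cone_span; split=> -[w wP]; exists w; rewrite ?al0 // -al0.
move=> j i n1 n2; split; first exact: cone_E1.
exact: cone_E2.
Qed.

(** For a scalar matrix [X] this resolves the quotient by U:a, for a single row the cyclic module
    generated by that row modulo [U]. *)
Lemma colon_ex n n' (P : resolution R n) (a : 'I_n' -> int) (X : 'M[R]_(n', n)) :
  gmx a (rdg (g := P) (j := 0)) X ->
  exists P' : resolution R n', rdg (g := P') (j := 0) = a /\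
  forall w, U_[P'] w <-> U_[P] (w *m X).
Proof.
move=> gX; have [sU gU] := (rowspan_submod (rD P 0), rowspan_graded (@rgmx _ _ _ P 0)).
have [||P' [aE UE]] := @gres_ex _ _ noeR n' a (fun w => U_[P] (w *m X)).
- split; first by rewrite mul0mx; case: sU.
  by move=> c x y Ux Uy; rewrite mulmxDl -scalemxAl; exact: (proj2 sU).
- by move=> u w Uw; rewrite -(prMr _ _ gX); exact: gU.
by exists P'; split=> // w; split=> /UE.
Qed.

Lemma van_qle n (P : resolution R n) j i : vanishing P j -> qle (Zc P j i) (Bc P j i) 0.
Proof. by move=> vP; apply/qle0P; exact: vP. Qed.

Lemma les_van n n' (P : resolution R n) (P' : resolution R n') C j : long_exact P P' C ->
  vanishing C j -> vanishing P' j -> vanishing P j.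
Proof.
move=> L vC vP' i; apply/qle0P; rewrite -[0%N]/(0 + 0)%N.
by apply: (proj1 (L _ _ _ _)); exact: van_qle.
Qed.

Lemma les_van2 n n' (P : resolution R n) (P' : resolution R n') C j : long_exact P P' C ->
  vanishing P j -> vanishing C j.+1 -> vanishing P' j.
Proof.
move=> L vC vP' i; apply/qle0P; rewrite -[0%N]/(0 + 0)%N.
by apply: (proj2 (L _ _ _ _)); exact: van_qle.
Qed.

Lemma kill_all n (P : resolution R n) : (forall v, U_[P] v) -> forall j, vanishing P j.
Proof.
move=> UP j i c Zc0; have := @hom_kill _ _ _ P 1 0 (rdeg1 R) (fun v => UP _) j i c Zc0.
by rewrite addr0 scale1r.
Qed.

(* The resolved module is killed by the irrelevant ideal. *)
Definition semisimple n (P : resolution R n) :=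
  forall d (a : R), 0 < d -> Rz d a -> forall v, U_[P] (a *: v).

(** Such a [P] resolves zero or a shift of k, so this says that *Ext^j(k,R) = 0 for all j at least
    [e]. *)
Definition vanishes_from e := forall P : resolution R 1, semisimple P ->
  forall j, (e <= j)%N -> vanishing P j.

Lemma not_full n (P : resolution R n) : (exists v, ~ U_[P] v) ->
  exists u v, gmx (fun=> u) (rdg (g := P) (j := 0)) v /\ ~ U_[P] v.
Proof.
move=> [v nv]; apply: contrapT => no; apply: nv.
have [s ->] := row_decomp (rdg (g := P) (j := 0)) v.
apply: submod_sum; first exact: rowspan_submod.
move=> u _; apply: contrapT => nu; apply: no.
by exists u, (pr (fun=> u) (rdg (g := P) (j := 0)) v); split=> //; exact: pr_gmx.
Qed.

(** A homogeneous [v] outside [U] generates a cyclic submodule killed by the irrelevant ideal, to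
    which the hypothesis applies; the quotient by it belongs to a larger [U]. *)
Lemma semisimple_van e : vanishes_from e -> forall n (P : resolution R n), semisimple P ->
  forall j, (e <= j)%N -> vanishing P j.
Proof.
move=> ve n; suff H : forall U : set 'rV[R]_n, submod U ->
    forall P : resolution R n, (forall v, U_[P] v <-> U v) -> semisimple P ->
    forall j, (e <= j)%N -> vanishing P j.
  by move=> P; apply: (H _ (rowspan_submod (rD P 0))).
apply: (noeth_ind noeR) => U sU IH P UP sP j ej.
have [full|/existsNP nfull] := pselect (forall v, U_[P] v); first exact: kill_all.
have [u [v [gv nv]]] := not_full nfull.
have sP0 := rowspan_submod (rD P 0).
have [P' [aE UE]] := @colon_ex n 1 P (fun=> u) v gv.
have [|C [UC L]] := cone_ex (X := v) _ UE; first by rewrite aE.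
have PC x : U_[P] x -> U_[C] x by move=> Px; apply/UC; exists 0; rewrite mul0mx addr0.
apply: (les_van L).
- apply: (IH U_[C]) => //.
  + exact: rowspan_submod.
  + by move=> x /UP /PC.
  + exists v; last by move/UP.
    apply/UC; exists (const_mx (-1)); rewrite (_ : const_mx (-1) = (-1)%:M).
      by rewrite mul_scalar_mx scaleN1r subrr; case: sP0.
    by apply/matrixP => x y; rewrite !mxE !ord1.
  + by move=> d a d0 da x; apply: PC; exact: (sP d).
- by apply: ve => // d a d0 da w; apply/UE; rewrite -scalemxAl; exact: (sP d).
Qed.

(** The cocycles form the kernel of the transposed differential and have finitely many homogeneous
    generators. Above the largest degree of a generator all coefficients have positive degree and
    kill cohomology by [hom_kill]. So cohomology lives in finitely many degrees. *)
Lemma semisimple_gr n (P : resolution R n) j : semisimple P -> growth P j 0.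
Proof.
move=> sP; have [h hP] := choice (fun i => @Zc_fin _ _ R0 noeR _ P j i).
have [N0 lowP] := @Zc_low _ _ _ P j.
have gT : gmx (fun l => - rdg (g := P) (j := j) l) (fun l => - rdg (g := P) (j := j.+1) l) (rD P j)^T.
  by have /gmx_tr := @rgmx _ _ _ P j.
have [m [b [G [gG GP]]]] := graded_fg noeR (ker_submod (rD P j)^T) (ker_graded gT).
pose M := (\max_l `|b l|)%N.
have high i c : M%:Z < i -> Zc P j i c -> Bc P j i c.
  move=> Mi [gc c0].
  have gcT : gmx (fun=> i) (fun l => - rdg (g := P) (j := j) l) c^T.
    by move=> l l'; have := gc l' l; rewrite !mxE !opprK addrC.
  have [w0 wE0] : rowspan G c^T by apply/GP; rewrite -trmx_mul c0 trmx0.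
  have [w gw wE] := gmx_solve_r gcT gG wE0.
  rewrite -[c]trmxK wE mulmx_sum_row raddf_sum; apply: (subsp_sum (Bc_subsp R0 P j i)) => l _.
  rewrite (_ : _ (w 0 l *: row l G) = w 0 l *: (row l G)^T); last first.
    by apply/matrixP => x y; rewrite !mxE.
  rewrite (_ : i = b l + (i - b l)); last by ring.
  apply: (hom_kill (gw 0 l)).
    move=> v; apply: (sP (i - b l)); last exact: gw.
    have := leq_bigmax (F := fun l => `|b l|%N) l; rewrite -/M; lia.
  split; first by move=> x y; have := gG l x; rewrite !mxE !opprK addrC.
  have : row l G *m (rD P j)^T = 0 by apply/GP; exists (delta_mx 0 l); rewrite rowE.
  by move=> /(congr1 trmx); rewrite trmx_mul trmxK trmx0.
pose h' i := if (i < - N0%:Z) || (M%:Z < i) then 0%N else h i.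
exists h', N0; split.
  move=> i; rewrite /h'; case: ifP => [/orP[iN|iM]|_] //; apply/qle0P => c Zcc.
    by rewrite (lowP _ iN _ Zcc); case: (Bc_subsp R0 P j i).
  exact: high.
split; first by move=> i iN; rewrite /h' iN.
exists (cumul h' N0 (N0 + M).+1) => r; rewrite expn0 muln1.
have [le|lt] := leqP r (N0 + M).+1; first exact: cumul_mono.
rewrite -(subnKC (ltnW lt)) {1}/cumul big_split_ord /= -/(cumul _ _ _).
rewrite [X in (_ + X)%N]big1 ?addn0 // => l _; rewrite /h' ifT //.
by apply/orP; right; lia.
Qed.

Lemma gr_exp n (P : resolution R n) j s s' : (s <= s')%N -> growth P j s -> growth P j s'.
Proof. by move=> ss [h [N [hP hb]]]; exists h, N; split=> //; exact: bnd_exp hb. Qed.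

Lemma van_gr n (P : resolution R n) j s : vanishing P j -> growth P j s.
Proof.
move=> vP; exists (fun=> 0%N), 0%N; split; first by move=> i; exact: van_qle.
by split=> //; exists 0%N => n0; rewrite /cumul big1.
Qed.

Lemma les_gr n n' (P : resolution R n) (P' : resolution R n') C j s : long_exact P P' C ->
  growth C j s -> growth P' j s -> growth P j s.
Proof.
move=> L [h1 [N1 [q1 b1]]] [h2 [N2 [q2 b2]]].
exists (fun i => (h2 i + h1 i)%N), (maxn N1 N2); split.
  by move=> i; apply: (proj1 (L _ _ _ _)).
by apply: bnd_add; [apply: bnd_shift b2; exact: leq_maxr|apply: bnd_shift b1; exact: leq_maxl].
Qed.

(** The exact piece H^j(P)_i -> H^j(P)_(i+d) -> H^(j+1)(C)_i bounds the middle term by the outer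
    ones. Descending in steps of [d] until cohomology vanishes leaves a sum of values of [h] in
    lower degrees. *)
Lemma les_shift_gr n (P : resolution R n) (d : nat) C j s : (0 < d)%N -> long_exact P (gshift P d) C ->
  growth C j.+1 s -> growth P j s.+1.
Proof.
move=> d0 L [h [N1 [q1 b1]]]; have [N2 lowP] := @Zc_low _ _ _ P j.
pose N := maxn N1 N2; have b := bnd_shift (leq_maxl N1 N2 : (_ <= N)%N) b1.
exists (cumulz h N), N; split; last exact: bnd_cumul.
have low i : i < - N%:Z -> qle (Zc P j i) (Bc P j i) 0.
  move=> iN; apply/qle0P => c /lowP ->; first by case: (Bc_subsp R0 P j i).
  by have := leq_maxr N1 N2; rewrite -/N; lia.
have pos : forall m : nat, qle (Zc P j (m%:Z - N%:Z)) (Bc P j (m%:Z - N%:Z)) (cumul h N m).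
  elim/ltn_ind => m IH.
  have E : m%:Z - N%:Z = (m%:Z - N%:Z - d%:Z) + d%:Z by ring.
  rewrite {1 2}E; apply/gshift_qle.
  have [dm|md] := leqP d m; last first.
    have lt : m%:Z - N%:Z - d%:Z < - N%:Z by lia.
    apply: (@qle_mono _ _ _ _ _ (0 + 0)) => //.
    apply: (proj2 (L _ _ _ _)); first exact: low.
    by have := q1 (m%:Z - N%:Z - d%:Z); rewrite (proj1 b).
  have E' : m%:Z - N%:Z - d%:Z = (m - d)%N%:Z - N%:Z by lia.
  (* The new value of [h] is the term of index [m - d], so the total is [cumul h N (m - d).+1], and
     [0 < d] keeps it below [cumul h N m]. *)
  rewrite E'; apply: (@qle_mono _ _ _ _ _ (h ((m - d)%N%:Z - N%:Z)%R + cumul h N (m - d))%N).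
    rewrite addnC -[X in (X <= _)%N](_ : cumul h N (m - d).+1 = _); last first.
      by rewrite /cumul big_ord_recr.
    by apply: cumul_mono; lia.
  by apply: (proj2 (L _ _ _ _)); [apply: IH; lia|exact: q1].
move=> i; rewrite /cumulz; case: ifP => [/low//|/negbT iN].
have {1 2}-> : i = (absz (i + N%:Z))%:Z - N%:Z by lia.
exact: pos.
Qed.

(** A graded Nakayama argument: multiplication by an element of positive degree is onto in
    cohomology, which is zero in low degrees. *)
Lemma les_shift_van n (P : resolution R n) (d : nat) C j : (0 < d)%N -> long_exact P (gshift P d) C ->
  vanishing C j.+1 -> vanishing P j.
Proof.
move=> d0 L vC; have [N lowP] := @Zc_low _ _ _ P j.
have low i : i < - N%:Z -> qle (Zc P j i) (Bc P j i) 0.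
  by move=> iN; apply/qle0P => c /lowP ->; first by case: (Bc_subsp R0 P j i).
have pos : forall m : nat, qle (Zc P j (m%:Z - N%:Z)) (Bc P j (m%:Z - N%:Z)) 0.
  elim/ltn_ind => m IH.
  have E : m%:Z - N%:Z = (m%:Z - N%:Z - d%:Z) + d%:Z by ring.
  rewrite {1 2}E; apply/gshift_qle; rewrite -[0%N]/(0 + 0)%N.
  apply: (proj2 (L _ _ _ _)); last exact: van_qle.
  have [dm|md] := leqP d m; last by apply: low; lia.
  have -> : m%:Z - N%:Z - d%:Z = (m - d)%N%:Z - N%:Z by lia.
  by apply: IH; lia.
move=> i; apply/qle0P; have [/low//|iN] := ltP i (- N%:Z).
have -> : i = (absz (i + N%:Z))%:Z - N%:Z by lia.
exact: pos.
Qed.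

(** Here [e] is one more than in the overview, the first index from which everything vanishes; hence
    the exponent [s] with [(j + s).+1 = e]. *)
Lemma main_bound e : vanishes_from e -> forall n (P : resolution R n),
  (forall j, (e <= j)%N -> vanishing P j) /\ (forall j s, (j + s).+1 = e -> growth P j s).
Proof.
move=> ve n; suff H : forall U : set 'rV[R]_n, submod U ->
    forall P : resolution R n, (forall v, U_[P] v <-> U v) ->
    (forall j, (e <= j)%N -> vanishing P j) /\ (forall j s, (j + s).+1 = e -> growth P j s).
  by move=> P; apply: (H _ (rowspan_submod (rD P 0))).
apply: (noeth_ind noeR) => U sU IH P UP.
have sP0 := rowspan_submod (rD P 0).
have [sP|nsP] := pselect (semisimple P).
  split; first exact: semisimple_van.
  by move=> j s _; apply: (@gr_exp _ _ _ 0) => //; exact: semisimple_gr.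
have [d [a [v [d0 [da nv]]]]] : exists (d : nat) (a : R) (v : 'rV[R]_n), (0 < d)%N /\ Rz d a /\ ~ U_[P] (a *: v).
  apply: contrapT => no; apply: nsP => -[d|d] // a d0 da v; apply: contrapT => nv.
  by apply: no; exists d, a, v.
have gX : gmx (fun l => rdg (g := P) (j := 0) l + d%:Z) (rdg (g := P) (j := 0)) (a%:M : 'M[R]_n).
  move=> l l'; rewrite mxE; case: eqP => [->|_]; last exact: Rz0.
  by rewrite mulr1n (_ : _ - _ = d%:Z) //; ring.
have big (C : resolution R n) : (forall v, U_[C] v <-> exists w, U_[P] (v + w *m a%:M)) ->
    (forall j, (e <= j)%N -> vanishing C j) /\ (forall j s, (j + s).+1 = e -> growth C j s).
  move=> UC; apply: (IH U_[C]) => //.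
  - exact: rowspan_submod.
  - by move=> x /UP Px; apply/UC; exists 0; rewrite mul0mx addr0.
  - exists (a *: v); last by move/UP.
    by apply/UC; exists (- v); rewrite mulNmx mul_mx_scalar subrr; case: sP0.
(* If [a] is regular modulo [U], then U:a equals [U] and the submodule term is a shift of [P]
   itself, so the bound comes from the shift lemmas. Otherwise U:a is strictly larger and the
   induction hypothesis applies to it too. *)
have [reg|/existsNP[w0 /not_implyP[aw nw]]] := pselect (forall w, U_[P] (a *: w) -> U_[P] w).
  have [||C [/big[vC gC] L]] := @cone_ex n n P (gshift P d) a%:M.
  - exact: gX.
  - move=> w; rewrite mul_mx_scalar; split; last exact: reg.
    by move=> Uw; apply: submodZ.
  (* For [s = 0] the index [j.+1] is [e], where the cohomology of [C] already vanishes. *)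
  split=> [j ej|j [|s]].
  - by apply: (les_shift_van d0 L); apply: vC; lia.
  - by move=> je; apply: van_gr; apply: (les_shift_van d0 L); apply: vC; lia.
  - by move=> je; apply: (les_shift_gr d0 L); apply: gC; lia.
have [P' [aE UE]] := colon_ex gX.
have [|C [/big[vC gC] L]] := cone_ex (X := a%:M) _ UE; first by rewrite aE.
have [||vP' gP'] := IH U_[P'] (rowspan_submod _) _ _ P' (fun=> iff_refl _).
- by move=> x /UP Ux; apply/UE; rewrite mul_mx_scalar; apply: submodZ.
- by exists w0; [apply/UE; rewrite mul_mx_scalar|move/UP].
split=> [j ej|j s je]; first by apply: (les_van L); [exact: vC|exact: vP'].
by apply: (les_gr L); [exact: gC|exact: gP'].
Qed.

End Vanishing.

(** * Krull dimension *)

Lemma big_ord_digits (V : nmodType) (m M : nat) (F : nat -> V) :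
  \sum_(N < m * M) F N = \sum_(r < M) \sum_(N < m) F (N * M + r)%N.
Proof.
elim: m => [|m IH]; first by rewrite big_ord0 big1 // => r _; rewrite big_ord0.
rewrite -(big_mkord xpredT F) mulSn addnC (@big_cat_nat _ _ _ (m * M)) ?leq_addr //=.
rewrite big_mkord IH -{1}[(m * M)%N]add0n big_addn addKn big_mkord -big_split /=.
by apply: eq_bigr => r _; rewrite big_ord_recr /= addnC.
Qed.

Section Dimension.
Variables (k : fieldType) (R : gring k).
Hypothesis R0 : forall x : R, rdeg 0%N x <-> exists c : k, x = c%:A.

(** The exponents are the base-[M] digits of [N], so a single index below [M ^ s] runs through all
    monomials with exponents below [M]. *)
Fixpoint monomial (M s : nat) (a : nat -> R) (N : nat) : R :=
  match s with
  | 0%N => 1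
  | s.+1 => a 0%N ^+ (N %% M) * monomial M s (fun l => a l.+1) (N %/ M)
  end.

(* Modulo [p 0], dividing by the lowest power of [a 0] and then reducing modulo
   [p 1] isolates the terms of lowest degree in [a 0]. *)
Lemma chain_independent M s (a : nat -> R) (p : nat -> prime_idealr R) (c : nat -> k) :
  (forall l, (l < s)%N -> [/\ a l \in p l.+1, a l \notin p l & {subset p l <= p l.+1}]) ->
  \sum_(N < M ^ s) (c N)%:A * monomial M s a N \in p 0%N ->
  forall N, (N < M ^ s)%N -> c N = 0.
Proof.
elim: s a p c => [|s IH] a p c ap.
  rewrite expn0 big_ord1 mulr1 => cp [|//] _; apply/eqP/negP => /negP c0.
  have : (c 0%N)^-1%:A * (c 0%N)%:A \in p 0%N by exact: idealMr.
  by rewrite -scalerAl mul1r scalerA mulVf // scale1r idealr1.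
have [ap1 anp0 p01] := ap 0%N isT.
pose Q r := \sum_(N < M ^ s) (c (N * M + r)%N)%:A * monomial M s (fun l => a l.+1) N.
rewrite expnSr (big_ord_digits _ _ (fun N => (c N)%:A * monomial M s.+1 a N)) => sp.
have M0 N : (N < M ^ s * M)%N -> (0 < M)%N by rewrite lt0n; apply: contraL => /eqP ->; rewrite muln0.
have spE : \sum_(r < M) \sum_(N < M ^ s) (c (N * M + r)%N)%:A * monomial M s.+1 a (N * M + r) =
    \sum_(r < M) a 0%N ^+ r * Q r.
  apply: eq_bigr => r _; rewrite mulr_sumr; apply: eq_bigr => N _ /=.
  rewrite mulrCA modnMDl modn_small // divnMDl ?divn_small ?addn0 //.
  exact: leq_ltn_trans (ltn_ord r).
rewrite {}spE in sp.
have Q0 r : (r < M)%N -> forall N, (N < M ^ s)%N -> c (N * M + r)%N = 0.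
  elim/ltn_ind: r => r IHr rM.
  apply: (IH (fun l => a l.+1) (fun l => p l.+1) (fun N => c (N * M + r)%N)).
    by move=> l ls; exact: ap.
  rewrite -/(Q r); pose z := \sum_(j < M | (r < j)%N) a 0%N ^+ (j - r.+1) * Q j.
  have E : \sum_(r < M) a 0%N ^+ r * Q r = a 0%N ^+ r * (Q r + a 0%N * z).
    rewrite (bigD1 (Ordinal rM)) //= mulrDr; congr (_ + _).
    rewrite (bigID (fun j : 'I_M => (r < j)%N)) /= [X in _ + X]big1 ?addr0; last first.
      move=> j /andP[jr]; rewrite -leqNgt => jr'.
      have jr2 : (j < r)%N by rewrite ltn_neqAle jr' andbT.
      by rewrite /Q big1 ?mulr0 // => N _; rewrite IHr ?scale0r ?mul0r.
    rewrite /z !mulr_sumr; apply: eq_big => [j|j /andP[_ rj]].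
      by have [rj|//] := boolP (r < j)%N; rewrite ?andbF ?andbT //; apply/eqP => jE; rewrite jE /= ltnn in rj.
    by rewrite !mulrA -exprSr -exprD subnKC.
  move: sp; rewrite E prime_idealrM => /orP[|].
    have : a 0%N ^+ r \notin p 0%N.
      elim: r {IHr rM z E} => [|r IHr]; first by rewrite expr0 idealr1.
      by rewrite exprS prime_idealrM negb_or anp0.
    by move=> /negbTE ->.
  move=> /p01 Qz; rewrite -[Q r](addrK (a 0%N * z)) rpredB // mulrC.
  exact: idealMr.
move=> N NM; have := M0 _ NM => M1.
by rewrite (divn_eq N M); apply: Q0; [exact: ltn_pmod|rewrite ltn_divLR].
Qed.

Definition degle (n : nat) (x : R) := forall i : int, n%:Z < i -> rcomp x i = 0.

Lemma degleM n m x y : degle n x -> degle m y -> degle (n + m) (x * y).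
Proof.
move=> dx dy l nml.
have [s [_ hx _ {1}->]] := gcompP (Rz_grading R) x.
have [t [_ hy _ {1}->]] := gcompP (Rz_grading R) y.
rewrite /rcomp mulr_suml gcomp_sum big1 // => i _; rewrite mulr_sumr gcomp_sum big1 // => j _.
rewrite (gcomp_homog _ _ (RzM (hx i) (hy j))); case: eqP => // lE.
have [ni|ni] := ltP n%:Z i; first by rewrite [gcomp _ x i]dx // mul0r.
by rewrite [gcomp _ y j]dy ?mulr0 //; lia.
Qed.

Lemma degle_mono n m x : (n <= m)%N -> degle n x -> degle m x.
Proof. by move=> nm dx i mi; apply: dx; lia. Qed.

Lemma degle1 : degle 0 1.
Proof.
move=> i i0; rewrite /rcomp (gcomp_homog _ (i := 0)); last exact: rdeg1.
by case: eqP => // ii; rewrite ii ltxx in i0.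
Qed.

Lemma degleX n r x : degle n x -> degle (r * n) (x ^+ r).
Proof.
move=> dx; elim: r => [|r IH]; first exact: degle1.
by rewrite exprS mulSn; exact: degleM.
Qed.

Lemma degle_ex x : exists n, degle n x.
Proof.
have [s [us _ x0 _]] := gcompP (Rz_grading R) x.
exists (\max_(i <- s) absz i)%N => i ni; apply: x0; apply/negP => is_.
have := leq_bigmax_seq (F := absz) i is_ isT; lia.
Qed.

Lemma degle_monomial M s a n N : (forall l, (l < s)%N -> degle n (a l)) -> (0 < M)%N ->
  degle (s * (M * n)) (monomial M s a N).
Proof.
move=> + M0; elim: s a N => [|s IH] a N an; first exact: degle1.
rewrite /= mulSn; apply: degleM; last by apply: IH => l ls; exact: an.
apply: (degle_mono _ (degleX (an 0%N isT))).
by rewrite leq_mul2r ltnW ?orbT // ltn_pmod.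
Qed.

Lemma klin_rcomp i : klin (fun x : R^o => rcomp x i : R^o).
Proof.
move=> c x y; rewrite /rcomp gcompD; congr (_ + _).
have := @rcompMl _ R 0 c%:A x i; rewrite add0r; apply.
by apply/(R0 _); exists c.
Qed.

Lemma degle_span (h : int -> nat) :
  (forall i, qle (V := R^o) (@Rz _ R i) (fun x => x = 0) (h i)) ->
  forall n, qle (V := R^o) (degle n) (fun x => x = 0) (\sum_(l < n.+1) h l)%N.
Proof.
move=> hP.
have sub n : subsp (V := R^o) (degle n).
  split; first by move=> i _; exact: gcomp0.
  by move=> c x y dx dy i ni; rewrite klin_rcomp dx // dy // scaler0 addr0.
have low (x : R) : (forall i : int, 0 <= i -> rcomp x i = 0) -> x = 0.
  move=> x0; apply: (@gcomp_eq0 _ _ _ (Rz_grading R)) => i.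
  have [/x0 //|i0] := leP 0 i.
  exact: (Rz_neg i0 (rcomp_deg x i)).
elim=> [|n IH].
  rewrite big_ord1; have [v vP] := hP 0; exists v => z dz; apply: vP.
  rewrite (_ : z = rcomp z 0); first exact: rcomp_deg.
  apply/eqP; rewrite -subr_eq0; apply/eqP/low => i; rewrite le_eqVlt => /orP[/eqP <-|i0].
    by rewrite /rcomp gcompB (gcomp_id _ (gcomp_deg _ z 0)) subrr.
  rewrite /rcomp gcompB (gcomp_homog _ _ (gcomp_deg _ z 0)) gt_eqF // subr0.
  exact: dz.
rewrite big_ord_recr /= addnC.
apply: (qle_ext (h := fun x : R^o => rcomp x n.+1 : R^o) (B2 := fun x => x = 0)).
- exact: klin_rcomp.
- exact: sub.
- exact: subsp0.
- by have [v vP] := hP n.+1; exists v => z _; apply: vP; exact: rcomp_deg.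
- apply: qle_sub IH => z [dz z0] i ni.
  have [->//|ne] := eqVneq i n.+1%:Z; apply: dz; lia.
Qed.

(** A chain of length e+1 yields e+1 elements whose monomials are linearly independent. The M^(e+1)
    monomials with exponents below M have degree O(M), where only O(M^e) dimensions are
    available. *)
Lemma krull_bound (h : int -> nat) N e : poly_bounded h N e ->
  (forall i, qle (V := R^o) (@Rz _ R i) (fun x => x = 0) (h i)) -> ~ krull_dim_ge R e.+1.
Proof.
move=> [_ [C hC]] hP [p0 pP].
pose p l := p0 (inord l).
have /choice[a aP] : forall l : nat, exists a, (l < e.+1)%N ->
    [/\ a \in p l.+1, a \notin p l & {subset p l <= p l.+1}].
  move=> l; have [le|nle] := boolP (l < e.+1)%N; last by exists 0.
  have [|sub nsub] := pP (inord l) (inord l.+1); first by rewrite !inordK // ltnW.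
  apply: contrapT => no; apply: nsub => x xp; apply: contrapT => /negP nx.
  by apply: no; exists x.
have /choice[dg dgP] := fun l => degle_ex (a l).
pose d := (\max_(l < e.+1) dg l)%N.
(* [T] is chosen so that N + (e+1)Md + 2 is at most MT, and [M] so that C(MT)^e is less than
   M^(e+1). *)
pose T := (N + e.+1 * d + 2)%N; pose M := (C * T ^ e).+1.
have aM N' : degle (e.+1 * (M * d)) (monomial M e.+1 a N').
  apply: degle_monomial => // l le; apply: (degle_mono _ (dgP l)).
  exact: (leq_bigmax (F := fun l : 'I_e.+1 => dg l) (Ordinal le)).
have [v vP] := degle_span hP (e.+1 * (M * d)).
have lt : (\sum_(l < (e.+1 * (M * d)).+1) h l < M ^ e.+1)%N.
  apply: (@leq_ltn_trans (cumul h N (N + (e.+1 * (M * d)).+1))).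
    rewrite /cumul big_split_ord /= addnC; apply: leq_trans (leq_addr _ _).
    by apply: leq_sum => l _; rewrite (_ : (_ - _)%R = l%:Z) //; lia.
  apply: leq_ltn_trans (hC _) _.
  apply: (@leq_ltn_trans (C * (M * T) ^ e)).
    have lexp x y s : (x <= y)%N -> (x ^ s <= y ^ s)%N by case: s => // s; rewrite leq_exp2r.
    rewrite leq_mul2l; apply/orP; right; apply: lexp.
    rewrite /T; have : (0 < M)%N by []; move: (M) => M' M0.
    rewrite mulnCA; move: (e.+1 * d)%N => u; rewrite !mulnDr.
    by have := leq_pmull N M0; have := leq_pmull u M0; lia.
  by rewrite expnMn mulnCA -/M expnSr ltn_pmul2l ?expn_gt0.
have [|c c0 [i ci]] := dependent (w := fun i : 'I_(M ^ e.+1) => (monomial M e.+1 a i : R^o)) (v := v) lt.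
  by move=> i; have [c cE] := vP _ (aM i); exists c; apply/eqP; rewrite -subr_eq0; apply/eqP.
pose c' n := if insub n is Some i then c i else 0.
have cE (j : 'I_(M ^ e.+1)) : c' j = c j by rewrite /c' valK.
case/eqP: ci; rewrite -cE; apply: (@chain_independent M e.+1 a p c') => //.
have -> : \sum_(j < M ^ e.+1) (c' j)%:A * monomial M e.+1 a j = 0.
  by rewrite -[RHS]c0; apply: eq_bigr => j _; rewrite cE.
exact: rpred0.
Qed.

End Dimension.

(** * Depth *)

Section Depth.
Variables (k : fieldType) (R : gring k).
Hypothesis R0 : forall x : R, rdeg 0%N x <-> exists c : k, x = c%:A.
Hypothesis noeR : noetherian R.

Notation "U_[ P ]" := (rowspan (rD P 0)) (at level 0, format "U_[ P ]").

Section Cons.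
Variables (n n1 : nat) (Q : resolution R n) (b : 'I_n1 -> int) (X : 'M[R]_(n, n1)).
Hypothesis gX : gmx (rdg (g := Q) (j := 0)) b X.
Hypothesis XU : forall v : 'rV_n, v *m X = 0 <-> U_[Q] v.

Definition csize := fsz n (rsz Q).
Definition cdeg j : 'I_(fsz n1 csize j) -> int :=
  match j return 'I_(fsz n1 csize j) -> int with
  | 0%N => b | j.+1 => rdg (g := Q) (j := j) end.
Definition cdiff j : 'M[R]_(fsz n1 csize j.+1, fsz n1 csize j) :=
  match j return 'M[R]_(fsz n1 csize j.+1, fsz n1 csize j) with
  | 0%N => X | j.+1 => rD Q j end.

Lemma cdiff_gmx j : gmx (@cdeg j.+1) (@cdeg j) (cdiff j).
Proof. by case: j => [|j]; [exact: gX|exact: (@rgmx _ _ _ Q j)]. Qed.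

Lemma cdiff_cx j : cdiff j.+1 *m cdiff j = 0.
Proof.
case: j => [|j]; last exact: (@rcx _ _ _ Q j).
apply/row_matrixP => i; rewrite row_mul row0; apply/XU.
by exists (delta_mx 0 i); rewrite rowE.
Qed.

Lemma cdiff_ex j v : v *m cdiff j = 0 -> rowspan (cdiff j.+1) v.
Proof. by case: j v => [|j] v; [move/XU|exact: (@rex _ _ _ Q j)]. Qed.

(** By [XU], [Q] resolves the image of [X]; putting [X] in front resolves its cokernel and moves the
    higher cohomology up by one index. *)
Definition gcons : resolution R n1 := GRes cdiff_gmx cdiff_cx cdiff_ex.

Lemma gcons_van j : vanishing Q j.+1 -> vanishing gcons j.+2.
Proof. by []. Qed.
End Cons.

(** Coboundaries without a degree condition: the relations of the dual module form a submodule of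
    all vectors, homogeneous or not. *)
Definition Ball n (P : resolution R n) j : 'cV[R]_(sz P j) -> Prop :=
  match j return 'cV[R]_(sz P j) -> Prop with
  | 0%N => fun c => c = 0
  | j.+1 => fun c => exists b, c = rD P j *m b
  end.
Arguments Ball {n} P j _.

Lemma Bc_Ball n (P : resolution R n) j i c : Bc P j i c -> Ball P j c.
Proof. by case: j c => [|j] c // [b _ ->]; exists b. Qed.

Lemma Ball_Bc n (P : resolution R n) j i c :
  gmx (rdg (g := P) (j := j)) (fun=> - i) c -> Ball P j c -> Bc P j i c.
Proof. by case: j c => [|j] c // gc [b bE]; exact: Bc_intro gc bE. Qed.

Lemma Ball_cocycle n (P : resolution R n) j c : Ball P j c -> rD P j *m c = 0.
Proof.
case: j c => [|j] c; first by move=> ->; rewrite mulmx0.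
by move=> [b ->]; rewrite mulmxA rcx mul0mx.
Qed.

Lemma free_res n (a : 'I_n -> int) : exists Q : resolution R n,
  [/\ rdg (g := Q) (j := 0) = a, forall v, U_[Q] v <-> v = 0 & forall j, (0 < j)%N -> vanishing Q j].
Proof.
pose s (j : nat) := 0%N.
pose dg j : 'I_(fsz n s j) -> int :=
  match j return 'I_(fsz n s j) -> int with 0%N => a | j.+1 => fun=> 0 end.
pose D j : 'M[R]_(fsz n s j.+1, fsz n s j) := 0.
have gD j : gmx (@dg j.+1) (@dg j) (D j) by move=> [].
have cD j : D j.+1 *m D j = 0 by rewrite mulmx0.
have eD j v : v *m D j = 0 -> rowspan (D j.+1) v.
  by move=> _; exists 0; rewrite mul0mx [LHS]thinmx0.
exists (GRes gD cD eD); split=> //.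
  by move=> v; split=> [[w ->]|->]; [rewrite mulmx0|exists 0; rewrite mulmx0].
move=> [//|j] _ i c _; rewrite [c]flatmx0.
exact: (proj1 (Bc_subsp R0 (GRes gD cD eD) j.+1 i)).
Qed.

(* Transposing the first [m] differentials of [P] yields a resolution as long as
   the cohomology of [P] vanishes below [m]. *)
Lemma dual_res n (P : resolution R n) m : (forall i, (i < m)%N -> vanishing P i) ->
  exists Q : resolution R (sz P m),
  [/\ rdg (g := Q) (j := 0) = fun l => - rdg (g := P) (j := m) l,
      forall v, U_[Q] v <-> Ball P m v^T & forall j, (m < j)%N -> vanishing Q j].
Proof.
elim: m => [|m IH] vP.
  have [Q [dE UE vQ]] := free_res (fun l => - rdg (g := P) (j := 0) l).
  exists Q; split=> // v; split=> [/UE ->|v0]; first by rewrite /Ball trmx0.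
  by apply/UE; rewrite -[v]trmxK [v^T]v0 trmx0.
have [|Q [dE UE vQ]] := IH; first by move=> i im; apply: vP; exact: ltnW.
have gX : gmx (rdg (g := Q) (j := 0)) (fun l => - rdg (g := P) (j := m.+1) l) (rD P m)^T.
  by rewrite dE; have /gmx_tr := @rgmx _ _ _ P m.
have XU v : v *m (rD P m)^T = 0 <-> U_[Q] v.
  split=> [v0|/UE vB].
    have [s sE] := row_decomp (fun l => - rdg (g := P) (j := m) l) v.
    rewrite sE; apply: submod_sum; first exact: rowspan_submod.
    move=> u _; apply/UE; apply: (@Bc_Ball _ _ _ u); apply: vP => //; split.
      by move=> x y; rewrite mxE; have := @pr_gmx _ R _ _ (fun=> u) (fun l => - rdg (g := P) (j := m) l) v y x; rewrite !opprK addrC.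
    have /gmx_tr gT := @rgmx _ _ _ P m.
    rewrite -[rD P m]trmxK -trmx_mul -(prMr (fun=> u) v gT).
    by rewrite v0; apply/matrixP => x y; rewrite !mxE /rcomp gcomp0.
  rewrite -[v]trmxK -trmx_mul; suff -> : rD P m *m v^T = 0 by rewrite trmx0.
  exact: Ball_cocycle.
exists (gcons gX XU); split=> //.
  move=> v; split=> [[w ->]|[b bE]]; first by exists w^T; rewrite trmx_mul trmxK.
  by exists b^T; rewrite -[LHS]trmxK bE trmx_mul.
by move=> [//|[//|j]] mj; apply: gcons_van; apply: vQ.
Qed.

Lemma semisimple_irr (P : resolution R 1) (v : 'rV[R]_1) : semisimple P ->
  rcomp (v 0 0) 0 = 0 -> U_[P] v.
Proof.
move=> sP v0; have [s [us dx xs xE]] := gcompP (Rz_grading R) (v 0 0).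
have -> : v = \sum_(i <- s) rcomp (v 0 0) i *: (1%:M : 'rV_1).
  by rewrite -scaler_suml -xE; apply/rowP => j; rewrite !mxE ord1 mulr1.
apply: submod_sum; first exact: rowspan_submod.
move=> i _; have [i0|] := ltP 0 i; first by apply: (sP i) => //; exact: dx.
rewrite le_eqVlt => /orP[/eqP ->|i0].
  by rewrite v0 scale0r; case: (rowspan_submod (rD P 0)).
have -> : rcomp (v 0 0) i = 0 by exact: Rz_neg i0 (dx i).
by rewrite scale0r; case: (rowspan_submod (rD P 0)).
Qed.

Lemma kill_Ball (P : resolution R 1) (w : 'rV[R]_1) j i c : U_[P] w -> Zc P j i c ->
  Ball P j (w 0 0 *: c).
Proof.
move=> Uw Zcc; have sU := rowspan_submod (rD P 0).
have [s [us dx xs xE]] := gcompP (Rz_grading R) (w 0 0).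
have subB : forall (x y : 'cV_(sz P j)), Ball P j x -> Ball P j y -> Ball P j (x + y).
  case: (j) => [x y -> ->|j' _ _ [x ->] [y ->]]; first by rewrite addr0.
  by exists (x + y); rewrite mulmxDr.
rewrite xE scaler_suml; elim/big_ind: _ => //.
  by case: (j) => // j'; exists 0; rewrite mulmx0.
move=> u _; apply: (@Bc_Ball _ _ _ (i + u)); apply: (hom_kill (dx u)) => // v.
pose b := rdg (g := P) (j := 0) 0.
have : U_[P] (pr (fun=> u + b) (rdg (g := P) (j := 0)) w).
  exact: (rowspan_graded (@rgmx _ _ _ P 0)).
move=> /(submodZ (v 0 0) sU); congr (U_[P] _).
apply/rowP => l; rewrite !mxE ord1 mulrC; congr (_ * _).
by rewrite /rcomp -/b addrK.
Qed.

(** [Q] resolves the module L of the overview. A cocycle [z] in degree [t] that is not a coboundary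
    gives an element of L whose annihilator is the irrelevant ideal, hence the copy of k. *)
Lemma depth e (P : resolution R 1) : vanishes_from R e.+1 -> semisimple P -> ~ vanishing P e ->
  forall i, (i < e)%N -> vanishing P i.
Proof.
move=> ve sP nvP.
have ex : exists t, `[< ~ vanishing P t >] by exists e; apply/asboolP.
case: (ex_minnP ex) => t /asboolP nvt' tmin.
have vlt i : (i < t)%N -> vanishing P i.
  by move=> it; apply: contrapT => /asboolP /tmin; rewrite leqNgt it.
have [et|te] := leqP e t; first by move=> i ie; apply: vlt; exact: leq_trans et.
exfalso; have [Q [dE UE vQ]] := dual_res vlt.
have [i [z [Zz nBz]]] : exists i z, Zc P t i z /\ ~ Bc P t i z.
  apply: contrapT => no; apply: nvt' => i c Zcc; apply: contrapT => nB.
  by apply: no; exists i, c.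
(* This puts the generator of [P'] in degree [i], so that sending it to [z^T] is homogeneous of
   degree 0. *)
pose P' := gshift P (i - rdg (g := P) (j := 0) 0).
have UQ w : U_[Q] (w *m z^T : 'rV_(sz P t)) <-> Ball P t (w 0 0 *: z).
  rewrite (_ : w *m z^T = (w 0 0 *: z)^T) ?UE ?trmxK //.
  by apply/rowP => l; rewrite !mxE big_ord1 mxE.
have sU := rowspan_submod (rD Q 0).
have [||C [UC L]] := @cone_ex _ _ R0 _ _ Q P' z^T.
- move=> x y; rewrite mxE dE /P' /= /sdg (ord1 x).
  by have := (proj1 Zz) y 0; rewrite opprK (_ : _ - - _ = rdg (g := P) (j := t) y + i); [move=> h; exact: h|ring].
- move=> w; rewrite UQ; split=> [Uw|Bw]; first exact: (@kill_Ball P w t i z Uw Zz).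
  apply: semisimple_irr => //; apply: contrapT => /eqP w0; apply: nBz.
  have [y yw] := rdeg0_unit R0 (rcomp_deg (w 0 0) 0) w0.
  apply: Ball_Bc; first exact: (proj1 Zz).
  (* Without its constant term, [w] multiplies [z] into the coboundaries; so the constant term does
     as well, and being a unit it would make [z] a coboundary. *)
  pose w' := w - (rcomp (w 0 0) 0)%:M.
  have Uw' : U_[P] w'.
    apply: semisimple_irr => //.
    by rewrite !mxE /= mulr1n /rcomp gcompB (gcomp_id _ (gcomp_deg _ (w 0 0) 0)) subrr.
  have /UQ Qw' := kill_Ball Uw' Zz; move/UQ: Bw => Qw.
  have /(submodZ y sU) := submodD sU Qw (submodN sU Qw').
  rewrite -mulNmx -mulmxDl /w' opprB addrC subrK mul_scalar_mx scalerA yw scale1r.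
  by move/UE; rewrite trmxK.
have vC : vanishing C e.+1 by apply: (proj1 (main_bound R0 noeR ve C)).
have vP' : vanishing P' e by apply: (les_van2 L) => //; exact: vQ.
apply: nvP => l c; rewrite -[l](subrK (i - rdg (g := P) (j := 0) 0)).
by move=> /gshift_Zc /vP' /gshift_Bc.
Qed.

Lemma gorenstein_depth : gorenstein R -> exists (K : resolution R 1) e,
  [/\ rdg (g := K) (j := 0) = (fun=> 0), forall v, U_[K] v <-> rcomp (v 0 0) 0 = 0,
      forall i, (i < e)%N -> vanishing K i & ~ krull_dim_ge R e.+1].
Proof.
move=> gor; have [r rP] := gorenstein_vanish R0 gor.
have ex : exists e, `[< vanishes_from R e >].
  by exists r.+1; apply/asboolP => P _ j; exact: rP.
case: (ex_minnP ex) => -[|e] /asboolP ve emin.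
  (* If *Ext^j(k,R) vanished for every j, [main_bound] would give Hom(R,R) = 0, although the
     identity is nonzero. *)
  have [Q [dE UE _]] := free_res (fun _ : 'I_1 => 0).
  have vQ : vanishing Q 0 by apply: (proj1 (main_bound R0 noeR ve Q)).
  have : Bc Q 0 0 (const_mx 1).
    apply: vQ; split; first by move=> x y; rewrite mxE dE subrr; exact: rdeg1.
    apply/row_matrixP => i; rewrite row_mul row0.
    have /UE -> : U_[Q] (row i (rD Q 0)) by exists (delta_mx 0 i); rewrite rowE.
    by rewrite mul0mx.
  move=> /matrixP/(_ 0 0); rewrite !mxE => /eqP; by rewrite oner_eq0.
have [P [sP nvP]] : exists P : resolution R 1, semisimple P /\ ~ vanishing P e.
  apply: contrapT => no; have /emin : `[< vanishes_from R e >]; last by rewrite ltnn.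
  apply/asboolP => P sP j; rewrite leq_eqVlt => /orP[/eqP <-|ej]; last exact: ve.
  by apply: contrapT => nv; apply: no; exists P.
exists (gshift P (- rdg (g := P) (j := 0) 0)), e; split.
- by apply/funext => l; rewrite /= /sdg (ord1 l) subrr.
(* If [U_[P]] contained an element with nonzero constant term, [P] would resolve zero and its
   cohomology would vanish at [e]. *)
- move=> v; split=> [Uv|]; last exact: semisimple_irr.
  apply: contrapT => /eqP v0; apply: nvP; apply: kill_all => // w.
  have [y yv] := rdeg0_unit R0 (rcomp_deg (v 0 0) 0) v0.
  have sU := rowspan_submod (rD P 0).
  have U1 : U_[P] (rcomp (v 0 0) 0)%:M.
    rewrite -[X in U_[P] X](subKr v); apply: submodD => //; apply: submodN => //.
    apply: semisimple_irr => //.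
    by rewrite !mxE /= mulr1n /rcomp gcompB (gcomp_id _ (gcomp_deg _ (v 0 0) 0)) subrr.
  have := submodZ (w 0 0 * y) sU U1; congr (U_[P] _).
  by apply/rowP => l; rewrite !mxE ord1 mulr1n -mulrA yv mulr1.
- move=> i ie l c /gshift_Zc Zcc; apply/gshift_Bc.
  exact: (depth ve sP nvP ie).
(* The degree-0 cohomology of the free resolution of [R] is [R] itself, so the growth bound for
   [j = 0] is one for its Hilbert function. *)
- have [Q [dE UE _]] := free_res (fun _ : 'I_1 => 0).
  have [h [N [hP hb]]] := proj2 (main_bound R0 noeR ve Q) 0%N e erefl.
  apply: (krull_bound R0 hb) => i.
  have [v vP] := hP i; exists (fun j => v j 0 0) => x dx.
  have [|c cE] := vP (const_mx x).
    split; first by move=> a b; rewrite mxE dE opprK add0r.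
    apply/row_matrixP => l; rewrite row_mul row0.
    have /UE -> : U_[Q] (row l (rD Q 0)) by exists (delta_mx 0 l); rewrite rowE.
    by rewrite mul0mx.
  exists c; have /matrixP/(_ 0 0) := cE; rewrite !mxE summxE => xE.
  rewrite -[RHS]xE; congr (_ - _); apply: eq_bigr => j _.
  by rewrite mxE.
Qed.

End Depth.

(** * Graded modules *)

Section GradedModules.
Variables (k : fieldType) (R : gring k).
Implicit Types (M N A B X : gmod R).

Definition mcomp M := gcomp (mdeg_grading M).

Lemma mdeg0 M i : mdeg i (0 : M). Proof. exact: (grading0 (mdeg_grading M)). Qed.

Lemma mdegRz M (i j : int) (a : R) (x : M) : Rz i a -> mdeg j x -> mdeg (i + j) (a *: x).
Proof.
case: i => i; first exact: mdegZ.
by move=> -> _; rewrite scale0r; exact: mdeg0.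
Qed.

Lemma ghom_id M : @ghom _ _ M M id. Proof. by []. Qed.

Lemma ghom_comp M N A (f : M -> N) (g : N -> A) : ghom f -> ghom g -> ghom (fun x => g (f x)).
Proof.
move=> [lf df] [lg dg]; split; first by move=> a x y; rewrite lf lg.
by move=> i x /df /dg.
Qed.

Lemma ghom0 M N : @ghom _ _ M N (fun=> 0).
Proof. by split=> [a x y|i x _]; [rewrite scaler0 addr0|exact: mdeg0]. Qed.

Lemma ghomD M N (f g : M -> N) : ghom f -> ghom g -> ghom (fun x => f x + g x).
Proof.
move=> [lf df] [lg dg]; split; first by move=> a x y; rewrite lf lg scalerDr addrACA.
by move=> i x dx; apply: (degD (mdeg_grading N)); [exact: df|exact: dg].
Qed.

Lemma ghomN M N (f : M -> N) : ghom f -> ghom (fun x => - f x).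
Proof.
move=> [lf df]; split; first by move=> a x y; rewrite lf opprD scalerN.
by move=> i x dx; apply: (degN (mdeg_grading N)); exact: df.
Qed.

Lemma ghomB M N (f g : M -> N) : ghom f -> ghom g -> ghom (fun x => f x - g x).
Proof. by move=> hf hg; apply: ghomD => //; exact: ghomN. Qed.

Lemma ghom_sum M N J (s : seq J) (P : pred J) (f : J -> M -> N) :
  (forall j, ghom (f j)) -> ghom (fun x => \sum_(j <- s | P j) f j x).
Proof.
move=> hf; elim: s => [|j s IH].
  by rewrite (_ : (fun _ => _) = fun=> 0); [exact: ghom0|apply/funext => x; rewrite big_nil].
have [Pj|nPj] := boolP (P j).
  rewrite (_ : (fun _ => _) = fun x => f j x + \sum_(j <- s | P j) f j x); first exact: ghomD.
  by apply/funext => x; rewrite big_cons Pj.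
rewrite (_ : (fun _ => _) = fun x => \sum_(j <- s | P j) f j x) //.
by apply/funext => x; rewrite big_cons (negbTE nPj).
Qed.

Lemma hom_eq M (V : lmodType R) (f g : M -> V) : linear f -> linear g ->
  (forall i x, mdeg i x -> f x = g x) -> f =1 g.
Proof.
move=> lf lg fg x; have [s [us dx _ ->]] := gcompP (mdeg_grading M) x.
by rewrite (lin_sum lf) (lin_sum lg); apply: eq_bigr => i _; apply: (fg i); exact: dx.
Qed.

Lemma ghom_mcomp0 M N (f : M -> N) : ghom f -> forall x i, mcomp (f x) i = f (mcomp x i).
Proof.
move=> [lf df] x i; apply: (gcomp_shift (mdeg_grading M) (mdeg_grading N) (f := f) (sh := id)) => //.
exact: linD.
Qed.

Section Pair.
Variables (M N : gmod R).
Definition pdeg (i : int) : set (M * N) := fun x => mdeg i x.1 /\ mdeg i x.2.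
Lemma pdeg_grading : is_grading pdeg.
Proof.
have [gM gN] := (mdeg_grading M, mdeg_grading N).
split=> [i|i x y [x1 x2] [y1 y2]|[x y]|s c us dc sc i is_].
- by split; exact: mdeg0.
- by split; [exact: (gradingB gM)|exact: (gradingB gN)].
- have [s [us _ hx {1}->]] := gcompP gM x; have [t [ut _ hy {1}->]] := gcompP gN y.
  pose r := undup (s ++ t); exists r, (fun i => (gcomp gM x i, gcomp gN y i)); split.
  + exact: undup_uniq.
  + by move=> i; split; exact: gcomp_deg.
  + have E (q : seq int) : \sum_(i <- q) (gcomp gM x i, gcomp gN y i) =
        (\sum_(i <- q) gcomp gM x i, \sum_(i <- q) gcomp gN y i).
      by elim: q => [|i q IH]; rewrite ?big_nil // !big_cons IH.
    rewrite E; congr (_, _); apply/esym; apply: sum_supp => //; rewrite ?undup_uniq //.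
      by move=> i is_; rewrite mem_undup mem_cat is_.
    by move=> i is_; rewrite mem_undup mem_cat is_ orbT.
- have E (q : seq int) : \sum_(i <- q) c i = (\sum_(i <- q) (c i).1, \sum_(i <- q) (c i).2).
    by elim: q => [|j q IH]; rewrite ?big_nil // !big_cons IH; case: (c j).
  move: sc; rewrite E => -[s1 s2].
  have c1 := grading_indep gM us (fun i => proj1 (dc i)) s1 is_.
  have c2 := grading_indep gN us (fun i => proj2 (dc i)) s2 is_.
  by rewrite [c i]surjective_pairing c1 c2.
Qed.
Lemma pdegZ (i : nat) (j : int) (a : R) x : rdeg i a -> pdeg j x -> pdeg (i%:Z + j) (a *: x).
Proof. by move=> da [x1 x2]; split; exact: mdegZ. Qed.
Lemma pair_fg : exists n (g : 'I_n -> M * N),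
  forall x, exists c : 'I_n -> R, x = \sum_i c i *: g i.
Proof.
have [m [g gP]] := gmod_fg M; have [n [h hP]] := gmod_fg N.
exists (m + n)%N, (fun i => match split i with inl l => (g l, 0) | inr l => (0, h l) end).
move=> [x y]; have [c cE] := gP x; have [e eE] := hP y.
exists (fun i => match split i with inl l => c l | inr l => e l end).
rewrite big_split_ord /=.
under eq_bigr do rewrite (unsplitK (inl _)).
under [X in _ + X]eq_bigr do rewrite (unsplitK (inr _)).
have E1 (q : seq 'I_m) : \sum_(i <- q) c i *: (g i, 0 : N) = (\sum_(i <- q) c i *: g i, 0).
  by elim: q => [|i q IH]; rewrite ?big_nil // !big_cons IH; congr (_, _); rewrite /= ?scaler0 ?addr0 ?add0r.
have E2 (q : seq 'I_n) : \sum_(i <- q) e i *: (0 : M, h i) = (0, \sum_(i <- q) e i *: h i).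
  by elim: q => [|i q IH]; rewrite ?big_nil // !big_cons IH; congr (_, _); rewrite /= ?scaler0 ?addr0 ?add0r.
by rewrite E1 E2 -cE -eE; congr (_, _); rewrite /= ?addr0 ?add0r.
Qed.
Definition gpair : gmod R := GMod pdeg_grading pdegZ pair_fg.
Lemma ghom_inl : @ghom _ _ M gpair (fun x => (x, 0)).
Proof. by split=> [a x y|i x dx]; [congr (_, _); rewrite /= ?scaler0 ?addr0|split=> //; exact: mdeg0]. Qed.
Lemma ghom_inr : @ghom _ _ N gpair (fun x => (0, x)).
Proof. by split=> [a x y|i x dx]; [congr (_, _); rewrite /= ?scaler0 ?addr0|split=> //; exact: mdeg0]. Qed.
Lemma ghom_fst : @ghom _ _ gpair M fst. Proof. by split=> // i x []. Qed.
Lemma ghom_snd : @ghom _ _ gpair N snd. Proof. by split=> // i x []. Qed.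
End Pair.

Section Free.
Variables (n : nat) (a : 'I_n -> int).
Lemma rowdegZ (i : nat) (j : int) (c : R) (x : 'rV[R]_n) :
  rdeg i c -> @rowdeg _ R n a j x -> @rowdeg _ R n a (i%:Z + j) (c *: x).
Proof. by move=> dc dx u l; rewrite mxE -addrA; apply: RzM => //; exact: dx. Qed.
Lemma row_fg : exists m (g : 'I_m -> 'rV[R]_n),
  forall x, exists c : 'I_m -> R, x = \sum_i c i *: g i.
Proof.
exists n, (fun i => delta_mx 0 i) => x; exists (fun i => x 0 i).
exact: row_sum_delta.
Qed.
Definition gfree : gmod R := GMod (@rowdeg_grading _ R n a) rowdegZ row_fg.

Lemma delta_deg l : @rowdeg _ R n a (a l) (delta_mx 0 l : 'rV[R]_n).
Proof.
move=> u l'; rewrite mxE ord1 eqxx /=; have [->|_] := eqVneq l l'.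
  by rewrite subrr; exact: rdeg1.
exact: Rz0.
Qed.

Lemma ghom_free B (f : 'I_n -> B) b : (forall l, mdeg (a l + b) (f l)) ->
  @ghom _ _ gfree (shift B b) (fun v => \sum_l (v : 'rV[R]_n) 0 l *: f l).
Proof.
move=> df; split.
  move=> c x y; rewrite scaler_sumr -big_split; apply: eq_bigr => l _.
  by rewrite !mxE scalerDl scalerA.
move=> i x dx; apply: (deg_sum (mdeg_grading B)) => l _.
have := mdegRz (dx 0 l) (df l).
by rewrite (_ : i - a l + (a l + b) = i + b) //; ring.
Qed.

Lemma gfree_projective : gprojective gfree.
Proof.
move=> A B q f [lq dq] onto [lf df].
have /choice[e eP] : forall l, exists x, mdeg (a l) x /\ q x = f (delta_mx 0 l).
  move=> l; have [x xE] := onto (f (delta_mx 0 l)); exists (mcomp x (a l)); split.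
    exact: gcomp_deg.
  rewrite -(ghom_mcomp0 (conj lq dq)) xE; apply: gcomp_id.
  by apply: df; exact: delta_deg.
have [|lg dg] := @ghom_free A e 0; first by move=> l; rewrite addr0; case: (eP l).
exists (fun v => \sum_l (v : 'rV[R]_n) 0 l *: e l).
  by split=> // i x /dg; rewrite /= /shift_deg addr0.
move=> x; rewrite (lin_sum lq) {2}[x]row_sum_delta (lin_sum lf).
by apply: eq_bigr => l _; rewrite (linZ lq) (linZ lf); case: (eP l) => _ ->.
Qed.
End Free.

Lemma RzZdeg (i : nat) (j : int) (a : R) (x : R^o) : rdeg i a -> Rz j (x : R) ->
  Rz (i%:Z + j) (a *: x : R).
Proof. by move=> da dx; exact: (@RzM _ R i). Qed.
Lemma reg_fg : exists m (g : 'I_m -> R^o),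
  forall x, exists c : 'I_m -> R, x = \sum_i c i *: g i.
Proof. by exists 1%N, (fun=> 1) => x; exists (fun=> x); rewrite big_ord1 /GRing.scale /= mulr1. Qed.
Definition greg : gmod R := @GMod _ R R^o (@Rz _ R) (Rz_grading R) RzZdeg reg_fg.

Hypothesis noeR : noetherian R.

(** Finite generation is checked on the preimage of [U] in a free module that maps onto [M]. That
    [io] reflects degrees is what lets homogeneous maps be corestricted. *)
Lemma gsub_ex M (U : set M) : (U 0 /\ forall (a : R) x y, U x -> U y -> U (a *: x + y)) ->
  (forall x i, U x -> U (mcomp x i)) ->
  exists (S : gmod R) (io : S -> M), [/\ ghom io, injective io,
    forall x, U x <-> exists y, io y = x & forall i y, mdeg i (io y) -> mdeg i y].
Proof.
move=> sU gU; pose V := SubModule sU.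
have lio := @subv_linear _ _ V.
pose dg (i : int) : set (subt V) := fun y => mdeg i (subv y).
have grd : is_grading dg.
  pose gM := mdeg_grading M.
  split=> [i|i x y dx dy|y|s c us dc sc i is_]; rewrite /dg.
  - by rewrite (lin0 lio); exact: mdeg0.
  - by rewrite (linB lio); exact: (gradingB gM).
  - have [s [us dy hy yE]] := gcompP gM (subv y).
    have /choice[c cP] : forall i, exists z : subt V, subv z = mcomp (subv y) i.
      by move=> i; apply: (@subv_ex _ _ V); apply: gU; exact: (@subt_mem _ _ V).
    exists s, c; split=> //; first by move=> i; rewrite cP; exact: dy.
    apply: subv_inj; rewrite (lin_sum lio) {1}yE; apply: eq_bigr => i _.
    by rewrite cP.
  - apply: subv_inj; rewrite (lin0 lio).
    apply: (grading_indep gM us (c := fun i => subv (c i))) => //.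
    by rewrite -(lin_sum lio) sc (lin0 lio).
have dgZ (i : nat) (j : int) (a : R) x : rdeg i a -> dg j x -> dg (i%:Z + j) (a *: x).
  by move=> da dx; rewrite /dg (linZ lio); exact: mdegZ.
have fg : exists n (g : 'I_n -> subt V), forall x, exists c : 'I_n -> R, x = \sum_i c i *: g i.
  have [n [g gP]] := gmod_fg M.
  pose ev (v : 'rV[R]_n) := \sum_i v 0 i *: g i.
  have lev : linear ev.
    move=> a x y; rewrite /ev scaler_sumr -big_split; apply: eq_bigr => l _.
    by rewrite !mxE scalerDl scalerA.
  have [|m [G GP]] := @submod_fg _ _ noeR n (fun v => U (ev v)).
    split; first by rewrite (lin0 lev); exact: (proj1 sU).
    by move=> a x y Ux Uy; rewrite lev; exact: (proj2 sU).
  have /choice[h hP] : forall i, exists z : subt V, subv z = ev (row i G).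
    by move=> i; apply: (@subv_ex _ _ V); apply/GP; exists (delta_mx 0 i); rewrite rowE.
  exists m, h => x; have [c cE] := gP (subv x).
  have [w wE] : rowspan G (\row_i c i).
    apply/GP; have -> : ev (\row_i c i) = subv x.
      by rewrite cE; apply: eq_bigr => i _; rewrite mxE.
    exact: (@subt_mem _ _ V).
  exists (w 0); apply: subv_inj; rewrite (lin_sum lio).
  have -> : subv x = ev (\row_i c i) by rewrite cE; apply: eq_bigr => i _; rewrite mxE.
  rewrite wE mulmx_sum_row (lin_sum lev); apply: eq_bigr => i _.
  by rewrite (linZ lev) (linZ lio) hP.
exists (GMod grd dgZ fg), (@subv _ _ V); split=> //.
- exact: subv_inj.
- move=> x; split=> [Ux|[y <-]]; [exact: (@subv_ex _ _ V)|exact: (@subt_mem _ _ V)].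
Qed.

Lemma image_ex M N (f : M -> N) : ghom f ->
  exists (S : gmod R) (io : S -> N), [/\ ghom io, injective io,
    forall x, (exists y, f y = x) <-> exists y, io y = x & forall i y, mdeg i (io y) -> mdeg i y].
Proof.
move=> hf; have [lf df] := hf; apply: gsub_ex.
  split; first by exists 0; exact: lin0.
  by move=> a _ _ [x <-] [y <-]; exists (a *: x + y); rewrite lf.
by move=> _ i [x <-]; exists (mcomp x i); rewrite (ghom_mcomp0 hf).
Qed.

Lemma kernel_ex M N (f : M -> N) : ghom f ->
  exists (S : gmod R) (io : S -> M), [/\ ghom io, injective io,
    forall x, f x = 0 <-> exists y, io y = x & forall i y, mdeg i (io y) -> mdeg i y].
Proof.
move=> hf; have [lf df] := hf; apply: gsub_ex.
  split; first exact: lin0.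
  by move=> a x y x0 y0; rewrite lf x0 y0 scaler0 addr0.
by move=> x i x0; rewrite -(ghom_mcomp0 hf) x0; exact: gcomp0.
Qed.

Lemma corestrict M N (S : gmod R) (io : S -> N) (f : M -> N) a :
  ghom io -> injective io -> (forall i y, mdeg i (io y) -> mdeg i y) ->
  @ghom _ _ M (shift N a) f -> (forall x, exists y, io y = f x) ->
  exists2 g : M -> S, @ghom _ _ M (shift S a) g & forall x, io (g x) = f x.
Proof.
move=> [lio dio] iio rio [lf df] /choice[g gE]; exists g => //; split.
  by move=> c x y; apply: iio; rewrite lio !gE lf.
by move=> i x dx; apply: rio; rewrite gE; exact: (df i).
Qed.

Lemma shift0 M N (f : M -> N) : @ghom _ _ M (shift N 0) f <-> ghom f.
Proof. by split=> -[lf df]; split=> // i x /df; rewrite /= /shift_deg addr0. Qed.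

Lemma corestrict0 M N (S : gmod R) (io : S -> N) (f : M -> N) :
  ghom io -> injective io -> (forall i y, mdeg i (io y) -> mdeg i y) ->
  ghom f -> (forall x, exists y, io y = f x) ->
  exists2 g : M -> S, ghom g & forall x, io (g x) = f x.
Proof.
move=> h1 h2 h3 /shift0 hf h4; have [g hg gE] := corestrict h1 h2 h3 hf h4.
by exists g => //; apply/shift0.
Qed.

(** [gprojective] lifts along maps that are onto; here both maps are first corestricted to the image
    of [h]. *)
Lemma proj_lift (P : gmod R) M N (h : M -> N) (f : P -> N) : gprojective P -> ghom h -> ghom f ->
  (forall x, exists y, h y = f x) -> exists2 g : P -> M, ghom g & forall x, h (g x) = f x.
Proof.
move=> pP hh hf hfE; have [S [io [hio iio imS dio]]] := image_ex hh.
have [h' hh' h'E] : exists2 h' : M -> S, ghom h' & forall x, io (h' x) = h x.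
  by apply: corestrict0 => // x; apply/imS; exists x.
have [f' hf' f'E] : exists2 f' : P -> S, ghom f' & forall x, io (f' x) = f x.
  by apply: corestrict0 => // x; apply/imS.
have [|g hg gE] := pP _ _ h' f' hh' _ hf'.
  move=> y; have [x xE] : exists x, h x = io y by apply/imS; exists y.
  by exists x; apply: iio; rewrite h'E.
by exists g => // x; rewrite -h'E gE f'E.
Qed.

End GradedModules.

(** * Independence of *Ext from the resolution, and closure properties of Cohen-Macaulay modules *)

Section ExtVanishing.
Variables (k : fieldType) (R : gring k).
Implicit Types (M N A B X : gmod R).
Hypothesis R0 : forall x : R, rdeg 0%N x <-> exists c : k, x = c%:A.
Hypothesis noeR : noetherian R.

Definition sghom M N (a : int) (f : M -> N) := @ghom _ _ M (shift N a) f.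

Lemma sghom_comp M N A (f : M -> N) (g : N -> A) a : ghom f -> sghom a g ->
  sghom a (fun x => g (f x)).
Proof. by move=> hf hg; exact: (@ghom_comp _ _ M N (shift A a) f g). Qed.

Lemma sghom_post M N A (f : M -> N) (g : N -> A) a : sghom a f -> ghom g ->
  sghom a (fun x => g (f x)).
Proof.
move=> [lf df] [lg dg]; split; first by move=> c x y; rewrite lf lg.
by move=> i x /df /dg.
Qed.

(* The degreewise form of the vanishing of *Ext^i computed on [P]. *)
Definition gext0 (P : nat -> gmod R) (d : forall i, P i.+1 -> P i) i B :=
  forall a (f : P i -> B), sghom a f -> (forall x, f (d i x) = 0) ->
  match i return (P i -> B) -> Prop with
  | 0%N => fun f => forall x, f x = 0
  | j.+1 => fun f => exists2 g : P j -> B, sghom a g & forall x, f x = g (d j x)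
  end f.

Lemma starhom_uniq M N (f : M -> N) : starhom f -> exists (s : seq int) (c : int -> M -> N),
  [/\ uniq s, forall i, sghom i (c i) & forall x, f x = \sum_(i <- s) c i x].
Proof.
move=> [s [c [hc fE]]].
exists (undup s), (fun a x => \sum_(i <- s | i == a) c i x); split.
- exact: undup_uniq.
- move=> a; rewrite /sghom; split.
    move=> b x y; rewrite scaler_sumr -big_split; apply: eq_bigr => i _.
    by case: (hc i) => ->.
  move=> i x dx; apply: (deg_sum (mdeg_grading N)) => j /eqP <-.
  by case: (hc j) => _; apply.
- move=> x; rewrite fE (exchange_big_dep xpredT) //= big_seq [RHS]big_seq.
  apply: eq_bigr => i is_; rewrite [RHS]big_mkcond /=.
  rewrite [RHS](bigD1_seq i) ?mem_undup ?undup_uniq //= eqxx big1 ?addr0 // => j.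
  by rewrite eq_sym => /negbTE ->.
Qed.

(** On an element of degree u the [c i] take values in the distinct degrees u + i, so a vanishing
    sum has vanishing terms. *)
Lemma starhom_comp0 (Q : gmod R) M N (h : Q -> M) (s : seq int) (c : int -> M -> N) : ghom h ->
  uniq s -> (forall i, sghom i (c i)) -> (forall x, \sum_(i <- s) c i (h x) = 0) ->
  forall i, i \in s -> forall x, c i (h x) = 0.
Proof.
move=> [lh dh] us hc c0 i is_.
apply: hom_eq => [a x y|a x y|u x dx]; [by rewrite lh; case: (hc i) => ->|by rewrite scaler0 addr0|].
rewrite -[i](addKr u) addrC in is_ *; move: (u + i) is_ => v is_.
apply: (grading_indep (mdeg_grading N) (s := [seq u + i | i <- s])
    (c := fun v => c (v - u) (h x)) _ _ _ (i := v)).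
- by rewrite map_inj_uniq //; exact: addrI.
- move=> w; case: (hc (w - u)) => _ /(_ u (h x) (dh _ _ dx)).
  by rewrite /= /shift_deg addrC subrK.
- by rewrite big_map -[RHS](c0 x); apply: eq_bigr => j _; rewrite addrC addKr.
- by apply/mapP; exists (v - u); rewrite // addrC subrK.
Qed.

Section Resolution.
Variables (A : gmod R) (P : nat -> gmod R) (d : forall i, P i.+1 -> P i) (e : P 0%N -> A).
Arguments d : clear implicits.
Hypothesis res : gproj_resolution d e.

Lemma starext_gext0 i B :
  (forall f : P i -> B, starhom_cocycle d f -> starhom_coboundary d f) <-> gext0 d i B.
Proof.
have [pP [he hd] _ _ _] := res.
split=> [H a f hf fd|H f [/starhom_uniq[s [c [us hc fE]]] fd]].
  have sf : starhom f.
    exists [:: a], (fun j => if j == a then f else fun=> 0); split; last first.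
      by move=> x; rewrite big_seq1 eqxx.
    by move=> j; case: eqP => [->//|_]; exact: (@ghom0 _ _ (P i) (shift B j)).
  have := H f (conj sf fd); case: i f hf fd sf {H} => [//|i] f hf fd _ /=.
  move=> [g [s [c [hc gE]]] fE].
  (* As [f] is homogeneous of degree [a], the part of [g] in that degree already maps to it. *)
  exists (fun y => \sum_(j <- s | j == a) c j y).
    split.
      move=> b x y; rewrite scaler_sumr -big_split; apply: eq_bigr => j _.
      by case: (hc j) => ->.
    move=> j x dx; apply: (deg_sum (mdeg_grading B)) => l /eqP <-.
    by case: (hc l) => _; apply.
  have ld : linear (d i) by case: (hd i).
  apply: hom_eq.
  - by case: hf.
  - move=> b x y; rewrite ld scaler_sumr -big_split; apply: eq_bigr => j _.
    by case: (hc j) => ->.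
  move=> u x dx; have [_ /(_ u x dx) dfx] := hf.
  rewrite -(gcomp_id (mdeg_grading B) dfx) fE gE gcomp_sum [RHS]big_mkcond /=.
  apply: eq_bigr => j _; have [_ dcj] := hc j.
  rewrite (gcomp_homog (mdeg_grading B) _ (dcj u (d i x) (proj2 (hd i) _ _ dx))).
  by rewrite (inj_eq (addrI u)) eq_sym.
have cd j : j \in s -> forall x, c j (d i x) = 0.
  by apply: (starhom_comp0 (hd i) us hc) => x; rewrite -fE.
case: i f c hc fE fd H cd => [|i] f c hc fE fd H cd /=.
  by move=> x; rewrite fE big1_seq // => j /andP[_ js]; apply: (H j) => //; exact: cd.
have /choice[g gP] : forall j, exists g : P i -> B, sghom j g /\
    (j \in s -> forall x, c j x = g (d i x)).
  move=> j; have [js|js] := boolP (j \in s); last first.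
    by exists (fun=> 0); split=> //; exact: (@ghom0 _ _ (P i) (shift B j)).
  by have [g hg gE] := H j (c j) (hc j) (cd j js); exists g.
exists (fun y => \sum_(j <- s) g j y).
  by exists s, g; split=> // j; case: (gP j).
by move=> x; rewrite fE; apply: eq_big_seq => j js; case: (gP j) => _; apply.
Qed.
End Resolution.

Section Comparison.
Variables (A : gmod R).
Variables (P : nat -> gmod R) (d : forall i, P i.+1 -> P i) (e : P 0%N -> A).
Variables (P' : nat -> gmod R) (d' : forall i, P' i.+1 -> P' i) (e' : P' 0%N -> A).
Arguments d : clear implicits.
Arguments d' : clear implicits.
Hypotheses (res : gproj_resolution d e) (res' : gproj_resolution d' e').

Lemma chain_lift : exists al : forall i, P' i -> P i,
  [/\ forall i, ghom (al i), forall x, e (al 0%N x) = e' x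
    & forall i x, d i (al i.+1 x) = al i (d' i x)].
Proof.
have [pP [he hd] se e0 ex] := res; have [pP' [he' hd'] se' e0' ex'] := res'.
pose L i (al : P' i -> P i) := ghom al /\ forall x, exists y, d i y = al (d' i x).
have [a0 ha0 a0E] := proj_lift noeR (pP' 0%N) he he' (fun x => se (e' x)).
have L0 : L 0%N a0.
  split=> // x; apply/e0; rewrite a0E; apply/e0'; by exists x.
have nx i (al : {al : P' i -> P i | L i al}) : {be : P' i.+1 -> P i.+1 | L i.+1 be /\
    forall x, d i (be x) = sval al (d' i x)}.
  case: al => al [hal La] /=; apply: cid.
  have [be hbe beE] := proj_lift noeR (pP' i.+1) (hd i) (ghom_comp (hd' i) hal) La.
  exists be; split=> //; split=> // x; apply/ex; rewrite beE.
  have -> : d' i (d' i.+1 x) = 0 by apply/ex'; exists x.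
  by case: hal => lal _; exact: lin0.
pose f := fix f i : {al : P' i -> P i | L i al} :=
  match i return {al : P' i -> P i | L i al} with
  | 0%N => exist _ a0 L0
  | i.+1 => exist _ (sval (nx i (f i))) (proj1 (svalP (nx i (f i)))) end.
exists (fun i => sval (f i)); split=> // i; first by case: (svalP (f i)).
by move=> x /=; exact: (proj2 (svalP (nx i (f i)))).
Qed.

Lemma homotopy (chi : forall i, P' i -> P' i) : (forall i, ghom (chi i)) ->
  (forall x, e' (chi 0%N x) = 0) -> (forall i x, d' i (chi i.+1 x) = chi i (d' i x)) ->
  exists s : forall i, P' i -> P' i.+1, [/\ forall i, ghom (s i),
    forall x, chi 0%N x = d' 0%N (s 0%N x)
    & forall i x, chi i.+1 x = d' i.+1 (s i.+1 x) + s i (d' i x)].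
Proof.
move=> hchi chi0 chid; have [pP' [he' hd'] se' e0' ex'] := res'.
pose L i (s : P' i -> P' i.+1) := ghom s /\
  forall x, d' i (chi i.+1 x - s (d' i x)) = 0.
have [s0 hs0 s0E] := proj_lift noeR (pP' 0%N) (hd' 0%N) (hchi 0%N) (fun x => proj1 (e0' _) (chi0 x)).
have L0 : L 0%N s0.
  split=> // x; rewrite (linB (proj1 (hd' 0%N))) s0E chid.
  by rewrite subrr.
have nx i (s : {s : P' i -> P' i.+1 | L i s}) : {t : P' i.+1 -> P' i.+2 | L i.+1 t /\
    forall x, chi i.+1 x = d' i.+1 (t x) + sval s (d' i x)}.
  case: s => s [hs Ls] /=; apply: cid.
  have hb : ghom (fun x => chi i.+1 x - s (d' i x)).
    by apply: ghomB => //; exact: ghom_comp.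
  have [t ht tE] := proj_lift noeR (pP' i.+1) (hd' i.+1) hb (fun x => proj1 (ex' _ _) (Ls x)).
  exists t; split; last by move=> x; rewrite tE subrK.
  split=> // x; rewrite (linB (proj1 (hd' i.+1))) tE chid.
  have -> : d' i (d' i.+1 x) = 0 by apply/ex'; exists x.
  by rewrite (lin0 (proj1 hs)) subr0 subrr.
pose f := fix f i : {s : P' i -> P' i.+1 | L i s} :=
  match i return {s : P' i -> P' i.+1 | L i s} with
  | 0%N => exist _ s0 L0
  | i.+1 => exist _ (sval (nx i (f i))) (proj1 (svalP (nx i (f i)))) end.
exists (fun i => sval (f i)); split=> // i; first by case: (svalP (f i)).
by move=> x /=; exact: (proj2 (svalP (nx i (f i)))).
Qed.
End Comparison.

(** [be \o al] is homotopic to the identity, so [f] and its pullback along it differ by a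
    coboundary. Since [starext_eq0] speaks of some resolution, this is what allows one fixed
    resolution of the residue module to be used for all modules. *)
Lemma gext0_indep A (P : nat -> gmod R) (d : forall i, P i.+1 -> P i) (e : P 0%N -> A)
    (P' : nat -> gmod R) (d' : forall i, P' i.+1 -> P' i) (e' : P' 0%N -> A) i B :
  @gproj_resolution _ _ A P d e -> @gproj_resolution _ _ A P' d' e' ->
  gext0 d i B -> gext0 d' i B.
Proof.
move=> res res' H a f hf fd.
have [pP' [he' hd'] se' e0' ex'] := res'; have [pP [he hd] se e0 ex] := res.
have [al [hal al0 ald]] := chain_lift res res'.
have [be [hbe be0 bed]] := chain_lift res' res.
pose chi i x := be i (al i x) - x.
have hchi j : ghom (chi j) by apply: ghomB; [exact: ghom_comp|exact: ghom_id].
have [||s [hs s0 sE]] := homotopy res' hchi.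
- by move=> x; rewrite /chi (linB (proj1 he')) be0 al0 subrr.
- by move=> j x; rewrite /chi (linB (proj1 (hd' j))) bed ald.
have [lf _] := hf.
have fE x : f x = f (be i (al i x)) - f (chi i x) by rewrite /chi (linB lf) opprB addrC subrK.
have hfb : sghom a (fun x => f (be i x)) by apply: sghom_comp.
have := H a _ hfb; case: i f hf fd lf fE hfb {H} => [|i] f hf fd lf fE hfb H.
  move=> x; rewrite fE (H _ (al 0%N x)) ?s0 ?fd ?subr0 //.
  by move=> y; rewrite -bed fd.
have [|g hg gE] := H; first by move=> y; rewrite -bed fd.
exists (fun y => g (al i y) - f (s i y)).
  apply: (@ghomB _ _ (P' i) (shift B a)); first exact: (sghom_comp (hal i) hg).
  exact: (sghom_comp (hs i) hf).
move=> x; rewrite fE gE ald; congr (_ - _).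
by rewrite sE (linD lf) fd add0r.
Qed.

Lemma krull_dim_down n : krull_dim_ge R n.+1 -> krull_dim_ge R n.
Proof.
move=> [p pP]; exists (fun i => p (widen_ord (leqnSn n.+1) i)) => i j ij.
exact: pP.
Qed.

Lemma krull_dim_le n m : (n <= m)%N -> krull_dim_ge R m -> krull_dim_ge R n.
Proof.
move=> /subnKC <-; elim: (m - n)%N => [|t IH]; first by rewrite addn0.
by rewrite addnS => /krull_dim_down.
Qed.

Section CohenMacaulayClosure.
Variables (P : nat -> gmod R) (d : forall i, P i.+1 -> P i) (e : P 0%N -> ResidueModule.gmod R).
Arguments d : clear implicits.
Hypothesis res : gproj_resolution d e.

Lemma gCM_gext0 M : gCM M <-> forall i, krull_dim_ge R i.+1 -> gext0 d i M.
Proof.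
split=> H i /H.
  move=> [P' [d' [e' [res' /(starext_gext0 res') g]]]].
  exact: (gext0_indep res' res g).
by move=> g; exists P, d, e; split=> //; apply/(starext_gext0 res).
Qed.

Lemma gCM_retract M N (io : M -> N) (p : N -> M) : ghom io -> ghom p -> cancel io p ->
  gCM N -> gCM M.
Proof.
move=> hio hp ip /gCM_gext0 cN; apply/gCM_gext0 => i /cN {}cN a f hf fd.
have := cN a _ (sghom_post hf hio).
case: i f hf fd {cN} => [|i] f hf fd H.
  move=> x; rewrite -[LHS]ip H ?(lin0 (proj1 hp)) // => y.
  by rewrite fd (lin0 (proj1 hio)).
have [|g hg gE] := H; first by move=> y; rewrite fd (lin0 (proj1 hio)).
exists (fun x => p (g x)); first exact: sghom_post hg hp.
by move=> x; rewrite -gE ip.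
Qed.

Lemma gCM_shift M b : gCM M -> gCM (shift M b).
Proof.
move=> /gCM_gext0 cM; apply/gCM_gext0 => i /cM {}cM a f hf fd.
have E (Q : gmod R) (g : Q -> M) : @sghom Q (shift M b) a g <-> sghom (a + b) g.
  by split=> -[lg dg]; split=> // j x /dg; rewrite /= /shift_deg addrA.
have := cM (a + b) f (proj1 (E _ f) hf) fd.
case: i f hf fd {cM} => [//|i] f hf fd [g hg gE].
by exists g => //; apply/E.
Qed.

Lemma gCM_pair M N : gCM M -> gCM N -> gCM (gpair M N).
Proof.
move=> /gCM_gext0 cM /gCM_gext0 cN; apply/gCM_gext0 => i ki a f hf fd.
have H1 := cM i ki a _ (sghom_post hf (ghom_fst M N)).
have H2 := cN i ki a _ (sghom_post hf (ghom_snd M N)).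
case: i f hf fd H1 H2 {ki cM cN} => [|i] f hf fd H1 H2.
  by move=> x; rewrite [f x]surjective_pairing H1 ?H2 // => y; rewrite fd.
have [|g1 [lg1 dg1] g1E] := H1; first by move=> y; rewrite fd.
have [|g2 [lg2 dg2] g2E] := H2; first by move=> y; rewrite fd.
exists (fun x => (g1 x, g2 x)); last by move=> x; rewrite -g1E -g2E -surjective_pairing.
split; first by move=> c x y; rewrite lg1 lg2.
by move=> j x dx; split; [exact: dg1|exact: dg2].
Qed.

(** The depth lemma: cohomology of [S] in index i+1 lies between that of [N] in index i and that of
    [B] in index i+1, and both indices are below dim R. *)
Lemma gCM_kernel (S : gmod R) B N (io : S -> B) (q : B -> N) : ghom io -> injective io ->
  (forall i y, mdeg i (io y) -> mdeg i y) -> ghom q -> (forall y, exists x, q x = y) ->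
  (forall x, q x = 0 <-> exists y, io y = x) -> gCM B -> gCM N -> gCM S.
Proof.
move=> hio iio rio hq sq kq /gCM_gext0 cB /gCM_gext0 cN; apply/gCM_gext0 => i ki a f hf fd.
have [pP [he hd] se e0 ex] := res.
have := cB i ki a _ (sghom_post hf hio).
case: i ki f hf fd {cB} => [|i] ki f hf fd H.
  move=> x; apply: iio; rewrite (lin0 (proj1 hio)); apply: H => y.
  by rewrite fd (lin0 (proj1 hio)).
have [|g hg gE] := H; first by move=> y; rewrite fd (lin0 (proj1 hio)).
have qgd x : q (g (d i x)) = 0 by rewrite -gE; apply/kq; eexists.
(* [f] is already a coboundary in [B], through [g]. Subtracting a cocycle [h] with the same image in
   [N] moves [g] into [S] without changing its coboundary. *)
suff [h hh [hd0 qh]] : exists2 h : P i -> B, sghom a h &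
    (forall x, h (d i x) = 0) /\ (forall x, q (h x) = q (g x)).
  have [||g' hg' g'E] := @corestrict _ _ (P i) B S io (fun x => g x - h x) a hio iio rio.
  - exact: (@ghomB _ _ (P i) (shift B a)).
  - by move=> x; apply/kq; rewrite (linB (proj1 hq)) qh subrr.
  by exists g' => // x; apply: iio; rewrite g'E gE hd0 subr0.
have := cN i (krull_dim_down ki) a _ (sghom_post hg hq) qgd.
case: i g hg qgd {ki f hf fd H gE} => [|i] g hg qgd H.
  exists (fun=> 0); first exact: (@ghom0 _ _ (P 0%N) (shift B a)).
  by split=> // x; rewrite H (lin0 (proj1 hq)).
have {H} [h hh hE] := H.
have hq' : @ghom _ _ (shift B a) (shift N a) q by case: hq => lq dq; split=> // j x /dq.
have [h' hh' h'E] := pP i (shift B a) (shift N a) q h hq' sq hh.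
exists (fun x => h' (d i x)); first exact: (sghom_comp (hd i) hh').
split=> x; last by rewrite h'E hE.
have -> : d i (d i.+1 x) = 0 by apply/ex; exists x.
by rewrite (lin0 (proj1 hh')).
Qed.

End CohenMacaulayClosure.

Lemma gorenstein_resolution : gorenstein R -> exists (P : nat -> gmod R)
    (d : forall i, P i.+1 -> P i) (e : P 0%N -> ResidueModule.gmod R),
  @gproj_resolution _ _ _ P d e /\
  forall i, krull_dim_ge R i.+1 -> gext0 d i (greg R).
Proof.
move=> gor; have [K [m [dg0 UK vK nk]]] := gorenstein_depth R0 noeR gor.
pose P j := @gfree _ R _ (rdg (g := K) (j := j)).
pose d j : P j.+1 -> P j := fun v => (v : 'rV[R]_(sz K j.+1)) *m rD K j.
pose e : P 0%N -> ResidueModule.gmod R := fun v => \pi_(ResidueModule.type R) ((v : 'rV[R]_1) 0 0).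
have lpi (x y : R) : \pi_(ResidueModule.type R) x = \pi_(ResidueModule.type R) y <->
    x - y \in irrelevant R.
  by split=> [/eqP|]; [rewrite -Quotient.idealrBE|exact: ResidueModule.pi_eq].
have pi0 : \pi_(ResidueModule.type R) 0 = 0 by rewrite (raddf0 \pi_(Quotient.quot (irrelevant R))).
have he : ghom e.
  split.
    move=> c x y; rewrite /e !mxE ResidueModule.piD; congr (_ + _).
    exact: (esym (ResidueModule.scale_pi c (x 0 0 : R))).
  move=> u x dx; have := dx 0 0; rewrite dg0 subr0 => dx0.
  have [->|u0] := eqVneq u 0; first by left.
  right; rewrite /e -pi0; apply/lpi; rewrite subr0; apply/irrelevantP.
  by rewrite /rcomp (gcomp_homog _ _ dx0) eq_sym (negbTE u0).
have hd j : ghom (d j).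
  split; first by move=> c x y; exact: mul_linear.
  by move=> u x dx; apply: gmxM dx (@rgmx _ _ _ K j).
have res : gproj_resolution d e.
  split=> //.
  - by move=> i; exact: gfree_projective.
  - by elim/quotW => x; exists (const_mx x); rewrite /e mxE.
  - move=> y; rewrite /e -pi0; split=> [/lpi|[x <-]].
      by rewrite subr0 => /irrelevantP /UK[w ->]; exists w.
    by apply/lpi; rewrite subr0; apply/irrelevantP/UK; exists x.
  - move=> i y; split=> [/rex[w ->]|[x <-]]; first by exists w.
    by rewrite /d -mulmxA rcx mulmx0.
exists P, d, e; split=> // i ki a f [lf df] fd.
have im : (i < m)%N.
  by rewrite ltnNge; apply/negP => mi; apply: nk; apply: krull_dim_le ki.
(* A homogeneous map from a free module to a shift of [R] is multiplication by a column, so the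
   vanishing of the cohomology of [K] applies. *)
pose c : 'cV[R]_(sz K i) := \col_l f (delta_mx 0 l).
have fE (v : 'rV[R]_(sz K i)) : f v = (v *m c) 0 0.
  rewrite {1}[v]row_sum_delta (lin_sum lf) mxE; apply: eq_bigr => l _.
  by rewrite (linZ lf) mxE.
have Zcc : Zc K i a c.
  split.
    by move=> l l'; rewrite mxE opprK; exact: (df _ _ (@delta_deg _ R _ (rdg (g := K) (j := i)) l)).
  apply/matrixP => l l'; rewrite ord1 [RHS]mxE; have := fd (delta_mx 0 l).
  by rewrite fE /d -mulmxA -rowE mxE.
have := vK i im a c Zcc.
case: i f lf df fd ki im c fE Zcc => [|i] f lf df fd ki im c fE _.
  by move=> c0 x; rewrite fE c0 mulmx0 mxE.
move=> [b gb bE]; exists (fun v => ((v : 'rV[R]_(sz K i)) *m b) 0 0).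
  split; first by move=> x v w; rewrite mulmxDl -scalemxAl !mxE.
  by move=> u x dx; have := gmxM dx gb 0 0; rewrite opprK.
by move=> x; rewrite fE bE mulmxA.
Qed.

End ExtVanishing.

(** * Hom spaces and cancellation *)

From mathcomp Require Import functions.

Section HomDimension.
Variables (k : fieldType) (R : gring k).
Implicit Types (M N A B X Y Z : gmod R).
Hypothesis R0 : forall x : R, rdeg 0%N x <-> exists c : k, x = c%:A.
Hypothesis noeR : noetherian R.

(** Seen inside the [R]-module of all functions from [M] to [N], to which the linear algebra above
    applies. *)
Definition Homs M N : set (M -> N) := fun f => ghom f.

Lemma mcomp_scale M (a : R) (x : M) i j : mdeg j x -> mcomp (a *: x) (i + j) = rcomp a i *: x.
Proof.
move=> dx; apply: (gcomp_shift (Rz_grading R) (mdeg_grading M) (f := fun a : R => a *: x)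
  (sh := fun i => i + j)).
- by move=> b c; rewrite scalerDl.
- exact: addIr.
- by move=> l b db; exact: mdegRz.
Qed.

Lemma homog_gen M : exists n (b : 'I_n -> int) (h : 'I_n -> M),
  (forall l, mdeg (b l) (h l)) /\ forall x, exists c : 'I_n -> R, x = \sum_l c l *: h l.
Proof.
have [n [g gP]] := gmod_fg M.
have /choice[S SP] := fun i => gcompP (mdeg_grading M) (g i).
pose L := flatten [seq [seq (i, u) | u <- S i] | i <- enum 'I_n].
pose h (j : 'I_(size L)) : M := mcomp (g (tnth (in_tuple L) j).1) (tnth (in_tuple L) j).2.
exists (size L), (fun j => (tnth (in_tuple L) j).2), h; split=> [l|x]; first exact: gcomp_deg.
pose W := fun x : M => exists c : 'I_(size L) -> R, x = \sum_l c l *: h l.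
have WD y z : W y -> W z -> W (y + z).
  move=> [c ->] [e ->]; exists (fun l => c l + e l).
  by rewrite -big_split; apply: eq_bigr => l _; rewrite scalerDl.
have WZ a y : W y -> W (a *: y).
  move=> [c ->]; exists (fun l => a * c l).
  by rewrite scaler_sumr; apply: eq_bigr => l _; rewrite scalerA.
have W0 : W 0 by exists (fun=> 0); rewrite big1 // => l _; rewrite scale0r.
rewrite -/(W x); have [c ->] := gP x; elim/big_ind: _ => // i _; apply: WZ.
have [us dx x0 ->] := SP i; rewrite big_seq; elim/big_ind: _ => // u uS.
have : (i, u) \in L.
  apply/flattenP; exists [seq (i, u) | u <- S i]; last by apply/mapP; exists u.
  by apply/mapP; exists i; rewrite ?mem_enum.
move=> /(tnthP (in_tuple L))[j jE]; exists (fun l => (l == j)%:R).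
rewrite (bigD1 j) //= eqxx scale1r big1 ?addr0 => [|l /negbTE ->]; last by rewrite scale0r.
by rewrite /h -jE.
Qed.

Lemma mdeg_fin M u : fdim (@mdeg _ _ M u).
Proof.
have [n [b [h [dh hP]]]] := homog_gen M.
apply: (fdim_sum (Y := fun j : 'I_n => @Rz _ R (u - b j) : set R^o) (h := fun j w => w *: h j)).
- by move=> j c x y; rewrite scalerDl scalerA.
- by move=> j; exact: Rz_fin.
- move=> z dz; have [c cE] := hP z; exists (fun j => rcomp (c j) (u - b j)); split.
    by move=> j; exact: rcomp_deg.
  rewrite -{1}(gcomp_id (mdeg_grading M) dz) cE gcomp_sum; apply: eq_bigr => j _.
  by have := mcomp_scale (c j) (u - b j) (dh j); rewrite subrK.
Qed.

Lemma ghomZ M N (c : k) (f : M -> N) : ghom f -> ghom (fun x => (c%:A : R) *: f x).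
Proof.
move=> [lf df]; split; first by move=> a x y; rewrite lf scalerDr !scalerA [a * _]mulrC.
move=> i x dx; rewrite -[i]add0r; apply: mdegRz; last exact: df.
by apply/(R0 _); exists c.
Qed.

Lemma Homs_subsp M N : subsp (@Homs M N).
Proof.
split; first exact: ghom0.
by move=> c f g hf hg; apply: (@ghomD _ _ M N) => //; exact: ghomZ.
Qed.

(** A map is determined by the images of homogeneous generators. Filtering by the maps that kill the
    first [m] of them, each step embeds into one graded piece of [N]. *)
Lemma Homs_fin M N : fdim (@Homs M N).
Proof.
have [n [b [h [dh hP]]]] := homog_gen M.
pose Am m := fun f : M -> N => ghom f /\ forall i : 'I_n, (i < m)%N -> f (h i) = 0.
suff : forall t m, (m + t)%N = n -> fdim (Am m).
  move=> H; apply: fdim_sub (H n 0%N erefl) => f hf; split=> //.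
elim=> [|t IH] m mn.
  exists 0%N; apply/qle0P => f [[lf _] f0]; apply/funext => x.
  have [c ->] := hP x; rewrite (lin_sum lf) big1 // => i _.
  by rewrite (linZ lf) f0 ?scaler0 // -[m]addn0 mn.
have mlt : (m < n)%N by lia.
have [p qp] := mdeg_fin N (b (Ordinal mlt)); have [r qr] := IH m.+1 ltac:(lia).
exists (p + r)%N; apply: (qle_ext (h := fun f : M -> N => f (h (Ordinal mlt))) (B2 := fun x => x = 0)).
- by [].
- split; first by split; [exact: ghom0|].
  move=> c f g [hf f0] [hg g0]; split; first exact: (proj2 (Homs_subsp M N)).
  by move=> i im; rewrite [LHS](_ : _ = c%:A *: f (h i) + g (h i)) // f0 // g0 // scaler0 addr0.
- exact: subsp0.
- have [v vP] := qp; exists v => f [[_ df] _]; apply: vP; exact: df.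
- apply: qle_sub qr => f [[hf f0] fm]; split=> // i; rewrite ltnS leq_eqVlt => /orP[/eqP im|]; last exact: f0.
  by rewrite (_ : i = Ordinal mlt) //; exact: val_inj.
Qed.

(** A basis exists, so the default value in [homdim] is never taken. *)
Lemma homdimP M N : isdim (@Homs M N) (homdim M N).
Proof.
have E d (f : 'I_d -> M -> N) (c : 'I_d -> k) x :
    (\sum_i (c i)%:A *: f i) x = \sum_i (c i)%:A *: f i x by rewrite fct_sumE.
suff : exists f : 'I_(homdim M N) -> M -> N, ghom_basis f.
  move=> [f [hf fi fs]]; exists f; split=> // [c c0|g hg].
    by apply: fi => x; rewrite -E c0.
  by have [c cE] := fs g hg; exists c; apply/funext => x; rewrite E.
have [d [f [hf fi fs]]] := isdim_ex (Homs_subsp M N) (proj2_sig (cid (Homs_fin M N))).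
rewrite /homdim; apply: (@xgetPex _ 0%N [set d | exists f : 'I_d -> M -> N, ghom_basis f]%classic).
exists d, f; split=> // [c c0|g hg].
  by apply: fi; apply/funext => x; rewrite E.
by have [c ->] := fs g hg; exists c => x; rewrite E.
Qed.

Lemma homdim_pos M N (f : M -> N) x : ghom f -> f x != 0 -> (0 < homdim M N)%N.
Proof.
move=> hf; apply: contraNT; rewrite lt0n negbK => /eqP d0.
have [b [_ _ sp]] := homdimP M N; rewrite d0 in b sp.
by have [c ->] := sp f hf; rewrite big_ord0.
Qed.

Lemma homdim_exact Z (S : gmod R) B N (io : S -> B) (q : B -> N) : ghom io -> injective io ->
  (forall i y, mdeg i (io y) -> mdeg i y) -> ghom q ->
  (forall x, q x = 0 <-> exists y, io y = x) ->
  (homdim Z B = (homdim Z S + homdim Z N)%N <->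
   forall f : Z -> N, ghom f -> exists2 h : Z -> B, ghom h & forall x, q (h x) = f x).
Proof.
move=> hio iio rio hq kq.
have lp (A A' : gmod R) (u : A -> A') : linear u -> klin (fun (f : Z -> A) x => u (f x)).
  by move=> lu c f g; apply/funext => x; exact: lu.
have [|||||||_ ->] := exact_dim (lp _ _ _ (proj1 hio)) (lp _ _ _ (proj1 hq))
  (homdimP Z S) (homdimP Z B) (homdimP Z N).
- by move=> f hf; exact: (ghom_comp hf hio).
- by move=> f hf; exact: (ghom_comp hf hq).
- exact: Homs_subsp.
- exact: Homs_subsp.
- move=> f hf f0; apply/funext => x; apply: iio; rewrite (lin0 (proj1 hio)).
  exact: (congr1 (fun g => g x) f0).
- by move=> f hf; apply/funext => x; apply/kq; exists (f x).
- move=> f hf qf; have [|g hg gE] := corestrict0 hio iio rio hf.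
    by move=> x; apply/kq; exact: (congr1 (fun g => g x) qf).
  by exists g => //; apply/funext => x; rewrite gE.
- split=> H f hf; have [h hh hE] := H f hf; exists h => //; last exact/funext.
  by move=> x; rewrite -hE.
Qed.

Definition retract A M := exists (i : A -> M) (p : M -> A), [/\ ghom i, ghom p & cancel i p].

Lemma retract_trans A B M : retract A B -> retract B M -> retract A M.
Proof.
move=> [i [p [hi hp ip]]] [j [q [hj hq jq]]].
exists (fun x => j (i x)), (fun x => p (q x)); split; [exact: ghom_comp|exact: ghom_comp|].
by move=> x; rewrite jq ip.
Qed.

Lemma retract_refl A : retract A A.
Proof. by exists id, id; split. Qed.

Lemma giso_retract A M : giso A M -> retract A M.
Proof. by move=> [f [g [hf hg fg gf]]]; exists f, g. Qed.

Lemma giso_sym M N : giso M N -> giso N M.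
Proof. by move=> [f [g [hf hg fg gf]]]; exists g, f. Qed.

Lemma complement A M (i : A -> M) (p : M -> A) : ghom i -> ghom p -> cancel i p ->
  exists M' (j : M' -> M) (r : M -> M'),
    [/\ ghom j, ghom r, cancel j r & forall x, p (j x) = 0] /\
    [/\ forall x, r (i x) = 0, forall x, i (p x) + j (r x) = x
      & forall X, homdim M X = (homdim A X + homdim M' X)%N].
Proof.
move=> hi hp ip; have [M' [j [hj ij kj rj]]] := kernel_ex noeR hp.
have hd : ghom (fun x => x - i (p x)).
  by apply: ghomB; [exact: ghom_id|exact: ghom_comp].
have [|r hr rE] := corestrict0 hj ij rj hd.
  by move=> x; apply/kj; rewrite (linB (proj1 hp)) ip subrr.
have pj x : p (j x) = 0 by apply/kj; exists x.
exists M', j, r; split; split=> //.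
- by move=> x; apply: ij; rewrite rE pj (lin0 (proj1 hi)) subr0.
- by move=> x; apply: ij; rewrite rE ip subrr (lin0 (proj1 hj)).
- by move=> x; rewrite rE addrC subrK.
- move=> X.
  have lp (C C' : gmod R) (u : C -> C') : klin (fun (f : C' -> X) x => f (u x)) by [].
  apply/(proj2 (exact_dim (lp _ _ p) (lp _ _ j) (homdimP A X) (homdimP M X) (homdimP M' X)
    _ _ _ _ _ _ _)).
  + by move=> f hf; exact: (ghom_comp hp hf).
  + by move=> f hf; exact: (ghom_comp hj hf).
  + exact: Homs_subsp.
  + exact: Homs_subsp.
  + move=> f hf f0; apply/funext => x; rewrite -[x]ip.
    exact: (congr1 (fun g => g (i x)) f0).
  + by move=> f hf; apply/funext => x; rewrite pj (lin0 (proj1 hf)).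
  + move=> f hf fj; exists (fun x => f (i x)); first exact: (ghom_comp hi hf).
    apply/funext => x; rewrite -[in RHS](subrK (i (p x)) x) (linD (proj1 hf)) -rE.
    by rewrite (congr1 (fun g => g (r x)) fj : f (j (r x)) = 0) add0r.
  + move=> f hf; exists (fun x => f (r x)); first exact: (ghom_comp hr hf).
    apply/funext => x; congr f; apply: ij.
    by rewrite rE pj (lin0 (proj1 hi)) subr0.
Qed.

Lemma homdim_retract A M X : retract A M -> (homdim A X <= homdim M X)%N.
Proof.
move=> [i [p [hi hp ip]]]; have [M' [j [r [_ [_ _ ->]]]]] := complement hi hp ip.
exact: leq_addr.
Qed.

Lemma homdim_giso M N X : giso M N -> homdim M X = homdim N X.
Proof.
move=> MN; apply/eqP; rewrite eqn_leq !homdim_retract //.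
  by apply: giso_retract; exact: giso_sym.
exact: giso_retract.
Qed.

Lemma ghom_iter A (f : A -> A) n : ghom f -> ghom (iter n f).
Proof. by move=> hf; elim: n => [|n IH]; [exact: ghom_id|exact: (ghom_comp IH hf)]. Qed.

(* Powers of [f] become dependent, so [f^m] is divisible by [f^(m+1)]. *)
Lemma fitting A (f : A -> A) : ghom f -> exists m (g : A -> A),
  [/\ (0 < m)%N, ghom g, forall x, g (f x) = f (g x) & forall x, iter m f x = iter m.+1 f (g x)].
Proof.
move=> hf; have [b [_ _ sp]] := homdimP A A; pose d := homdim A A.
have [c c0 cn] := dependent (w := fun i : 'I_d.+1 => (iter i f : A -> A)) (v := b) (ltnSn d)
  (fun i => sp _ (ghom_iter i hf)).
have ex : exists m, [exists i : 'I_d.+1, (i == m :> nat) && (c i != 0)].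
  by have [i ci] := cn; exists i; apply/existsP; exists i; rewrite eqxx.
(* With [m] the least exponent that occurs in the relation, solving for f^m leaves only higher
   powers. *)
case: (ex_minnP ex) => m /existsP[i /andP[/eqP im ci]] mmin.
pose g x := \sum_(j < d.+1 | (m < j)%N) ((- (c j / c i))%:A : R) *: iter (j - m.+1) f x.
have [lf _] := hf.
have hg : ghom g by apply: ghom_sum => j; apply: ghomZ; exact: ghom_iter.
have gf x : g (f x) = f (g x).
  rewrite /g (lin_sum lf); apply: eq_bigr => j _.
  by rewrite (linZ lf) -iterSr.
have fE x : iter m f x = iter m.+1 f (g x).
  have := congr1 (fun h => h x) c0; rewrite fct_sumE /= => c0x.
  have li := proj1 (ghom_iter m.+1 hf).
  rewrite /g -iterS (lin_sum li).
  have -> : iter m f x = ((c i)^-1%:A : R) *: (((c i)%:A : R) *: iter i f x).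
    by rewrite scaleAA mulVf // scaleA1 im.
  move: c0x; rewrite (bigD1 i) //= => /eqP; rewrite addr_eq0 => /eqP.
  rewrite [X in X = _ -> _](_ : _ = ((c i)%:A : R) *: iter i f x) // => ->.
  rewrite scalerN scaler_sumr -sumrN (bigID (fun j : 'I_d.+1 => (m < j)%N)) /=.
  rewrite [X in _ + X]big1 ?addr0; last first.
    move=> j /andP[ji]; rewrite -leqNgt => jm.
    have cj : c j = 0.
      apply/eqP/negPn/negP => cj; have : (m <= j)%N.
        by apply: mmin; apply/existsP; exists j; rewrite eqxx.
      move=> mj; case/eqP: ji; apply: val_inj; rewrite /= im.
      by apply/eqP; rewrite eqn_leq jm mj.
    by rewrite [X in - (_ *: X)](_ : _ = ((c j)%:A : R) *: iter j f x) // cj scaleA0 scaler0 oppr0.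
  apply: eq_big => [j|j /andP[_ mj]].
    by have [mj|] := boolP (m < j)%N; rewrite ?andbF ?andbT //; apply/eqP => jE; rewrite jE im ltnn in mj.
  rewrite -iterS (linZ li) -iterD subnKC // -scaleAN.
  by rewrite [X in _ *: X](_ : _ = ((c j)%:A : R) *: iter j f x) // scaleAA mulrC mulrN.
(* The exponent is raised by one to make it positive. *)
exists m.+1, g; split=> // x.
by rewrite iterS fE -iterS.
Qed.

Definition is_giso A (f : A -> A) := exists g : A -> A, [/\ ghom g, cancel f g & cancel g f].

(** For finite-dimensional endomorphism rings this is locality, put in the form that Fitting's lemma
    delivers. *)
Definition islocal A := (exists x : A, x != 0) /\
  forall f : A -> A, ghom f -> is_giso f \/ exists n, forall x, iter n f x = 0.

(** [E] is f^m g^m, the projection onto the stable image of [f]; it is idempotent because f^m =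
    f^(2m) g^m. *)
Lemma fitting_idempotent A (f : A -> A) : ghom f -> exists E : A -> A,
  [/\ ghom E, forall x, E (E x) = E x, (forall x, E x = x) -> is_giso f
    & (forall x, E x = 0) -> exists n, forall x, iter n f x = 0].
Proof.
move=> hf; have [m [g [m0 hg gf fE]]] := fitting hf.
have gi n x : g (iter n f x) = iter n f (g x).
  by elim: n => //= n IH; rewrite gf IH.
have gif n l x : iter l g (iter n f x) = iter n f (iter l g x).
  by elim: l => //= l IH; rewrite IH gi.
have fE2 t x : iter m f x = iter (t + m) f (iter t g x).
  elim: t => [//|t IH].
  by rewrite addSnnS iterD [iter t.+1 g x]iterS -fE -iterD.
exists (fun x => iter m f (iter m g x)); split.
- exact: (ghom_comp (ghom_iter m hg) (ghom_iter m hf)).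
- by move=> x; rewrite gif -[in LHS]iterD [RHS](fE2 m).
- move=> Eid; exists (fun x => iter m.-1 f (iter m g x)); split.
  + exact: (ghom_comp (ghom_iter m hg) (ghom_iter m.-1 hf)).
  + by move=> x; rewrite (gif 1%N m x : _ = f _) -iterSr prednK // Eid.
  + by move=> x; rewrite -iterS prednK // Eid.
- by move=> E0; exists m => x; rewrite (fE2 m) iterD E0 (lin0 (proj1 (ghom_iter m hf))).
Qed.

End HomDimension.

(** * Local summands and cancellation *)

Section Bongartz.
Variables (k : fieldType) (R : gring k).
Implicit Types (M N A B X Y Z : gmod R).
Hypothesis R0 : forall x : R, rdeg 0%N x <-> exists c : k, x = c%:A.
Hypothesis noeR : noetherian R.

(** If [A] is not local, a Fitting idempotent splits it into two nonzero summands with smaller Hom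
    dimension into [M], and [psi] is nonzero on one of them. Carrying [psi] along produces a local
    summand that still maps nontrivially to [Z]. *)
Lemma local_ex M Z (phi : M -> Z) x0 : ghom phi -> phi x0 != 0 ->
  exists A, [/\ retract A M, islocal A & exists psi : A -> Z, ghom psi /\ exists x, psi x != 0].
Proof.
move=> hphi phi0.
suff H : forall n A (psi : A -> Z) x, retract A M -> ghom psi -> psi x != 0 ->
    (homdim A M <= n)%N -> exists A, [/\ retract A M, islocal A
      & exists psi : A -> Z, ghom psi /\ exists x, psi x != 0].
  exact: (H _ M phi x0 (retract_refl M) hphi phi0 (leqnn _)).
elim=> [|n IH] A psi x rA hpsi px le.
  have [i [p [hi hp ip]]] := rA.
  have : (0 < homdim A M)%N.
    apply: (homdim_pos R0 noeR (f := i) (x := x)) => //; apply: contraNneq px => ix.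
    by rewrite -[x]ip ix (lin0 (proj1 hp)) (lin0 (proj1 hpsi)).
  by rewrite ltnNge le.
have [loc|nloc] := pselect (islocal A).
  by exists A; split=> //; exists psi; split=> //; exists x.
have x_neq0 : x != 0 by apply: contraNneq px => ->; rewrite (lin0 (proj1 hpsi)).
have [f [hf nf nn]] : exists f : A -> A, [/\ ghom f, ~ is_giso f & ~ exists n, forall x, iter n f x = 0].
  apply: contrapT => no; apply: nloc; split; first by exists x.
  move=> f hf; apply: contrapT => /not_orP[nf nn]; apply: no.
  by exists f.
have [E [hE EE Eid E0]] := fitting_idempotent R0 noeR hf.
have [A1 [io [hio iio imE rio]]] := image_ex noeR hE.
have [|p hp pE] := corestrict0 hio iio rio hE; first by move=> y; apply/imE; exists y.
have iop : cancel io p.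
  move=> y; apply: iio; rewrite pE.
  have [z zE] : exists z, E z = io y by apply/imE; exists y.
  by rewrite -zE EE.
have [A2 [j [r [[hj hr jr pj] [ri dec dimE]]]]] := complement R0 noeR hio hp iop.
have r1 : retract A1 M by apply: retract_trans rA; exists io, p.
have r2 : retract A2 M by apply: retract_trans rA; exists j, r.
have pos C : retract C M -> (exists c : C, c != 0) -> (0 < homdim C M)%N.
  move=> [i [q [hi hq iq]]] [c c0]; apply: (homdim_pos R0 noeR (f := i) (x := c)) => //.
  by apply: contraNneq c0 => ic; rewrite -[c]iq ic (lin0 (proj1 hq)).
have n1 : exists c : A1, c != 0.
  apply: contrapT => no; apply: nn; apply: E0 => y; rewrite -pE.
  have -> : p y = 0 by apply/eqP/negPn/negP => py; apply: no; exists (p y).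
  exact: lin0 (proj1 hio).
have n2 : exists c : A2, c != 0.
  apply: contrapT => no; apply: nf; apply: Eid => y; rewrite -[RHS]dec pE.
  have -> : r y = 0 by apply/eqP/negPn/negP => ry; apply: no; exists (r y).
  by rewrite (lin0 (proj1 hj)) addr0.
have := dimE M; have := pos _ r1 n1; have := pos _ r2 n2 => p2 p1 dE.
have [p0|q0] := eqVneq (psi (io (p x))) 0; last first.
  by apply: (IH A1 (fun y => psi (io y)) (p x) r1) => //; [exact: (ghom_comp hio hpsi)|lia].
apply: (IH A2 (fun y => psi (j y)) (r x) r2) => //; [exact: (ghom_comp hj hpsi)| |lia].
by move: px; rewrite -{1}[x]dec (linD (proj1 hpsi)) p0 add0r.
Qed.

(* An iterate of [f] vanishes, so the geometric series inverts [1 - f]. *)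
Lemma nilpotent_giso A (f h : A -> A) : ghom f -> ghom h -> (forall x, f x + h x = x) ->
  (exists n, forall x, iter n f x = 0) -> is_giso h.
Proof.
move=> hf hh fh [n fn]; have [lf _] := hf; have [lh _] := hh.
pose s x := \sum_(i < n) iter i f x.
have hs : ghom s by apply: ghom_sum => i; exact: ghom_iter.
have hE x : h x = x - f x by rewrite -[X in X - _]fh addrC addKr.
have hsE x : s (h x) = x.
  rewrite /s hE.
  under eq_bigr => i _ do rewrite (linB (proj1 (ghom_iter i hf))) -iterSr.
  rewrite -(big_mkord xpredT (fun i => iter i f x - iter i.+1 f x)).
  by rewrite (telescope_sumr_eq (fun i => - iter i f x)) => [||i _] //; rewrite ?fn ?oppr0 ?sub0r ?opprK // addrC.
exists s; split=> // x.
rewrite -[RHS]hsE /s (lin_sum lh); apply: eq_bigr => i _.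
elim: (nat_of_ord i) => //= j <-.
by rewrite !hE (linB lf).
Qed.

(** The endomorphisms of [A] through [B1] and through [B2] add up to the identity; if the first is
    not invertible it is nilpotent, and then the second is invertible. *)
Lemma local_pair A B1 B2 : islocal A -> retract A (gpair B1 B2) -> retract A B1 \/ retract A B2.
Proof.
move=> [_ loc] [i [p [hi hp ip]]].
have h1 : ghom (fun x => (i x).1) := ghom_comp hi (ghom_fst B1 B2).
have h2 : ghom (fun x => (i x).2) := ghom_comp hi (ghom_snd B1 B2).
have p1 : ghom (fun y : B1 => p (y, 0)) := ghom_comp (ghom_inl B1 B2) hp.
have p2 : ghom (fun y : B2 => p (0, y)) := ghom_comp (ghom_inr B1 B2) hp.
have hf := ghom_comp h1 p1; have hg := ghom_comp h2 p2.
have fg x : p ((i x).1, 0) + p (0, (i x).2) = x.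
  rewrite -(linD (proj1 hp)) -[RHS]ip; congr p.
  by rewrite [RHS]surjective_pairing; congr (_, _); rewrite /= ?addr0 ?add0r.
have inv (C : gmod R) (u : A -> C) (v : C -> A) : ghom u -> ghom v -> is_giso (fun x => v (u x)) -> retract A C.
  move=> hu hv [g [hg' gf fg']]; exists u, (fun y => g (v y)); split=> //.
  exact: (ghom_comp hv hg').
have [iso|nil] := loc _ hf; first by left; exact: (inv _ _ _ h1 p1 iso).
right; apply: (inv _ _ _ h2 p2); exact: (nilpotent_giso hf hg fg nil).
Qed.

Section Resolution.
Variables (P : nat -> gmod R) (d : forall i, P i.+1 -> P i) (e : P 0%N -> ResidueModule.gmod R).
Hypothesis res : gproj_resolution d e.
Hypothesis CMreg : gCM (greg R).

Definition Rsh (a : int) : gmod R := shift (greg R) a.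

Lemma CM_Rsh a : gCM (Rsh a).
Proof. exact: (gCM_shift noeR res a CMreg). Qed.

Section Approximation.
Variables (M : gmod R) (CM : gCM M).

(* The sums of copies of [M] and of shifts of [R] satisfy [good]. *)
Definition good B := gCM B /\
  forall A, islocal A -> retract A B -> retract A M \/ exists a, retract A (Rsh a).

Lemma good_pair B1 B2 : good B1 -> good B2 -> good (gpair B1 B2).
Proof.
move=> [c1 g1] [c2 g2]; split; first exact: (gCM_pair noeR res).
by move=> A lA /(local_pair lA)[/g1|/g2]; apply.
Qed.

Lemma good_extend N n (X : nat -> gmod R) (f : forall i, X i -> N) (B0 : gmod R) (q0 : B0 -> N) :
  (forall i, good (X i)) -> (forall i, ghom (f i)) -> good B0 -> ghom q0 ->
  exists (B : gmod R) (q : B -> N), [/\ good B, ghom q,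
    exists i0 : B0 -> B, ghom i0 /\ forall x, q (i0 x) = q0 x
    & forall i, (i < n)%N -> exists io : X i -> B, ghom io /\ forall x, q (io x) = f i x].
Proof.
move=> gX hf gB0 hq0; elim: n => [|n [B [q [gB hq [i0 [hi0 i0E]] lq]]]].
  by exists B0, q0; split=> //; exists id; split.
pose q' (z : gpair B (X n)) : N := q z.1 + f n z.2.
have hq' : ghom q'.
  by apply: ghomD; [exact: (ghom_comp (ghom_fst _ _) hq)|exact: (ghom_comp (ghom_snd _ _) (hf n))].
exists (gpair B (X n)), q'; split=> //; first exact: good_pair.
  exists (fun x => (i0 x, 0)); split; first exact: (ghom_comp hi0 (ghom_inl _ _)).
  by move=> x; rewrite /q' /= i0E (lin0 (proj1 (hf n))) addr0.
move=> i; rewrite ltnS leq_eqVlt => /orP[/eqP ->|/lq[io [hio ioE]]].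
  exists (fun x => (0, x)); split; first exact: ghom_inr.
  by move=> x; rewrite /q' /= (lin0 (proj1 hq)) add0r.
exists (fun x => (io x, 0)); split; first exact: (ghom_comp hio (ghom_inl _ _)).
by move=> x; rewrite /q' /= ioE (lin0 (proj1 (hf n))) addr0.
Qed.

Lemma approximation N : exists (B : gmod R) (q : B -> N), [/\ good B, ghom q,
  forall y, exists x, q x = y
  & forall f : M -> N, ghom f -> exists2 h : M -> B, ghom h & forall x, q (h x) = f x].
Proof.
have gM : good M by split=> // A _ rA; left.
have gR a : good (Rsh a) by split=> [|A _ rA]; [exact: CM_Rsh|right; exists a].
have [n [b [h [dh hP]]]] := homog_gen N.
(* [good_extend] takes families indexed by all natural numbers; beyond [n] the default map is
   zero. *)
pose a i := if insub i is Some l then - b l else 0.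
pose f i (x : Rsh (a i)) : N := if insub i is Some l then (x : R) *: h l else 0.
have hf i : ghom (@f i).
  rewrite /f /a; case: insubP => [l _ _|_]; last exact: ghom0.
  split; first by move=> c x y; rewrite scalerDl -scalerA.
  move=> u x dx; have := mdegRz (dx : Rz (u - b l) (x : R)) (dh l).
  by rewrite subrK.
have [B1 [q1 [g1 hq1 _ l1]]] := good_extend n (fun i => gR (a i)) hf gM (@ghom0 _ _ M N).
have [fs [hfs _ sp]] := homdimP R0 noeR M N.
pose ff i : M -> N := if insub i is Some l then fs l else fun=> 0.
have hff i : ghom (ff i) by rewrite /ff; case: insubP => [l _ _|_]; [exact: hfs|exact: ghom0].
have [B [q [gB hq [i0 [hi0 i0E]] lq]]] :=
  good_extend (homdim M N) (fun _ => gM) hff g1 hq1.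
exists B, q; split=> //.
  move=> y; have [c ->] := hP y.
  have H (l : 'I_n) : exists x, q x = c l *: h l.
    have [io [hio ioE]] := l1 l (ltn_ord l).
    have [z zE] : exists z : Rsh (a l), f l z = c l *: h l by exists (c l); rewrite /f valK.
    by exists (i0 (io z)); rewrite i0E ioE.
  have [x xE] := choice H; exists (\sum_l x l); rewrite (lin_sum (proj1 hq)).
  by apply: eq_bigr => l _.
move=> g hg; have [c gE] := sp g hg.
have H (l : 'I_(homdim M N)) : exists io : M -> B, ghom io /\ forall x, q (io x) = fs l x.
  have [io [hio ioE]] := lq l (ltn_ord l); exists io; split=> // x.
  by rewrite ioE /ff valK.
have [io ioP] := choice H.
exists (fun x => \sum_l ((c l)%:A : R) *: io l x).
  by apply: ghom_sum => l; apply: (ghomZ R0); case: (ioP l).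
move=> x; rewrite (lin_sum (proj1 hq)) gE fct_sumE; apply: eq_bigr => l _.
by rewrite (linZ (proj1 hq)); case: (ioP l) => _ ->.
Qed.
End Approximation.

Lemma local_retract_dichotomy M N : gCM M -> gCM N ->
  (forall X, gCM X -> homdim M X = homdim N X) ->
  forall A, islocal A -> retract A N -> retract A M \/ exists a, retract A (Rsh a).
Proof.
move=> cM cN MN A lA rA; have [B [q [[cB gB] hq sq lq]]] := approximation cM N.
apply: gB => //; apply: retract_trans rA _.
have [K [io [hio iio kq rio]]] := kernel_ex noeR hq.
have cK : gCM K by apply: (gCM_kernel noeR res hio iio rio hq sq kq).
have /(homdim_exact R0 noeR M hio iio rio hq kq) := lq.
rewrite !MN // => /(homdim_exact R0 noeR N hio iio rio hq kq) /(_ id (@ghom_id _ _ N))[s hs sE].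
by exists s, q.
Qed.

(** The idempotent [i \o p] is multiplication by some [s] of degree 0. Thus [s] is a nonzero
    idempotent constant, that is, 1. *)
Lemma retract_Rsh A a : islocal A -> retract A (Rsh a) -> giso A (Rsh a).
Proof.
move=> [[x0 x0n] _] [i [p [hi hp ip]]]; exists i, p; split=> //.
pose s : R := i (p (1 : R)).
have ipE (r : R) : i (p r) = r * s.
  by rewrite -[in LHS](mulr1 r) (linZ (proj1 hp) r (1 : R)) (linZ (proj1 hi)).
have ds : Rz 0 s.
  have [[_ di] [_ dp]] := (hi, hp).
  have d1 : mdeg (- a) ((1 : R) : Rsh a) by rewrite /= /shift_deg /= addNr; exact: rdeg1.
  by have := di _ _ (dp _ _ d1); rewrite /= /shift_deg /= addNr.
have s0 : s != 0.
  apply: contraNneq x0n => s0; apply/eqP; rewrite -[x0]ip.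
  have -> : i x0 = 0 by have := ipE (i x0); rewrite ip s0 mulr0.
  exact: lin0 (proj1 hp).
have ss : s * s = s by rewrite -ipE /s ip.
have [y ys] := rdeg0_unit R0 ds s0.
have s1 : s = 1 by rewrite -[LHS]mul1r -ys -mulrA ss.
by move=> r; rewrite ipE s1 mulr1.
Qed.

Lemma giso_trans M N X : giso M N -> giso N X -> giso M X.
Proof.
move=> [f [g [hf hg fg gf]]] [f' [g' [hf' hg' fg' gf']]].
exists (fun x => f' (f x)), (fun x => g (g' x)); split; [exact: ghom_comp|exact: ghom_comp| |].
  by move=> x; rewrite fg' fg.
by move=> x; rewrite gf gf'.
Qed.

Lemma hom_neq0 M N : (0 < homdim M N)%N -> exists (f : M -> N) x, ghom f /\ f x != 0.
Proof.
move=> d0; apply: contrapT => no; have [b [hb bi _]] := homdimP R0 noeR M N.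
have b0 i : b i = 0.
  by apply/funext => y; apply/eqP/negPn/negP => bn; apply: no; exists (b i), y; split=> //; exact: (hb i).
have := bi (fun=> 1) _ (Ordinal d0); rewrite big1; last by move=> i _; rewrite b0 scaler0.
by move=> /(_ erefl)/eqP; rewrite oner_eq0.
Qed.

(** R(a) is zero below degree -a. If -a exceeds the degrees of all generators of [M], every map from
    [M] to R(a) is zero. *)
Lemma Rsh_bounded M : exists D : nat, forall a, retract (Rsh a) M -> - D%:Z <= a.
Proof.
have [n [b [h [dh hP]]]] := homog_gen M.
exists (\max_l absz (b l))%N => a [i [p [hi hp ip]]]; rewrite leNgt; apply/negP => aD.
have [c cE] := hP (i (1 : R)).
have : (1 : Rsh a) = 0; last by move=> /eqP; rewrite [_ == _]oner_eq0.
have -> : (1 : Rsh a) = p (i (1 : R)) by rewrite ip.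
rewrite cE (lin_sum (proj1 hp)) big1 // => l _.
rewrite (linZ (proj1 hp)) (_ : p (h l) = 0) ?scaler0 //.
have := (proj2 hp) _ _ (dh l); rewrite /= /shift_deg /=; apply: Rz_neg.
have := leq_bigmax (F := fun l => absz (b l)) l; lia.
Qed.

(** Without a common local summand, all local summands of both modules are shifts of [R]. If R(a) is
    a summand of one module, the test module R(a) gives a nonzero map to it from some summand R(b)
    of the other; here b is at most a, and b = a would be a common summand. *)
Lemma common_local M N : gCM M -> gCM N ->
  (forall X, gCM X -> homdim M X = homdim N X) -> (exists x : M, x != 0) ->
  exists A, [/\ islocal A, retract A M & retract A N].
Proof.
move=> cM cN MN [x0 x0n]; apply: contrapT => no.
have NM X : gCM X -> homdim N X = homdim M X by move=> /MN ->.
have freeN A : islocal A -> retract A N -> exists a, giso A (Rsh a).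
  move=> lA rA; have [rM|[a ra]] := local_retract_dichotomy cM cN MN lA rA.
    by case: no; exists A.
  by exists a; exact: retract_Rsh.
have freeM A : islocal A -> retract A M -> exists a, giso A (Rsh a).
  move=> lA rA; have [rN|[a ra]] := local_retract_dichotomy cN cM NM lA rA.
    by case: no; exists A.
  by exists a; exact: retract_Rsh.
have descent U V a : (forall X, gCM X -> homdim U X = homdim V X) ->
    (forall A, islocal A -> retract A V -> exists a, giso A (Rsh a)) ->
    (~ exists A, [/\ islocal A, retract A U & retract A V]) ->
    retract (Rsh a) U -> exists2 b, b < a & retract (Rsh b) V.
  move=> UV frV noc ra; have [i [p [hi hp ip]]] := ra.
  have : (0 < homdim V (Rsh a))%N.
    rewrite -UV; last exact: CM_Rsh.
    apply: (homdim_pos R0 noeR (f := p) (x := i (1 : R))) => //.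
    by rewrite ip; exact: oner_neq0.
  move=> /(@hom_neq0 V (Rsh a))[f [y [hf fy]]].
  have [A [rA lA [psi [hpsi [z pz]]]]] := local_ex hf fy.
  have [b [u [v [hu hv uv vu]]]] := frV A lA rA.
  exists b; last by apply: retract_trans rA; exists v, u.
  rewrite lt_neqAle; apply/andP; split.
    apply/eqP => ba; apply: noc; exists A; split=> //.
    by apply: retract_trans ra; rewrite -ba; exists u, v.
  rewrite leNgt; apply/negP => ab; case/eqP: pz.
  have hpv := ghom_comp hv hpsi.
  have d1 : mdeg (- b) ((1 : R) : Rsh b) by rewrite /= /shift_deg /= addNr; exact: rdeg1.
  have v1 : psi (v (1 : R)) = 0.
    by have := (proj2 hpv) _ _ d1; rewrite /= /shift_deg /=; apply: Rz_neg; lia.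
  rewrite -[z]uv; have := linZ (proj1 hpv) (u z : R) (1 : R).
  by rewrite v1 scaler0 => <-; rewrite [_ *: _]mulr1.
have [DM DMP] := Rsh_bounded M; have [DN DNP] := Rsh_bounded N.
have [A [rA lA _]] := local_ex (@ghom_id _ _ M) x0n.
have [a Aa] := freeM A lA rA.
have raM : retract (Rsh a) M.
  by apply: retract_trans rA; apply: giso_retract; exact: giso_sym.
(* Every shift that occurs is at least [- DM] or [- DN], so this measure cannot keep decreasing. *)
suff H : forall n a, a + (DM + DN)%N%:Z <= n%:Z -> ~ (retract (Rsh a) M \/ retract (Rsh a) N).
  by apply: (H (absz (a + (DM + DN)%N%:Z)) a); [lia|left].
elim=> [|n IH] c cn [rM|rN].
- have [b bc /DNP] := descent M N c MN freeN no rM; lia.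
- have [|b bc /DMP] := descent N M c NM freeM _ rN; last lia.
  by move=> [C [lC CN CM]]; apply: no; exists C.
- have [b bc rb] := descent M N c MN freeN no rM.
  by apply: (IH b); [lia|right].
- have [|b bc rb] := descent N M c NM freeM _ rN.
    by move=> [C [lC CN CM]]; apply: no; exists C.
  by apply: (IH b); [lia|left].
Qed.

(** Splitting off a common local summand subtracts the same number from both Hom dimensions, so the
    hypothesis persists. The induction is on [M',M] with [M] fixed, because this is additive in M'
    and positive for nonzero summands of [M]. *)
Lemma hom_determines M N : gCM M -> gCM N ->
  (forall X, gCM X -> homdim M X = homdim N X) -> giso M N.
Proof.
suff H : forall n M' N', gCM M' -> gCM N' -> (forall X, gCM X -> homdim M' X = homdim N' X) ->
    retract M' M -> (homdim M' M <= n)%N -> giso M' N'.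
  by move=> cM cN MN; apply: (H _ M N cM cN MN (retract_refl M) (leqnn _)).
elim=> [|n IH] U V cU cV UV rU le.
(* If [U] is zero then so is [V]: the test module [V] gives [V,V] = [U,V] = 0. *)
all: have [[x0 x0n]|z] := pselect (exists x : U, x != 0); last first.
1,3: have U0 (x : U) : x = 0 by apply/eqP/negPn/negP => xn; apply: z; exists x.
1,2: have V0 (y : V) : y = 0.
1,3: apply/eqP/negPn/negP => yn.
1,2: have := homdim_pos R0 noeR (@ghom_id _ _ V) yn; rewrite -UV //.
1,2: by move=> /(@hom_neq0 U V)[f [x [hf]]]; rewrite (U0 x) (lin0 (proj1 hf)) eqxx.
1,2: by exists (fun=> 0), (fun=> 0); split; [exact: ghom0|exact: ghom0| |].
  have [i [p [hi hp ip]]] := rU.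
  have := homdim_pos R0 noeR (f := i) (x := x0) hi; rewrite ltnNge le /=.
  case: eqP => [ix|_ /(_ isT)//]; move: x0n.
  by rewrite -[x0]ip ix (lin0 (proj1 hp)) eqxx.
have [|A [lA [i [p [hi hp ip]]] [j [q [hj hq jq]]]]] := common_local cU cV UV; first by exists x0.
have [U' [iu [ru [[hiu hru iru pu] [rui decU dimU]]]]] := complement R0 noeR hi hp ip.
have [V' [iv [rv [[hiv hrv irv pv] [rvj decV dimV]]]]] := complement R0 noeR hj hq jq.
have [|||||f [g [hf hg fg gf]]] := IH U' V'.
- exact: (gCM_retract noeR res hiu hru iru).
- exact: (gCM_retract noeR res hiv hrv irv).
- by move=> X cX; have := UV X cX; rewrite dimU dimV => /addnI.
- by apply: retract_trans rU; exists iu, ru.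
- have [[a an] _] := lA; have [s [t [hs ht st]]] := rU.
  have : (0 < homdim A M)%N.
    apply: (homdim_pos R0 noeR (f := fun x => s (i x)) (x := a)); first exact: (ghom_comp hi hs).
    apply: contraNneq an => sa; rewrite -[a]ip -[i a]st sa.
    by rewrite (lin0 (proj1 ht)) (lin0 (proj1 hp)).
  by have := dimU M; lia.
exists (fun x => j (p x) + iv (f (ru x))), (fun y => i (q y) + iu (g (rv y))); split.
- apply: ghomD; first exact: (ghom_comp hp hj).
  exact: (ghom_comp hru (ghom_comp hf hiv)).
- apply: ghomD; first exact: (ghom_comp hq hi).
  exact: (ghom_comp hrv (ghom_comp hg hiu)).
- move=> x; rewrite (linD (proj1 hq)) jq pv addr0.
  by rewrite (linD (proj1 hrv)) rvj add0r irv fg decU.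
- move=> y; rewrite (linD (proj1 hp)) ip pu addr0.
  by rewrite (linD (proj1 hru)) rui add0r iru gf decV.
Qed.
End Resolution.

End Bongartz.

Theorem theorem2p7 (k : closedFieldType) (char0 : [pchar k] =i pred0)
    (R : gring k)
    (R0 : forall x : R, rdeg 0%N x <-> exists c : k, x = c%:A)
    (gorR : gorenstein R)
    (isoR : graded_isolated_singularity R) :
  (forall M N : gmod R, gCM M -> gCM N ->
     (forall X : gmod R, gCM X -> homdim M X = homdim N X) <-> giso M N) /\
  partial_order_on_classes (@gCM k R) (@giso k R) (@le_hom k R).
Proof.
have noeR : noetherian R by case: gorR.
have [P [d [e [res regP]]]] := gorenstein_resolution R0 noeR gorR.
have CMreg : gCM (greg R) by apply/(gCM_gext0 noeR res).
have det := hom_determines R0 noeR res CMreg.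
split=> [M N cM cN|].
  by split=> [|MN X _]; [exact: det|exact: (homdim_giso R0 noeR X MN)].
split.
- split=> [M _|M N _ _|M N X _ _ _]; [|exact: giso_sym|exact: giso_trans].
  by exists id, id; split=> //; exact: ghom_id.
- move=> M M' N N' _ _ _ _ MM' NN' le X cX.
  by rewrite -(homdim_giso R0 noeR X MM') -(homdim_giso R0 noeR X NN'); exact: le.
- by move=> M _ X _.
- move=> M N cM cN MN NM; apply: det => // X cX.
  by apply/eqP; rewrite eqn_leq MN ?NM.
- move=> M N X _ _ _ MN NX Y cY; exact: leq_trans (MN Y cY) (NX Y cY).
Qed.
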